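(* Let $p,q\geq 1$. Suppose that $X_j\subset \mathbb{C}^{m_j}$ is a bounded convex domain for $j=1,\ldots,p$, and $Y_j\subset \mathbb{C}^{n_j}$ is a bounded strongly convex domain with $C^3$-boundary for $j=1,\ldots,q$. If $p>q$, then there is no isometric embedding of $\prod_{j=1}^p X_j$ into $\prod_{j=1}^q Y_j$ under the Kobayashi distance, i.e., with $X=\prod_{j=1}^p X_j$ and $Y=\prod_{j=1}^q Y_j$, there is no map $\phi\colon X\to Y$ with $k_Y(\phi(x),\phi(x'))=k_X(x,x')$ for all $x,x'\in X$.
   Context: A domain is a non-empty connected open set; all dimensions $m_j,n_j$ are at least $1$. A bounded domain with $C^3$-boundary is strongly convex if it has a $C^3$ defining function whose real Hessian is positive definite on the real tangent space at each boundary point. Let $\Delta=\{z\in\mathbb{C}\colon |z|<1\}$ and let $\rho(z,w)=\log\frac{1+\left|\frac{w-z}{1-\bar z w}\right|}{1-\left|\frac{w-z}{1-\bar z w}\right|}$ be the hyperbolic distance on $\Delta$. For a convex domain $D\subseteq\mathbb{C}^n$ the Kobayashi distance is $$k_D(z,w)=\inf\{\rho(\zeta,\eta)\colon \exists f\colon\Delta\to D\text{ holomorphic with } f(\zeta)=z,\ f(\eta)=w\}.$$ A product of bounded convex domains is a bounded convex domain, so $k_X$ and $k_Y$ are defined in this way. An isometric embedding is a distance-preserving map; it need not be onto, and it is not assumed to be holomorphic. *)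

(* Defs.v *)
From HB Require Import structures.
From mathcomp Require Import all_boot all_order all_algebra.
From mathcomp Require Import complex.
From mathcomp Require Import all_classical all_reals all_analysis.

Set Implicit Arguments.
Unset Strict Implicit.
Unset Printing Implicit Defensive.

Import Order.TTheory GRing.Theory Num.Theory.
Import numFieldNormedType.Exports.

Local Open Scope classical_set_scope.
Local Open Scope complex_scope.
Local Open Scope ring_scope.

(* R[i] receives the topology and norm of its regular module R[i]^o, as the
   library does for abstract numFieldTypes; 'rV[R[i]]_n then carries the usual
   topology of C^n. *)
HB.instance Definition _ (R : realType) := GRing.ComAlgebra.copy R[i] R[i]^o.
HB.instance Definition _ (R : realType) := Vector.copy R[i] R[i]^o.
HB.instance Definition _ (R : realType) := NormedModule.copy R[i] R[i]^o.

(* The library's convex_set takes weights in [0, 1] of the scalar field. In the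
   order of R[i], 0 <= l <= 1 forces l to be real, so over R[i] it is the usual
   real convexity. Likewise the bound in bounded_set is a real number. *)

Section Domains.
Context {R : realType} {n : nat}.
Implicit Types (D U : set 'rV[R[i]]_n) (r : 'rV[R[i]]_n -> R).

Definition domain D : Prop := [/\ D !=set0, open D & connected D].

Definition bounded_convex_domain D : Prop :=
  [/\ domain D, bounded_set D & convex_set D].

Definition boundary D : set 'rV[R[i]]_n := closure D `\` D°.

(* C^n seen as a real vector space: t |-> r (z + t v) has a real parameter t. *)
Definition real_derivable r (v z : 'rV[R[i]]_n) : Prop :=
  derivable (fun t : R => r (z + t%:C *: v)) 0 1.

Definition real_derive (v : 'rV[R[i]]_n) r : 'rV[R[i]]_n -> R :=
  fun z => derive1 (fun t : R => r (z + t%:C *: v)) 0.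

(* Class C^k on U in the real sense: iterated directional derivatives up to
   order k exist and are continuous on U. *)
Fixpoint real_Ck (k : nat) U r : Prop :=
  (forall z, U z -> {for z, continuous r}) /\
  if k is k'.+1 then
    forall v, (forall z, U z -> real_derivable r v z) /\
              real_Ck k' U (real_derive v r)
  else True.

Definition real_hessian r (z v w : 'rV[R[i]]_n) : R :=
  real_derive v (real_derive w r) z.

(* r is only required to be C^k on an open neighbourhood U of the boundary;
   that r vanishes on the boundary of an open D follows. *)
Definition Ck_defining_function (k : nat) D U r : Prop :=
  [/\ open U,
      boundary D `<=` U,
      real_Ck k U r,
      D `&` U = [set z | U z /\ r z < 0]
    & forall z, boundary D z -> exists v, real_derive v r z != 0].

Definition real_tangent r (z : 'rV[R[i]]_n) : set 'rV[R[i]]_n :=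
  [set v | real_derive v r z = 0].

Definition strongly_convex_C3_domain D : Prop :=
  [/\ domain D, bounded_set D
    & exists U r, Ck_defining_function 3 D U r /\
        forall z, boundary D z ->
        forall v, real_tangent r z v -> v != 0 -> 0 < real_hessian r z v v].

End Domains.

Section Kobayashi.
Context {R : realType}.

Definition unit_disc : set R[i] := [set z | `|z| < 1].

(* `|z| is an element of R[i]; its real part is the modulus as an element of R. *)
Definition modulus (z : R[i]) : R := complex.Re `|z|.

Definition hyperbolic_dist (z w : R[i]) : R :=
  let t := modulus ((w - z) / (1 - z^*%C * w)) in
  ln ((1 + t) / (1 - t)).

(* f is total, but unit_disc is open, so only its values there matter. *)
Definition holomorphic_disc n (D : set 'rV[R[i]]_n)
    (f : R[i] -> 'rV[R[i]]_n) : Prop :=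
  forall z, unit_disc z -> derivable f z 1 /\ D (f z).

(* The infimum is taken in the extended reals, where the empty set has
   infimum +oo; for a convex domain D and points of D the set is nonempty and
   the infimum is a nonnegative real. *)
Definition kobayashi n (D : set 'rV[R[i]]_n) (z w : 'rV[R[i]]_n) : \bar R :=
  ereal_inf [set d | exists zeta eta : R[i],
    [/\ unit_disc zeta, unit_disc eta,
        exists f, [/\ holomorphic_disc D f, f zeta = z & f eta = w]
      & d = (hyperbolic_dist zeta eta)%:E]].

(* The product of the X j inside C^(m_1 + ... + m_p): submxrow z j is the j-th
   block of coordinates of z. *)
Definition prod_domain p (m : 'I_p -> nat)
    (X : forall j, set 'rV[R[i]]_(m j)) : set 'rV[R[i]]_(\sum_j m j) :=
  [set z | forall j, X j (submxrow z j)].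

Definition isometric_embedding m n (X : set 'rV[R[i]]_m) (Y : set 'rV[R[i]]_n)
    (phi : 'rV[R[i]]_m -> 'rV[R[i]]_n) : Prop :=
  (forall x, X x -> Y (phi x)) /\
  (forall x x', X x -> X x' ->
     kobayashi Y (phi x) (phi x') = kobayashi X x x').

End Kobayashi.

(* Main.v *)
(* With T = exp t, distances are handled multiplicatively: Kle X z w T means that the
   distance from z to w is at most ln T.

   In a factor X_i of X, every base point o_i lies, up to a bounded error, in the middle of
   two points x_i+ and x_i- at distance ln T, so that x_i+ and x_i- are at distance at least
   2 ln T - ln 2. Moving only the i-th coordinate of o gives points a_i+ and a_i- of X with
   the same property, while a_i and a_j are at distance at most ln T for i <> j. Under an
   isometric embedding some factor Y_c of Y must separate a_i+ from a_i-; since q < p, two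
   indices i <> j share the same c. So Y_c contains points P, P' (images of a_i+, a_i-) and
   Q (image of a_j+) with P, P' almost opposite as seen from the image of o, and with Q at
   distance at most ln T from both, all at distance nearly ln T from that base point.

   This is impossible in a strongly convex domain when T is large. The points P, P', Q are
   close to the boundary, and a disc through P and Q that is almost a geodesic stays close
   to the boundary, where strong convexity makes its Euclidean speed at most the square
   root of the depth; summing a geometric series shows that P and Q are close to each other.
   So are P' and Q, hence P and P'. But two points of depth about 1/T at Euclidean distance s
   are at most 2 ln (s T) + O(1) apart, because of the interior ball condition, and s can be
   taken small. *)

Require Import Defs.
From HB Require Import structures.
From mathcomp Require Import all_boot all_order all_algebra.
From mathcomp Require Import complex.
From mathcomp Require Import all_classical all_reals all_analysis.
From mathcomp Require Import ring lra zify.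

Set Implicit Arguments.
Unset Strict Implicit.
Unset Printing Implicit Defensive.

Import Order.TTheory GRing.Theory Num.Theory.
Import numFieldNormedType.Exports.

Local Open Scope classical_set_scope.
Local Open Scope complex_scope.
Local Open Scope ring_scope.

Local Notation Re := (@complex.Re _).
Local Notation Im := (@complex.Im _).

(** * Continuity and derivatives of one complex variable *)

(** The map [phi] carries metric information only, so the obstruction must be a statement about
    finitely many points and their distances: o, P, P', Q, Q' in one factor. It is quantitative.
    Each loss is a factor bounded independently of T, and large T absorbs it. For this reason no
    limit of discs is taken: in place of extremal discs stand discs that are optimal up to a factor
    2 ([Kd_halving]) or up to a small defect of the derivative at 0 ([line_points]).

    A distance is defined by a single disc through two points, so its triangle inequality is a
    theorem about convex domains. One device gives both this inequality ([Kd_glue]) and the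
    approximate midpoints ([glue_jet]): two discs are combined with a rational coefficient that is
    real, between 0 and 1, on the unit circle, and the maximum principle [hull] keeps the result in
    the domain.

    Strong convexity enters the metric part through [peg] alone. At the boundary point nearest to P
    there is an interior ball of fixed radius, which bounds distances from above, and a supporting
    hyperplane from which the domain recedes quadratically, which bounds the movement of discs. *)

Section Modulus.
Context {R : realType}.
Implicit Types z w : R[i].

Lemma modulusE z : modulus z = Num.sqrt (Re z ^+ 2 + Im z ^+ 2).
Proof. by rewrite /modulus normc_def. Qed.

Lemma modulusC z : (modulus z)%:C = `|z|.
Proof. by rewrite modulusE normc_def. Qed.

Lemma modulus_ge0 z : 0 <= modulus z.
Proof. by rewrite modulusE sqrtr_ge0. Qed.

Lemma modulus_sqr z : modulus z ^+ 2 = Re z ^+ 2 + Im z ^+ 2.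
Proof. by rewrite modulusE sqr_sqrtr// addr_ge0// sqr_ge0. Qed.

Lemma modulusM z w : modulus (z * w) = modulus z * modulus w.
Proof. by apply: complexI; rewrite rmorphM/= !modulusC normrM. Qed.

Lemma modulusD z w : modulus (z + w) <= modulus z + modulus w.
Proof. by rewrite -lecR rmorphD/= !modulusC ler_normD. Qed.

Lemma modulusN z : modulus (- z) = modulus z.
Proof. by rewrite /modulus normrN. Qed.

Lemma modulusBC z w : modulus (z - w) = modulus (w - z).
Proof. by rewrite -modulusN opprB. Qed.

Lemma modulusB z w : modulus (z - w) <= modulus z + modulus w.
Proof. by rewrite -(modulusN w) modulusD. Qed.

Lemma modulus0 : modulus (0 : R[i]) = 0.
Proof. by rewrite /modulus normr0. Qed.

Lemma modulus1 : modulus (1 : R[i]) = 1.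
Proof. by rewrite /modulus normr1. Qed.

Lemma modulus_eq0 z : (modulus z == 0) = (z == 0).
Proof. by rewrite -(inj_eq (@complexI R)) modulusC normr_eq0. Qed.

Lemma modulus_gt0 z : (0 < modulus z) = (z != 0).
Proof. by rewrite lt_neqAle modulus_ge0 andbT eq_sym modulus_eq0. Qed.

Lemma modulus_real (x : R) : modulus x%:C = `|x|.
Proof. by rewrite modulusE/= expr0n addr0 sqrtr_sqr. Qed.

Lemma modulusi : modulus ('i%C : R[i]) = 1.
Proof. by rewrite modulusE/= expr0n add0r expr1n sqrtr1. Qed.

Lemma modulusV z : modulus z^-1 = (modulus z)^-1.
Proof. by apply: complexI; rewrite modulusC normfV -modulusC fmorphV. Qed.

Lemma modulusX z n : modulus (z ^+ n) = modulus z ^+ n.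
Proof. by elim: n => [|n ih]; rewrite ?expr0 ?modulus1// !exprS modulusM ih. Qed.

Lemma modulusJ z : modulus z^*%C = modulus z.
Proof. by rewrite /modulus normcJ. Qed.

Lemma Re_le_modulus z : `|Re z| <= modulus z.
Proof. by rewrite modulusE -sqrtr_sqr ler_wsqrtr// lerDl sqr_ge0. Qed.

Lemma Im_le_modulus z : `|Im z| <= modulus z.
Proof. by rewrite modulusE -sqrtr_sqr ler_wsqrtr// lerDr sqr_ge0. Qed.

Lemma modulus_le_ReIm z : modulus z <= `|Re z| + `|Im z|.
Proof.
rewrite {1}(complexE z); apply: le_trans (modulusD _ _) _.
by rewrite modulusM modulusi mul1r !modulus_real.
Qed.

Lemma modulus_sub_lt z w r : modulus (z - w) < r -> modulus z < modulus w + r.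
Proof.
move=> h; rewrite -(subrK w z); apply: le_lt_trans (modulusD _ _) _.
by rewrite addrC ltrD2l.
Qed.

Lemma modulus_ltC z (r : R) : (`|z| < r%:C) = (modulus z < r).
Proof. by rewrite -modulusC ltcR. Qed.

Lemma RecM z w : Re (z * w) = Re z * Re w - Im z * Im w.
Proof. by case: z; case: w. Qed.

Lemma ImcM z w : Im (z * w) = Re z * Im w + Im z * Re w.
Proof. by case: z; case: w. Qed.

Lemma RecD z w : Re (z + w) = Re z + Re w.
Proof. by case: z; case: w. Qed.

Lemma ImcD z w : Im (z + w) = Im z + Im w.
Proof. by case: z; case: w. Qed.

Lemma RecN z : Re (- z) = - Re z.
Proof. by case: z. Qed.

Lemma ImcN z : Im (- z) = - Im z.
Proof. by case: z. Qed.

Lemma modulus_mulJ z : z * z^*%C = ((modulus z) ^+ 2)%:C.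
Proof. by rewrite -sqr_normc rmorphXn/= modulusC. Qed.

Lemma complex_ext z w : Re z = Re w -> Im z = Im w -> z = w.
Proof. by case: z; case: w => /= a b c d -> ->. Qed.

End Modulus.

Section ComplexContinuity.
Context {R : realType}.
Implicit Types (f g : R[i] -> R[i]) (z w : R[i]).

(** Radii are real numbers here, whereas the balls of [R[i]] have radii in [R[i]]; [nbhs_modulusP]
    relates the two. *)
Definition ccont f z := forall e : R, 0 < e -> exists2 d : R, 0 < d &
  forall w, modulus (w - z) < d -> modulus (f w - f z) < e.

Lemma ccont_cst c z : ccont (fun=> c) z.
Proof. by move=> e e0; exists 1 => // w _; rewrite subrr modulus0. Qed.

Lemma ccont_id z : ccont id z.
Proof. by move=> e e0; exists e. Qed.

Lemma ccont_bounded f z : ccont f z ->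
  exists2 d : R, 0 < d & forall w, modulus (w - z) < d -> modulus (f w) < modulus (f z) + 1.
Proof.
move=> /(_ 1 ltr01)[d d0 h]; exists d => // w /h; exact: modulus_sub_lt.
Qed.

Lemma ccontD f g z : ccont f z -> ccont g z -> ccont (fun w => f w + g w) z.
Proof.
move=> hf hg e e0; have e2 : 0 < e / 2 by rewrite divr_gt0.
have [d d0 hd] := hf _ e2; have [d' d'0 hd'] := hg _ e2.
exists (Num.min d d') => [|w]; first by rewrite lt_min d0.
rewrite lt_min => /andP[/hd h1 /hd' h2].
rewrite opprD addrACA; apply: le_lt_trans (modulusD _ _) _.
by rewrite (splitr e) ltrD.
Qed.

Lemma ccontM f g z : ccont f z -> ccont g z -> ccont (fun w => f w * g w) z.
Proof.
move=> hf hg e e0.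
have [d1 d10 hd1] := ccont_bounded hf.
pose M := modulus (f z) + 1 + modulus (g z) + 1.
have M0 : 0 < M by rewrite /M; have := modulus_ge0 (f z); have := modulus_ge0 (g z); lra.
have e2 : 0 < e / (2 * M) by rewrite divr_gt0// mulr_gt0.
have [d d0 hd] := hf _ e2; have [d' d'0 hd'] := hg _ e2.
exists (Num.min d1 (Num.min d d')) => [|w]; first by rewrite !lt_min d10 d0.
rewrite !lt_min => /and3P[/hd1 h1 /hd h2 /hd' h3].
have -> : f w * g w - f z * g z = f w * (g w - g z) + (f w - f z) * g z by ring.
apply: le_lt_trans (modulusD _ _) _; rewrite !modulusM.
apply: le_lt_trans (_ : M * modulus (g w - g z) + modulus (f w - f z) * M < _).
  rewrite lerD// ?ler_wpM2r ?ler_wpM2l ?modulus_ge0//.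
    by apply: le_trans (ltW h1) _; rewrite /M; have := modulus_ge0 (g z); lra.
  by rewrite /M; have := modulus_ge0 (f z); lra.
have -> : e = M * (e / (2 * M)) + (e / (2 * M)) * M by field; rewrite gt_eqF.
by rewrite ltrD// ?ltr_pM2l ?ltr_pM2r.
Qed.

Lemma ccontV f z : f z != 0 -> ccont f z -> ccont (fun w => (f w)^-1) z.
Proof.
move=> fz hf e e0; have m0 : 0 < modulus (f z) by rewrite modulus_gt0.
set m := modulus (f z) in m0 *.
have [d d0 hd] := hf (m / 2) (divr_gt0 m0 (ltr0n _ 2)).
have [d' d'0 hd'] := hf (e * (m * m / 2)) (mulr_gt0 e0 (divr_gt0 (mulr_gt0 m0 m0) (ltr0n _ 2))).
exists (Num.min d d') => [|w]; first by rewrite lt_min d0.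
rewrite lt_min => /andP[/hd h1 /hd' h2].
have fw : m / 2 < modulus (f w).
  rewrite modulusBC in h1.
  by have := modulus_sub_lt h1; rewrite -/m; lra.
have fw0 : f w != 0 by rewrite -modulus_gt0; apply: lt_trans fw; rewrite divr_gt0.
have -> : (f w)^-1 - (f z)^-1 = (f z - f w) * ((f w)^-1 * (f z)^-1).
  by field; rewrite fz fw0.
rewrite !modulusM !modulusV -/m modulusBC.
have mw : 0 < modulus (f w) by rewrite modulus_gt0.
rewrite -invfM ltr_pdivrMr ?mulr_gt0//.
apply: lt_le_trans h2 _; rewrite ler_wpM2l ?(ltW e0)//.
by rewrite mulrAC ler_wpM2r ?(ltW m0)// ltW.
Qed.

Lemma ccont_comp f g z : ccont g z -> ccont f (g z) -> ccont (f \o g) z.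
Proof.
move=> hg hf e /hf[d d0 hd]; have [d' d'0 hd'] := hg d d0.
by exists d' => // w /hd' /hd.
Qed.

Lemma ccontN f z : ccont f z -> ccont (fun w => - f w) z.
Proof.
by move=> hf e /hf[d d0 h]; exists d => // w /h; rewrite -opprD modulusN.
Qed.

Lemma ccontB f g z : ccont f z -> ccont g z -> ccont (fun w => f w - g w) z.
Proof. by move=> hf hg; apply: ccontD => //; exact: ccontN. Qed.

Lemma ccont_modulus f z : ccont f z -> ccont (fun w => (modulus (f w))%:C) z.
Proof.
move=> hf e /hf[d d0 h]; exists d => // w /h; apply: le_lt_trans.
rewrite -rmorphB/= modulus_real ler_norml.
have := modulusD (f w - f z) (f z); have := modulusD (f z - f w) (f w).
by rewrite !subrK (modulusBC (f z)) => h1 h2; apply/andP; split; lra.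
Qed.

Lemma ccont_near f g z (r : R) : 0 < r ->
  (forall w, modulus (w - z) < r -> f w = g w) -> ccont f z -> ccont g z.
Proof.
move=> r0 fg hf e /hf[d d0 h]; exists (Num.min d r) => [|w]; first by rewrite lt_min d0.
by rewrite lt_min => /andP[/h h1 h2]; rewrite -!fg// subrr modulus0.
Qed.

(* Caratheodory's form of the derivative turns every rule of calculus below
   into an algebraic identity between continuous quotients. *)
Definition cder f z (l : R[i]) :=
  exists q, [/\ ccont q z, q z = l & forall w, f w = f z + (w - z) * q w].

Definition chol f z := exists l, cder f z l.

Lemma cder_cont f z l : cder f z l -> ccont f z.
Proof.
move=> [q [cq _ fE]]; apply: (@ccont_near (fun w => f z + (w - z) * q w) _ _ 1) => //.
apply: ccontD; first exact: ccont_cst.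
apply: ccontM => //; apply: ccontB; [exact: ccont_id|exact: ccont_cst].
Qed.

Lemma chol_cont f z : chol f z -> ccont f z.
Proof. by case=> l; exact: cder_cont. Qed.

Lemma cder_cst c z : cder (fun=> c) z 0.
Proof. by exists (fun=> 0); split=> [||w]; rewrite ?mulr0 ?addr0//; exact: ccont_cst. Qed.

Lemma cder_id z : cder id z 1.
Proof. by exists (fun=> 1); split=> [||w]; rewrite ?mulr1 ?subrKC//; exact: ccont_cst. Qed.

Lemma cderD f g z k l : cder f z k -> cder g z l ->
  cder (fun w => f w + g w) z (k + l).
Proof.
move=> [p [cp pz fE]] [q [cq qz gE]]; exists (fun w => p w + q w); split.
- exact: ccontD.
- by rewrite pz qz.
- by move=> w; rewrite (fE w) (gE w); ring.
Qed.

Lemma cderM f g z k l : cder f z k -> cder g z l ->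
  cder (fun w => f w * g w) z (k * g z + f z * l).
Proof.
move=> hf hg; have cg := cder_cont hg.
have [p [cp pz fE]] := hf; have [q [cq qz gE]] := hg.
exists (fun w => p w * g w + f z * q w); split.
- by apply: ccontD; apply: ccontM => //; exact: ccont_cst.
- by rewrite pz qz.
- by move=> w; rewrite (fE w) (gE w); ring.
Qed.

Lemma ccont_neq0 f z : ccont f z -> f z != 0 ->
  exists2 r : R, 0 < r & forall w, modulus (w - z) < r -> f w != 0.
Proof.
move=> cf fz; have [r r0 h] := cf _ (eq_ind_r is_true fz (modulus_gt0 (f z))).
exists r => // w /h; apply: contraTN => /eqP ->.
by rewrite sub0r modulusN ltxx.
Qed.

(** The factorisation in [cder] is required at every w, so the quotient of g is built afresh on the
    whole plane, with the value l at z; only near z does it have to agree with the quotient of f. *)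
Lemma cder_near f g z (r : R) l : 0 < r ->
  (forall w, modulus (w - z) < r -> f w = g w) -> cder f z l -> cder g z l.
Proof.
move=> r0 fg [q [cq qz fE]].
exists (fun w => if w == z then l else (g w - g z) / (w - z)); split.
- apply: (@ccont_near q _ _ r) => // w wr.
  case: eqP => [->//|/eqP wz]; rewrite -!fg// ?subrr ?modulus0// fE addrAC subrr add0r.
  by rewrite mulrC mulKf// subr_eq0.
- by rewrite eqxx.
- move=> w; case: eqP => [->|/eqP wz]; first by rewrite subrr mul0r addr0.
  by rewrite mulrCA divff ?subr_eq0// mulr1 subrKC.
Qed.

Lemma cderV f z l : f z != 0 -> cder f z l ->
  cder (fun w => (f w)^-1) z (- l / (f z) ^+ 2).
Proof.
move=> fz hf; have cf := cder_cont hf; have [q [cq qz fE]] := hf.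
have [r r0 hr] := ccont_neq0 cf fz.
(* f may vanish far from z, where the algebraic identity for the inverse fails. The function
   substituted here has the right quotient everywhere and equals the inverse near z. *)
apply: (@cder_near (fun w => (f z)^-1 + (w - z) * (- q w * ((f w)^-1 * (f z)^-1))) _ _ r) => //.
  move=> w /hr fw; rewrite (_ : (w - z) * _ = - (f w - f z) * ((f w)^-1 * (f z)^-1)).
    by field; rewrite fz fw.
  by rewrite (fE w); ring.
exists (fun w => - q w * ((f w)^-1 * (f z)^-1)); split.
- apply: ccontM; first exact: ccontN.
  by apply: ccontM; [exact: ccontV|exact: ccont_cst].
- by rewrite qz expr2 invfM.
- by move=> w; rewrite subrr mul0r addr0.
Qed.

Lemma cder_comp f g z k l : cder g z l -> cder f (g z) k ->
  cder (f \o g) z (k * l).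
Proof.
move=> hg; have cg := cder_cont hg; case: hg => q [cq qz gE] [p [cp pz fE]].
exists (fun w => p (g w) * q w); split.
- by apply: ccontM => //; exact: (ccont_comp cg cp).
- by rewrite pz qz.
- by move=> w /=; rewrite (fE (g w)) {1}(gE w); ring.
Qed.

Lemma chol_cst c z : chol (fun=> c) z.
Proof. by exists 0; exact: cder_cst. Qed.

Lemma chol_id z : chol id z.
Proof. by exists 1; exact: cder_id. Qed.

Lemma cholD f g z : chol f z -> chol g z -> chol (fun w => f w + g w) z.
Proof. by move=> [k hk] [l hl]; exists (k + l); exact: cderD. Qed.

Lemma cholM f g z : chol f z -> chol g z -> chol (fun w => f w * g w) z.
Proof. by move=> [k hk] [l hl]; eexists; exact: cderM hk hl. Qed.

Lemma cholN f z : chol f z -> chol (fun w => - f w) z.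
Proof.
move=> /(cholM (chol_cst (-1) z)).
by rewrite (_ : (fun w => -1 * f w) = (fun w => - f w)) //; apply/funext => w; rewrite mulN1r.
Qed.

Lemma cholB f g z : chol f z -> chol g z -> chol (fun w => f w - g w) z.
Proof. by move=> hf hg; apply: cholD => //; exact: cholN. Qed.

Lemma cholV f z : f z != 0 -> chol f z -> chol (fun w => (f w)^-1) z.
Proof. by move=> fz [k hk]; eexists; exact: cderV hk. Qed.

Lemma chol_comp f g z : chol g z -> chol f (g z) -> chol (f \o g) z.
Proof. by move=> [k hk] [l hl]; eexists; exact: cder_comp hk hl. Qed.

Lemma chol_near f g z (r : R) : 0 < r ->
  (forall w, modulus (w - z) < r -> f w = g w) -> chol f z -> chol g z.
Proof. by move=> r0 fg [l hl]; exists l; exact: (cder_near r0 fg hl). Qed.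

Lemma chol_sum (I : Type) (s : seq I) (F : I -> R[i] -> R[i]) z :
  (forall i, chol (F i) z) -> chol (fun w => \sum_(i <- s) F i w) z.
Proof.
move=> h; elim: s => [|i s ih].
  by rewrite (_ : (fun _ => _) = fun=> 0); [exact: chol_cst|apply/funext => w; rewrite big_nil].
rewrite (_ : (fun _ => _) = fun w => F i w + \sum_(j <- s) F j w); first exact: cholD.
by apply/funext => w; rewrite big_cons.
Qed.

End ComplexContinuity.

(** * Integrals, Goursat's theorem and the mean value property *)

Section PathIntegral.
Context {R : realType}.
Implicit Types (p q : R -> R[i]) (a b c t : R).

Definition pcont p t := forall e : R, 0 < e -> exists2 d : R, 0 < d &
  forall s, `|s - t| < d -> modulus (p s - p t) < e.

Definition rint (u : R -> R) a b := \int[lebesgue_measure]_(t in `[a, b]) u t.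

Definition cint p a b : R[i] :=
  rint (fun t => Re (p t)) a b +i* rint (fun t => Im (p t)) a b.

Lemma Re_cint p a b : Re (cint p a b) = rint (fun t => Re (p t)) a b.
Proof. by []. Qed.

Lemma Im_cint p a b : Im (cint p a b) = rint (fun t => Im (p t)) a b.
Proof. by []. Qed.

Lemma pcont_rcont (u : R -> R) p t : (forall s, `|u s - u t| <= modulus (p s - p t)) ->
  pcont p t -> {for t, continuous u}.
Proof.
move=> h cp; apply/cvgrPdist_lt => e /cp[d d0 hd].
apply/nbhs_ballP; exists d => //= s; rewrite /ball/= distrC => /hd.
by rewrite distrC; exact: le_lt_trans.
Qed.

Lemma pcont_Re p t : pcont p t -> {for t, continuous (fun s => Re (p s))}.
Proof. by apply: pcont_rcont => s; rewrite -RecN -RecD Re_le_modulus. Qed.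

Lemma pcont_Im p t : pcont p t -> {for t, continuous (fun s => Im (p s))}.
Proof. by apply: pcont_rcont => s; rewrite -ImcN -ImcD Im_le_modulus. Qed.

Lemma rint_integrable (u : R -> R) a b : (forall t, a <= t <= b -> {for t, continuous u}) ->
  lebesgue_measure.-integrable `[a, b] (EFin \o u).
Proof.
move=> cu; apply: continuous_compact_integrable; first exact: segment_compact.
apply: continuous_in_subspaceT => t; rewrite inE /= in_itv /=; exact: cu.
Qed.

Lemma rint_cst (k : R) a b : a <= b -> rint (fun=> k) a b = k * (b - a).
Proof.
move=> ab; rewrite /rint Rintegral_cst//= lebesgue_measure_itv/= lte_fin.
by case: ltP => //= ba; rewrite (@le_anti _ _ a b) ?ab// subrr.
Qed.

Lemma rint_split (u : R -> R) a c b : a <= c <= b ->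
  (forall t, a <= t <= b -> {for t, continuous u}) ->
  rint u a b = rint u a c + rint u c b.
Proof.
move=> /andP[ac cb] cu; have iu := rint_integrable cu.
apply/eqP; rewrite addrC -subr_eq; apply/eqP; rewrite /rint.
rewrite Rintegral_itvB// ?bnd_simp//.
rewrite Rintegral_itv_obnd_cbnd//.
by apply: integrableS iu => //; apply: subset_itv; rewrite bnd_simp.
Qed.

Lemma le_rint (u v : R -> R) a b :
  (forall t, a <= t <= b -> {for t, continuous u}) ->
  (forall t, a <= t <= b -> {for t, continuous v}) ->
  (forall t, a <= t <= b -> u t <= v t) -> rint u a b <= rint v a b.
Proof.
by move=> cu cv uv; apply: le_Rintegral => //; exact: rint_integrable.
Qed.

Lemma rintD (u v : R -> R) a b :
  (forall t, a <= t <= b -> {for t, continuous u}) ->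
  (forall t, a <= t <= b -> {for t, continuous v}) ->
  rint (fun t => u t + v t) a b = rint u a b + rint v a b.
Proof. by move=> cu cv; apply: RintegralD => //; exact: rint_integrable. Qed.

Lemma rintZ (k : R) (u : R -> R) a b :
  (forall t, a <= t <= b -> {for t, continuous u}) ->
  rint (fun t => k * u t) a b = k * rint u a b.
Proof. by move=> cu; apply: RintegralZl => //; exact: rint_integrable. Qed.

Lemma eq_rint (u v : R -> R) a b : (forall t, a <= t <= b -> u t = v t) ->
  rint u a b = rint v a b.
Proof. by move=> uv; apply: eq_Rintegral => t; rewrite inE /= in_itv/=; exact: uv. Qed.

Lemma eq_cint p q a b : (forall t, a <= t <= b -> p t = q t) -> cint p a b = cint q a b.
Proof. by move=> pq; congr (_ +i* _); apply: eq_rint => t /pq ->. Qed.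

Lemma cint_cst k a b : a <= b -> cint (fun=> k) a b = k * (b - a)%:C.
Proof.
move=> ab; apply: complex_ext; rewrite ?Re_cint ?Im_cint rint_cst//.
  by rewrite RecM /= mulr0 subr0.
by rewrite ImcM /= mulr0 add0r.
Qed.

Section Continuous.
Variables (a b : R) (p q : R -> R[i]).
Hypotheses (cp : forall t, a <= t <= b -> pcont p t).
Hypotheses (cq : forall t, a <= t <= b -> pcont q t).

Let cRe t : a <= t <= b -> {for t, continuous (fun s => Re (p s))}.
Proof. by move/cp/pcont_Re. Qed.
Let cIm t : a <= t <= b -> {for t, continuous (fun s => Im (p s))}.
Proof. by move/cp/pcont_Im. Qed.
Let dRe t : a <= t <= b -> {for t, continuous (fun s => Re (q s))}.
Proof. by move/cq/pcont_Re. Qed.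
Let dIm t : a <= t <= b -> {for t, continuous (fun s => Im (q s))}.
Proof. by move/cq/pcont_Im. Qed.

Lemma cintD : cint (fun t => p t + q t) a b = cint p a b + cint q a b.
Proof.
apply: complex_ext; rewrite ?RecD ?ImcD ?Re_cint ?Im_cint -rintD//.
  by apply: eq_rint => t _; rewrite RecD.
by apply: eq_rint => t _; rewrite ImcD.
Qed.

Lemma cintZ k : cint (fun t => k * p t) a b = k * cint p a b.
Proof.
have cont_scale (l : R) (u : R -> R) : (forall t, a <= t <= b -> {for t, continuous u}) ->
    forall t, a <= t <= b -> {for t, continuous (fun s => l * u s)}.
  by move=> cu t /cu ct; apply: continuousM => //; exact: cvg_cst.
apply: complex_ext; rewrite ?RecM ?ImcM ?Re_cint ?Im_cint -!rintZ//.
  rewrite -mulN1r -rintZ//; last exact: cont_scale.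
  rewrite -rintD//; [|exact: cont_scale|by apply/cont_scale/cont_scale].
  by apply: eq_rint => t _; rewrite RecM mulN1r.
rewrite -rintD//; [|exact: cont_scale|exact: cont_scale].
by apply: eq_rint => t _; rewrite ImcM.
Qed.

Lemma cint_split c : a <= c <= b -> cint p a b = cint p a c + cint p c b.
Proof. by move=> acb; apply: complex_ext; rewrite ?RecD ?ImcD; exact: rint_split. Qed.

End Continuous.

Lemma Re_cint_ge0 p a b : (forall t, a <= t <= b -> 0 <= Re (p t)) -> 0 <= Re (cint p a b).
Proof. by move=> h; apply: Rintegral_ge0 => t /=; rewrite in_itv/=; exact: h. Qed.

Lemma pcontZ k p t : pcont p t -> pcont (fun s => k * p s) t.
Proof.
move=> cp e e0; have k0 : 0 < modulus k + 1 by have := modulus_ge0 k; lra.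
have [d d0 h] := cp (e / (modulus k + 1)) (divr_gt0 e0 k0).
exists d => // s /h; rewrite ltr_pdivlMr// -mulrBr modulusM mulrC; apply: le_lt_trans.
by rewrite ler_wpM2r ?modulus_ge0//; lra.
Qed.

Lemma pcontD p q t : pcont p t -> pcont q t -> pcont (fun s => p s + q s) t.
Proof.
move=> hf hg e e0; have e2 : 0 < e / 2 by rewrite divr_gt0.
have [d d0 hd] := hf _ e2; have [d' d'0 hd'] := hg _ e2.
exists (Num.min d d') => [|w]; first by rewrite lt_min d0.
rewrite lt_min => /andP[/hd h1 /hd' h2].
rewrite opprD addrACA; apply: le_lt_trans (modulusD _ _) _.
by rewrite (splitr e) ltrD.
Qed.

(** A unimodular factor k turns the integral into its modulus, and then only real parts have to be
    compared. The majorant is the real part of a path, so that it can itself be a circle mean. *)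
Lemma modulus_cint_dom p q a b : a <= b ->
  (forall t, a <= t <= b -> pcont p t) -> (forall t, a <= t <= b -> pcont q t) ->
  (forall t, a <= t <= b -> modulus (p t) <= Re (q t)) ->
  modulus (cint p a b) <= Re (cint q a b).
Proof.
move=> ab cp cq pM; set I := cint p a b.
have [->|I0] := eqVneq I 0.
  rewrite modulus0; apply: Re_cint_ge0 => t /pM; apply: le_trans; exact: modulus_ge0.
have m0 : 0 < modulus I by rewrite modulus_gt0.
pose k := I^*%C / (modulus I)%:C.
have mC : (modulus I)%:C != 0 :> R[i] by rewrite -modulus_gt0 modulus_real gtr0_norm.
have kI : k * I = (modulus I)%:C.
  by rewrite /k mulrAC (mulrC _ I) modulus_mulJ expr2 rmorphM/= mulfK.
have mk : modulus k = 1.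
  by rewrite /k modulusM modulusJ modulusV modulus_real gtr0_norm// mulfV// gt_eqF.
have -> : modulus I = Re (cint (fun t => k * p t) a b) by rewrite cintZ// -/I kI.
rewrite !Re_cint; apply: le_rint.
- by move=> t /cp cpt; apply: pcont_Re; exact: pcontZ.
- by move=> t /cq cqt; exact: pcont_Re.
- move=> t /pM; apply: le_trans; apply: le_trans (ler_norm _) _.
  by apply: le_trans (Re_le_modulus _) _; rewrite modulusM mk mul1r.
Qed.

Lemma pcont_cst (k : R[i]) t : pcont (fun=> k) t.
Proof. by move=> e e0; exists 1 => // s _; rewrite subrr modulus0. Qed.

Lemma modulus_cint_le p a b (M : R) : a <= b ->
  (forall t, a <= t <= b -> pcont p t) ->
  (forall t, a <= t <= b -> modulus (p t) <= M) ->
  modulus (cint p a b) <= M * (b - a).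
Proof.
move=> ab cp pM; apply: le_trans (modulus_cint_dom (q := fun=> M%:C) ab cp _ pM) _.
  by move=> *; exact: pcont_cst.
by rewrite cint_cst// RecM/= mulr0 subr0.
Qed.

Lemma cintJ p a b : (forall t, a <= t <= b -> pcont p t) ->
  cint (fun t => (p t)^*%C) a b = (cint p a b)^*%C.
Proof.
move=> cp; apply: complex_ext; rewrite ?Re_cint ?Im_cint.
  by rewrite /=; apply: eq_rint => t _; case: (p t).
rewrite /= -mulN1r -rintZ; last by move=> t /cp; exact: pcont_Im.
by apply: eq_rint => t _; rewrite mulN1r; case: (p t).
Qed.

End PathIntegral.

Section Goursat.
Context {R : realType}.
Implicit Types (G : R[i] -> R[i]) (s t x y : R).

(** The contour integral of G dz counterclockwise round the rectangle, with opposite sides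
    paired. *)
Definition rect_int G s1 s2 t1 t2 : R[i] :=
  'i%C * cint (fun y => G (s2 +i* y) - G (s1 +i* y)) t1 t2 -
  cint (fun x => G (x +i* t2) - G (x +i* t1)) s1 s2.

Lemma modulus_vert x y y' : modulus ((x +i* y') - (x +i* y)) = `|y' - y|.
Proof. by rewrite modulusE/= subrr expr0n add0r sqrtr_sqr. Qed.

Lemma modulus_horiz x x' y : modulus ((x' +i* y) - (x +i* y)) = `|x' - x|.
Proof. by rewrite modulusE/= subrr expr0n addr0 sqrtr_sqr. Qed.

Lemma pcont_vert G x y : ccont G (x +i* y) -> pcont (fun y => G (x +i* y)) y.
Proof.
by move=> cG e /cG[d d0 h]; exists d => // y' hy; apply: h; rewrite modulus_vert.
Qed.

Lemma pcont_horiz G x y : ccont G (x +i* y) -> pcont (fun x => G (x +i* y)) x.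
Proof.
by move=> cG e /cG[d d0 h]; exists d => // y' hy; apply: h; rewrite modulus_horiz.
Qed.

Lemma pcontB (p q : R -> R[i]) t : pcont p t -> pcont q t -> pcont (fun s => p s - q s) t.
Proof.
move=> hp /(pcontZ (-1)) hq.
rewrite (_ : (fun _ => _) = (fun s => p s + -1 * q s)); first exact: pcontD.
by apply/funext => s; rewrite mulN1r.
Qed.

Section Split.
Variables (G : R[i] -> R[i]) (s1 s3 t1 t3 : R).
Hypothesis cG : forall x y, s1 <= x <= s3 -> t1 <= y <= t3 -> ccont G (x +i* y).

Lemma rect_int_hsplit s2 : s1 <= s2 <= s3 -> t1 <= t3 ->
  rect_int G s1 s3 t1 t3 = rect_int G s1 s2 t1 t3 + rect_int G s2 s3 t1 t3.
Proof.
move=> /andP[s12 s23] t13; rewrite /rect_int.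
have s13 := le_trans s12 s23.
rewrite [X in _ - X = _](@cint_split _ s1 s3 _ _ s2) ?s12//; last first.
  move=> x sx; apply: pcontB; apply: pcont_horiz; apply: cG; rewrite ?lexx ?andbT//.
have -> : cint (fun y => G (s3 +i* y) - G (s1 +i* y)) t1 t3 =
    cint (fun y => G (s2 +i* y) - G (s1 +i* y)) t1 t3 +
    cint (fun y => G (s3 +i* y) - G (s2 +i* y)) t1 t3.
  rewrite -cintD.
  - by apply: eq_cint => y _; ring.
  - by move=> y ty; apply: pcontB; apply: pcont_vert; apply: cG => //; rewrite ?lexx ?s12 ?s13.
  - by move=> y ty; apply: pcontB; apply: pcont_vert; apply: cG => //; rewrite ?lexx ?s12 ?s13 ?andbT.
by ring.
Qed.

Lemma rect_int_vsplit t2 : t1 <= t2 <= t3 -> s1 <= s3 ->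
  rect_int G s1 s3 t1 t3 = rect_int G s1 s3 t1 t2 + rect_int G s1 s3 t2 t3.
Proof.
move=> /andP[t12 t23] s13; rewrite /rect_int.
have t13 := le_trans t12 t23.
rewrite [X in 'i%C * X - _ = _](@cint_split _ t1 t3 _ _ t2) ?t12//; last first.
  move=> x sx; apply: pcontB; apply: pcont_vert; apply: cG; rewrite ?lexx ?andbT//.
have -> : cint (fun x => G (x +i* t3) - G (x +i* t1)) s1 s3 =
    cint (fun x => G (x +i* t2) - G (x +i* t1)) s1 s3 +
    cint (fun x => G (x +i* t3) - G (x +i* t2)) s1 s3.
  rewrite -cintD.
  - by apply: eq_cint => y _; ring.
  - by move=> y ty; apply: pcontB; apply: pcont_horiz; apply: cG => //; rewrite ?lexx ?t12 ?t13.
  - by move=> y ty; apply: pcontB; apply: pcont_horiz; apply: cG => //; rewrite ?lexx ?t12 ?t13 ?andbT.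
by ring.
Qed.

End Split.

(** The affine part of G at z0 contributes i l (s2 - s1) (t2 - t1) to both terms of [rect_int], and
    the two cancel. What remains on each pair of opposite sides is twice an error of size e h. *)
Lemma rect_int_small G (s1 s2 t1 t2 : R) (z0 l : R[i]) (e : R) :
  s1 <= s2 -> t1 <= t2 -> s1 <= Re z0 <= s2 -> t1 <= Im z0 <= t2 ->
  (forall x y, s1 <= x <= s2 -> t1 <= y <= t2 -> ccont G (x +i* y)) ->
  (forall x y, s1 <= x <= s2 -> t1 <= y <= t2 ->
     modulus (G (x +i* y) - G z0 - ((x +i* y) - z0) * l) <= e * modulus ((x +i* y) - z0)) ->
  0 <= e -> modulus (rect_int G s1 s2 t1 t2) <= 2 * e * (s2 - s1 + (t2 - t1)) ^+ 2.
Proof.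
move=> s12 t12 /andP[z1 z2] /andP[z3 z4] cG hG e0.
set h := s2 - s1 + (t2 - t1).
have h0 : 0 <= h by rewrite /h; lra.
have hmod x y : s1 <= x <= s2 -> t1 <= y <= t2 -> modulus ((x +i* y) - z0) <= h.
  move=> /andP[x1 x2] /andP[y1 y2]; apply: le_trans (modulus_le_ReIm _) _.
  rewrite RecD ImcD RecN ImcN /= /h lerD// ler_norml; apply/andP; split; lra.
have err x y : s1 <= x <= s2 -> t1 <= y <= t2 ->
    modulus (G (x +i* y) - G z0 - ((x +i* y) - z0) * l) <= e * h.
  by move=> hx hy; apply: le_trans (hG _ _ hx hy) _; rewrite ler_wpM2l// hmod.
have s1s : s1 <= s1 <= s2 by rewrite lexx.
have s2s : s1 <= s2 <= s2 by rewrite lexx s12.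
have t1t : t1 <= t1 <= t2 by rewrite lexx.
have t2t : t1 <= t2 <= t2 by rewrite lexx t12.
have key1 : modulus (cint (fun y => G (s2 +i* y) - G (s1 +i* y)) t1 t2 -
    (s2 - s1)%:C * l * (t2 - t1)%:C) <= 2 * e * h * (t2 - t1).
  rewrite -cint_cst// -mulN1r -cintZ; last by move=> *; exact: pcont_cst.
  rewrite -cintD; first last.
  - by move=> *; apply: pcontZ; exact: pcont_cst.
  - by move=> y ty; apply: pcontB; apply: pcont_vert; exact: cG.
  apply: modulus_cint_le => // y ty.
    apply: pcontD; last by apply: pcontZ; exact: pcont_cst.
    by apply: pcontB; apply: pcont_vert; exact: cG.
  have -> : G (s2 +i* y) - G (s1 +i* y) + -1 * ((s2 - s1)%:C * l) =
     (G (s2 +i* y) - G z0 - ((s2 +i* y) - z0) * l) -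
     (G (s1 +i* y) - G z0 - ((s1 +i* y) - z0) * l).
    have -> : s2 +i* y = s1 +i* y + (s2 - s1)%:C.
      by apply: complex_ext; rewrite ?RecD ?ImcD/= ?addr0// subrKC.
    by ring.
  apply: le_trans (modulusB _ _) _.
  by have := err _ _ s2s ty; have := err _ _ s1s ty; lra.
have key2 : modulus (cint (fun x => G (x +i* t2) - G (x +i* t1)) s1 s2 -
    ('i%C * (t2 - t1)%:C) * l * (s2 - s1)%:C) <= 2 * e * h * (s2 - s1).
  rewrite -cint_cst// -mulN1r -cintZ; last by move=> *; exact: pcont_cst.
  rewrite -cintD; first last.
  - by move=> *; apply: pcontZ; exact: pcont_cst.
  - by move=> y ty; apply: pcontB; apply: pcont_horiz; exact: cG.
  apply: modulus_cint_le => // y ty.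
    apply: pcontD; last by apply: pcontZ; exact: pcont_cst.
    by apply: pcontB; apply: pcont_horiz; exact: cG.
  have -> : G (y +i* t2) - G (y +i* t1) + -1 * (('i%C * (t2 - t1)%:C) * l) =
     (G (y +i* t2) - G z0 - ((y +i* t2) - z0) * l) -
     (G (y +i* t1) - G z0 - ((y +i* t1) - z0) * l).
    have -> : y +i* t2 = y +i* t1 + 'i%C * (t2 - t1)%:C.
      apply: complex_ext; rewrite ?RecD ?ImcD ?RecM ?ImcM/=; first by rewrite !mul0r mul1r subr0 addr0.
      by rewrite !mul0r mul1r add0r subrKC.
    by ring.
  apply: le_trans (modulusB _ _) _.
  by have := err _ _ ty t1t; have := err _ _ ty t2t; lra.
rewrite /rect_int; set A := cint _ _ _ in key1 *; set B := cint _ _ _ in key2 *.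
have -> : 'i%C * A - B = 'i%C * (A - (s2 - s1)%:C * l * (t2 - t1)%:C) -
    (B - ('i%C * (t2 - t1)%:C) * l * (s2 - s1)%:C) by ring.
apply: le_trans (modulusB _ _) _; rewrite modulusM modulusi mul1r.
apply: le_trans (lerD key1 key2) _.
rewrite le_eqVlt; apply/orP; left; apply/eqP; rewrite /h; ring.
Qed.

(** The four quarters add up to the whole, so their integrals cannot all have modulus below k /
    4. *)
Lemma rect_bisect G (s1 s3 t1 t3 k : R) : s1 <= s3 -> t1 <= t3 ->
  (forall x y, s1 <= x <= s3 -> t1 <= y <= t3 -> ccont G (x +i* y)) ->
  k <= modulus (rect_int G s1 s3 t1 t3) ->
  exists s t, [/\ (s == s1) || (s == s1 + (s3 - s1) / 2), (t == t1) || (t == t1 + (t3 - t1) / 2)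
   & k / 4 <= modulus (rect_int G s (s + (s3 - s1) / 2) t (t + (t3 - t1) / 2))].
Proof.
move=> s13 t13 cG kA; apply: contrapT => hno.
have no s t : (s == s1) || (s == s1 + (s3 - s1) / 2) ->
    (t == t1) || (t == t1 + (t3 - t1) / 2) ->
    modulus (rect_int G s (s + (s3 - s1) / 2) t (t + (t3 - t1) / 2)) < k / 4.
  by move=> hs ht; rewrite ltNge; apply/negP => hk; apply: hno; exists s, t.
set s2 := s1 + (s3 - s1) / 2 in no.
set t2 := t1 + (t3 - t1) / 2 in no.
have s2E : s2 + (s3 - s1) / 2 = s3 by rewrite /s2; field.
have t2E : t2 + (t3 - t1) / 2 = t3 by rewrite /t2; field.
have s12 : s1 <= s2 <= s3 by rewrite /s2; apply/andP; split; lra.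
have t12 : t1 <= t2 <= t3 by rewrite /t2; apply/andP; split; lra.
have n1 := no s1 t1; have n2 := no s1 t2; have n3 := no s2 t1; have n4 := no s2 t2.
rewrite !eqxx ?orbT s2E t2E -/s2 -/t2 in n1 n2 n3 n4.
move: kA; rewrite (rect_int_hsplit cG s12 t13).
have /andP[s12a s12b] := s12; have /andP[t12a t12b] := t12.
rewrite (rect_int_vsplit _ t12 s12a); last first.
  by move=> x y /andP[x1 x2]; apply: cG; rewrite x1 (le_trans x2).
rewrite (rect_int_vsplit _ t12 s12b); last first.
  by move=> x y /andP[x1 x2]; apply: cG; rewrite x2 (le_trans s12a).
apply/negP; rewrite -ltNge.
apply: le_lt_trans (modulusD _ _) _.
apply: le_lt_trans (lerD (modulusD _ _) (modulusD _ _)) _.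
by move: (n1 isT isT) (n2 isT isT) (n3 isT isT) (n4 isT isT); clear; lra.
Qed.

(** The supremum of the left ends works, because every left end lies below every right end. *)
Lemma nested_cvg (u w : nat -> R) (h : R) : 0 <= h ->
  (forall n, u n <= u n.+1) -> (forall n, u n.+1 + h / 2 ^+ n.+1 <= u n + h / 2 ^+ n) ->
  exists x, forall n, u n <= x <= u n + h / 2 ^+ n.
Proof.
move=> h0 ui ud.
have hn n : 0 <= h / 2 ^+ n by rewrite divr_ge0// exprn_ge0.
have mono m n : (m <= n)%N -> u m <= u n.
  by move=> /subnK <-; elim: (n - m)%N => // k ih; rewrite addSn; apply: le_trans ih (ui _).
have anti m n : (m <= n)%N -> u n + h / 2 ^+ n <= u m + h / 2 ^+ m.
  by move=> /subnK <-; elim: (n - m)%N => // k ih; rewrite addSn; apply: le_trans (ud _) ih.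
have ub m n : u m <= u n + h / 2 ^+ n.
  case/orP: (leq_total m n) => [/mono mn|/anti nm].
    by apply: le_trans mn _; rewrite lerDl.
  by apply: le_trans nm; rewrite lerDl.
have hs : has_sup (range u).
  split; first by exists (u 0%N), 0%N.
  by exists (u 0%N + h / 2 ^+ 0) => _ [n _ <-].
exists (sup (range u)) => n; apply/andP; split.
  by apply: (sup_upper_bound hs); exists n.
by apply: ge_sup => [|_ [m _ <-]]; [exists (u 0%N), 0%N|exact: ub].
Qed.

Lemma goursat G (s1 s3 t1 t3 : R) : s1 <= s3 -> t1 <= t3 ->
  (forall x y, s1 <= x <= s3 -> t1 <= y <= t3 -> chol G (x +i* y)) ->
  rect_int G s1 s3 t1 t3 = 0.
Proof.
move=> s13 t13 hG; apply/eqP; rewrite -modulus_eq0; apply/negPn/negP => A0.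
set k := modulus _ in A0.
have k0 : 0 < k by rewrite lt_neqAle eq_sym A0 modulus_ge0.
pose a := s3 - s1; pose b := t3 - t1.
pose P n (q : R * R) := [/\ s1 <= q.1, q.1 + a / 2 ^+ n <= s3, t1 <= q.2, q.2 + b / 2 ^+ n <= t3 &
   k / 4 ^+ n <= modulus (rect_int G q.1 (q.1 + a / 2 ^+ n) q.2 (q.2 + b / 2 ^+ n))].
have cG x y : s1 <= x <= s3 -> t1 <= y <= t3 -> ccont G (x +i* y).
  by move=> hx hy; apply: chol_cont; exact: hG.
have a0 : 0 <= a by rewrite subr_ge0.
have b0 : 0 <= b by rewrite subr_ge0.
have an n : 0 <= a / 2 ^+ n by rewrite divr_ge0// exprn_ge0.
have bn n : 0 <= b / 2 ^+ n by rewrite divr_ge0// exprn_ge0.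
have halve (c : R) n : c / 2 ^+ n / 2 = c / 2 ^+ n.+1 by rewrite exprS invfM mulrA mulrAC.
(* [P] stands after the existential, with a junk witness when it fails, so that [choice] gives a
   total selection function that can be iterated. *)
have step : forall x : nat * (R * R), exists y : R * R, P x.1 x.2 ->
   [/\ P x.1.+1 y, x.2.1 <= y.1, y.1 + a / 2 ^+ x.1.+1 <= x.2.1 + a / 2 ^+ x.1,
       x.2.2 <= y.2 & y.2 + b / 2 ^+ x.1.+1 <= x.2.2 + b / 2 ^+ x.1].
  move=> [n [s t]] /=; have [[/= p1 p2 p3 p4 p5]|np] := pselect (P n (s, t)); last by exists (s, t) => /np.
  have sa : s <= s + a / 2 ^+ n by rewrite lerDl.
  have tb : t <= t + b / 2 ^+ n by rewrite lerDl.
  have cG' x y : s <= x <= s + a / 2 ^+ n -> t <= y <= t + b / 2 ^+ n -> ccont G (x +i* y).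
    move=> /andP[x1 x2] /andP[y1 y2]; apply: cG; apply/andP; split.
    - exact: le_trans p1 x1.
    - exact: le_trans x2 p2.
    - exact: le_trans p3 y1.
    - exact: le_trans y2 p4.
  have [s' [t' []]] := rect_bisect sa tb cG' p5.
  rewrite !(addrAC _ _ (- _)) !subrr !add0r !halve => hs ht hk; exists (s', t') => _ /=.
  have ha : a / 2 ^+ n = a / 2 ^+ n.+1 + a / 2 ^+ n.+1 by rewrite -halve -splitr.
  have hb : b / 2 ^+ n = b / 2 ^+ n.+1 + b / 2 ^+ n.+1 by rewrite -halve -splitr.
  have := an n.+1; have := bn n.+1 => bn1 an1.
  have hs' : s <= s' /\ s' + a / 2 ^+ n.+1 <= s + a / 2 ^+ n.
    by clear -hs ha an1; case/orP: hs => /eqP ->; split; rewrite ?ha; lra.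
  have ht' : t <= t' /\ t' + b / 2 ^+ n.+1 <= t + b / 2 ^+ n.
    by clear -ht hb bn1; case/orP: ht => /eqP ->; split; rewrite ?hb; lra.
  case: hs' ht' => s1' s2' [t1' t2'].
  split => //; split => //=.
  - exact: le_trans p1 s1'.
  - exact: le_trans s2' p2.
  - exact: le_trans p3 t1'.
  - exact: le_trans t2' p4.
  - by rewrite exprSr invfM mulrA.
have [f hf] := choice step.
pose Q := fix Q n := if n is m.+1 then f (m, Q m) else (s1, t1).
have PQ n : P n (Q n).
  elim: n => [|n ih]; last by have [] := hf (n, Q n) ih.
  by split; rewrite //= ?expr0 ?divr1 ?lexx// /a /b ?subrKC.
have [x0 hx] : exists x, forall n, (Q n).1 <= x <= (Q n).1 + a / 2 ^+ n.
  by apply: nested_cvg => // n; have [_ ? ? ? ?] := hf (n, Q n) (PQ n).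
have [y0 hy] : exists x, forall n, (Q n).2 <= x <= (Q n).2 + b / 2 ^+ n.
  by apply: nested_cvg => // n; have [_ ? ? ? ?] := hf (n, Q n) (PQ n).
have hx0 : s1 <= x0 <= s3 by have := hx 0%N; rewrite /= expr0 divr1 /a subrKC.
have hy0 : t1 <= y0 <= t3 by have := hy 0%N; rewrite /= expr0 divr1 /b subrKC.
have [l [q [cq ql GE]]] := hG _ _ hx0 hy0.
pose h := a + b; have h0 : 0 <= h by rewrite /h; lra.
(* With this e, [rect_int_small] bounds the n-th integral by half of k / 4^n, against the k / 4^n
   preserved by bisection. The summand 1 covers a degenerate rectangle, where h = 0. *)
pose e := k / (4 * (h + 1) ^+ 2).
have h1 : 0 < (h + 1) ^+ 2 by rewrite exprn_gt0//; lra.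
have e0 : 0 < e by rewrite divr_gt0// mulr_gt0.
have [d d0 hd] := cq _ e0.
have [n hn] : exists n, h / 2 ^+ n < d.
  have [n hn] : exists n, h / d < n%:R.
    by exists (Num.bound (h / d)); apply: archi_boundP; rewrite divr_ge0// ltW.
  exists n; rewrite ltr_pdivrMr ?exprn_gt0// mulrC -ltr_pdivrMr//.
  by apply: lt_trans hn _; rewrite -natrX ltr_nat ltn_expl.
have [/= p1 p2 p3 p4 p5] := PQ n.
set s := (Q n).1 in p1 p2 p5; set t := (Q n).2 in p3 p4 p5.
have hsum : a / 2 ^+ n + b / 2 ^+ n = h / 2 ^+ n by rewrite -mulrDl.
have := @rect_int_small G s (s + a / 2 ^+ n) t (t + b / 2 ^+ n) (x0 +i* y0) l e.
rewrite !lerDl an bn; move=> /(_ isT isT (hx n) (hy n)).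
have cG' x y : s <= x <= s + a / 2 ^+ n -> t <= y <= t + b / 2 ^+ n -> ccont G (x +i* y).
  move=> /andP[x1 x2] /andP[y1 y2]; apply: cG; apply/andP; split.
  - exact: le_trans p1 x1.
  - exact: le_trans x2 p2.
  - exact: le_trans p3 y1.
  - exact: le_trans y2 p4.
move=> /(_ cG') H.
have {H}/H : forall x y, s <= x <= s + a / 2 ^+ n -> t <= y <= t + b / 2 ^+ n ->
   modulus (G (x +i* y) - G (x0 +i* y0) - (x +i* y - (x0 +i* y0)) * l)
      <= e * modulus (x +i* y - (x0 +i* y0)).
  move=> x y /andP[hx1 hx2] /andP[hy1 hy2].
  set w := x +i* y; set z0 := x0 +i* y0.
  have -> : G w - G z0 - (w - z0) * l = (w - z0) * (q w - q z0) by rewrite GE -/z0 ql; ring.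
  rewrite modulusM mulrC ler_wpM2r ?modulus_ge0// ltW// hd//.
  apply: le_lt_trans hn; rewrite -hsum; apply: le_trans (modulus_le_ReIm _) _.
  have /andP[xa xb] := hx n; have /andP[ya yb] := hy n.
  rewrite -/s -/t in xa xb ya yb; clear -xa xb ya yb hx1 hx2 hy1 hy2.
  by rewrite RecD ImcD RecN ImcN /= lerD// ler_norml; apply/andP; split; lra.
move=> /(_ (ltW e0)).
rewrite !(addrAC _ _ (- _)) !subrr !add0r hsum => H.
have := le_trans p5 H; apply/negP; rewrite -ltNge.
rewrite expr_div_n (_ : (2 ^+ n) ^+ 2 = 4 ^+ n); last by rewrite -exprM mulnC exprM (_ : 2 ^+ 2 = 4)//; ring.
rewrite mulrA ltr_pM2r ?invr_gt0 ?exprn_gt0//.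
have hh : h ^+ 2 <= (h + 1) ^+ 2 by clear -h0; rewrite ler_sqr ?nnegrE; lra.
apply: (@le_lt_trans _ _ (2 * e * (h + 1) ^+ 2)); first by rewrite ler_wpM2l// mulr_ge0// ltW.
clear -h0 k0; rewrite /e (_ : 2 * _ * _ = k / 2); first lra.
by field; rewrite gt_eqF//; lra.
Qed.

End Goursat.

Section ComplexExponential.
Context {R : realType}.
Implicit Types (t r : R) (z w : R[i]).

Lemma is_derive_littleo (f : R -> R) (x l : R) : is_derive x 1 f l ->
  forall e : R, 0 < e -> exists2 d : R, 0 < d &
  forall h, `|h| < d -> `|f (x + h) - f x - h * l| <= e * `|h|.
Proof.
move=> [df <-] e e0.
have /cvgrPdist_le/(_ e e0) := df.
move=> /nbhs_ballP[d /= d0 hd]; exists d => // h hh.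
have [->|h0] := eqVneq h 0; first by rewrite addr0 subrr mul0r subr0 normr0 mulr0.
have := hd h; rewrite /ball/= sub0r normrN => /(_ hh h0).
rewrite -(ler_pM2r (x := `|h|)) ?normr_gt0// -normrM; apply: le_trans.
rewrite le_eqVlt; apply/orP; left; apply/eqP; rewrite distrC mulrBl.
by rewrite /GRing.scale/= mulrAC mulVf// mul1r mulr1 (addrC h x) (mulrC h).
Qed.

Definition cis t : R[i] := cos t +i* sin t.

Lemma modulus_cis t : modulus (cis t) = 1.
Proof. by rewrite modulusE/= cos2Dsin2 sqrtr1. Qed.

Lemma cisD t t' : cis (t + t') = cis t * cis t'.
Proof. by apply: complex_ext; rewrite ?RecM ?ImcM/= ?cosD ?sinD//; ring. Qed.

Lemma cis0 : cis 0 = 1.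
Proof. by rewrite /cis cos0 sin0. Qed.

Lemma cis2pi : cis (2 * pi) = 1.
Proof.
rewrite (_ : 2 * pi = pi + pi); last by ring.
rewrite cisD /cis cospi sinpi; apply: complex_ext; rewrite ?RecM ?ImcM/=; ring.
Qed.

Definition cexp z : R[i] := (expR (Re z))%:C * cis (Im z).

Lemma cexpD z w : cexp (z + w) = cexp z * cexp w.
Proof. by rewrite /cexp RecD ImcD expRD cisD rmorphM/=; ring. Qed.

Lemma cexp0 : cexp 0 = 1.
Proof. by rewrite /cexp/= expR0 cis0 mulr1. Qed.

Lemma modulus_cexp z : modulus (cexp z) = expR (Re z).
Proof. by rewrite modulusM modulus_cis mulr1 modulus_real ger0_norm// expR_ge0. Qed.

Lemma cexp_small (e : R) : 0 < e -> exists2 d : R, 0 < d &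
  forall w, modulus w < d -> modulus (cexp w - 1 - w) <= e * modulus w.
Proof.
(* The three terms of the decomposition below add up to 6 e' |w|. *)
move=> e0; pose e' := Num.min 1 (e / 7).
have e'0 : 0 < e' by rewrite lt_min ltr01 divr_gt0.
have [d1 d10 h1] := is_derive_littleo (is_derive_expR (0 : R)) e'0.
have [d2 d20 h2] := is_derive_littleo (is_derive_cos (0 : R)) e'0.
have [d3 d30 h3] := is_derive_littleo (is_derive_sin (0 : R)) e'0.
exists (Num.min (Num.min d1 (e' / 2)) (Num.min d2 d3)) => [|w].
  by rewrite !lt_min d10 d20 d30 divr_gt0.
rewrite !lt_min => /andP[/andP[w1 we] /andP[w2 w3]].
set m := modulus w in w1 we w2 w3 *.
have m0 : 0 <= m := modulus_ge0 _.
have xm := Re_le_modulus w; have ym := Im_le_modulus w; rewrite -/m in xm ym.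
have {h1} := h1 _ (le_lt_trans xm w1).
have {h2} := h2 _ (le_lt_trans ym w2).
have {h3} := h3 _ (le_lt_trans ym w3).
rewrite !add0r sin0 cos0 expR0 oppr0 mulr0 addr0 subr0 !mulr1 => h3 h2 h1.
have e'1 : e' <= 1 by rewrite ge_min lexx.
have e'7 : e' <= e / 7 by rewrite ge_min lexx orbT.
have {}h1 : `|expR (Re w) - 1 - Re w| <= e' * m by apply: le_trans h1 _; rewrite ler_wpM2l// ltW.
have {}h2 : `|cos (Im w) - 1| <= e' * m by apply: le_trans h2 _; rewrite ler_wpM2l// ltW.
have {}h3 : `|sin (Im w) - Im w| <= e' * m by apply: le_trans h3 _; rewrite ler_wpM2l// ltW.
have e'm : e' * m <= m by rewrite ler_piMl.
have hE : `|expR (Re w) - 1| <= 2 * m.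
  by move: h1 xm; rewrite !ler_norml => /andP[? ?] /andP[? ?]; apply/andP; split; lra.
have hE1 : expR (Re w) <= 2.
  by move: hE we; rewrite ler_norml => /andP[_]; move: e'1; clear; lra.
set X := expR (Re w) in h1 hE hE1 *.
have -> : cexp w - 1 - w = (X - 1 - Re w)%:C + X%:C * ((cos (Im w) - 1)%:C + 'i%C * (sin (Im w) - Im w)%:C)
   + (X - 1)%:C * ('i%C * (Im w)%:C).
  rewrite {2}(complexE w) /cexp /cis (complexE (_ +i* _)) -/X /= !rmorphB/=; ring.
apply: le_trans (modulusD _ _) _; apply: le_trans (lerD (modulusD _ _) (lexx _)) _.
rewrite !modulusM !modulus_real modulusi mul1r.
have X0 : 0 <= X := expR_ge0 _.
have hA : modulus ((cos (Im w) - 1)%:C + 'i%C * (sin (Im w) - Im w)%:C) <= 2 * (e' * m).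
  apply: le_trans (modulusD _ _) _; rewrite modulusM modulusi mul1r !modulus_real.
  by clear -h2 h3; lra.
have hB : X * modulus ((cos (Im w) - 1)%:C + 'i%C * (sin (Im w) - Im w)%:C) <= 2 * (2 * (e' * m)).
  by apply: ler_pM => //; exact: modulus_ge0.
have hC : `|X - 1| * `|Im w| <= 2 * m * (e' / 2).
  by apply: ler_pM => //; exact: le_trans ym (ltW we).
rewrite (ger0_norm X0).
apply: (@le_trans _ _ (e' * m + 2 * (2 * (e' * m)) + 2 * m * (e' / 2))).
  by apply: lerD => //; apply: lerD.
rewrite (_ : _ + _ = 6 * e' * m); last by field.
by rewrite ler_wpM2r//; clear -e'7 e0; lra.
Qed.

(** [cexp_small] is the derivative at 0, and the addition theorem carries it to z. *)
Lemma cder_cexp z : cder cexp z (cexp z).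
Proof.
have d0 : cder cexp 0 1.
  exists (fun w => if w == 0 then 1 else (cexp w - 1) / w); split.
  - move=> e e0; have [d d0 hd] := cexp_small (divr_gt0 e0 (ltr0n _ 2)).
    exists d => // w; rewrite eqxx subr0 => /hd.
    case: eqP => [->|/eqP w0]; first by rewrite subrr modulus0.
    move=> h; rewrite (_ : _ - 1 = (cexp w - 1 - w) / w); last by field.
    rewrite modulusM modulusV ltr_pdivrMr ?modulus_gt0//.
    apply: le_lt_trans h _; rewrite ltr_pM2r ?modulus_gt0//.
    by rewrite ltr_pdivrMr// ltr_pMr// ltr1n.
  - by rewrite eqxx.
  - move=> w; rewrite cexp0 subr0; case: eqP => [->|/eqP w0].
      by rewrite mul0r addr0 cexp0.
    by rewrite mulrC divfK// subrKC.
have h1 : cder (fun w => w - z) z 1.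
  by rewrite -[1]addr0; apply: cderD; [exact: cder_id|exact: cder_cst].
have := cder_comp (f := cexp) h1; rewrite subrr => /(_ _ d0) /(cderM (cder_cst (cexp z) z)).
rewrite mul0r add0r !mulr1; apply: (@cder_near _ _ _ _ 1) => // w _ /=.
by rewrite -cexpD subrKC.
Qed.

End ComplexExponential.

(** * Means over circles centred at 0 *)

Section CircleMean.
Context {R : realType}.
Implicit Types (r t : R) (F G : R[i] -> R[i]) (z w : R[i]).

Definition circ r t : R[i] := r%:C * cis t.

Definition cmean r F : R[i] := ((2 * pi)^-1)%:C * cint (fun t => F (circ r t)) 0 (2 * pi).

Definition circle_cont r F := forall w, modulus w = r -> ccont F w.

Lemma twopi_gt0 : 0 < 2 * pi :> R.
Proof. by rewrite mulr_gt0// pi_gt0. Qed.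

Let twopi_ge0 : 0 <= 2 * pi :> R := ltW twopi_gt0.

Lemma modulus_circ r t : 0 <= r -> modulus (circ r t) = r.
Proof. by move=> r0; rewrite modulusM modulus_cis mulr1 modulus_real ger0_norm. Qed.

Lemma circ_dist r r' t t' : modulus (circ r' t' - circ r t) <=
  `|r' - r| + `|r| * modulus (cis t' - cis t).
Proof.
rewrite (_ : _ - _ = (r' - r)%:C * cis t' + r%:C * (cis t' - cis t)); last first.
  by rewrite /circ rmorphB/=; ring.
by apply: le_trans (modulusD _ _) _; rewrite !modulusM modulus_cis mulr1 !modulus_real.
Qed.

Lemma pcont_cis t : pcont cis t.
Proof.
move=> e e0; have e2 : 0 < e / 2 by rewrite divr_gt0.
have /cvgrPdist_lt/(_ _ e2)/nbhs_ballP[d /= d0 hd] := @continuous_cos R t.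
have /cvgrPdist_lt/(_ _ e2)/nbhs_ballP[d' /= d'0 hd'] := @continuous_sin R t.
exists (Num.min d d') => [|s]; first by rewrite lt_min d0.
rewrite lt_min => /andP[s1 s2].
apply: le_lt_trans (modulus_le_ReIm _) _; rewrite RecD ImcD RecN ImcN /=.
rewrite (splitr e) distrC [X in _ + X]distrC ltrD//.
  by apply: hd; rewrite /ball/= distrC.
by apply: hd'; rewrite /ball/= distrC.
Qed.

Lemma pcont_circ r F t : 0 <= r -> circle_cont r F -> pcont (fun t => F (circ r t)) t.
Proof.
move=> r0 cF e /(cF _ (modulus_circ t r0))[d d0 hd].
have r1 : 0 < r + 1 by apply: ltr_wpDl.
have [d' d'0 hd'] := pcont_cis t (divr_gt0 d0 r1).
exists d' => // s /hd' h; apply: hd; apply: le_lt_trans (circ_dist _ _ _ _) _.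
rewrite subrr normr0 add0r ger0_norm//.
move: h; rewrite ltr_pdivlMr// mulrC; apply: le_lt_trans.
by rewrite ler_wpM2r ?modulus_ge0//; lra.
Qed.

Section Algebra.
Variables (r : R) (F G : R[i] -> R[i]).
Hypotheses (r0 : 0 <= r) (cF : circle_cont r F) (cG : circle_cont r G).

Lemma cmeanD : cmean r (fun w => F w + G w) = cmean r F + cmean r G.
Proof. by rewrite /cmean cintD ?mulrDr// => t _; exact: pcont_circ. Qed.

Lemma cmeanZ k : cmean r (fun w => k * F w) = k * cmean r F.
Proof. by rewrite /cmean cintZ 1?mulrCA// => t _; exact: pcont_circ. Qed.

Lemma cmeanJ : cmean r (fun w => (F w)^*%C) = (cmean r F)^*%C.
Proof.
rewrite /cmean cintJ; last by move=> t _; exact: pcont_circ.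
by rewrite rmorphM/= oppr0.
Qed.

Lemma modulus_cmean_dom : (forall w, modulus w = r -> modulus (F w) <= Re (G w)) ->
  modulus (cmean r F) <= Re (cmean r G).
Proof.
move=> h; rewrite /cmean modulusM modulus_real RecM/= mul0r subr0.
rewrite ger0_norm ?invr_ge0// ler_wpM2l ?invr_ge0//.
apply: modulus_cint_dom => // t _; [exact: pcont_circ|exact: pcont_circ|].
by apply: h; rewrite modulus_circ.
Qed.

Lemma Re_cmean_ge0 : (forall w, modulus w = r -> 0 <= Re (F w)) -> 0 <= Re (cmean r F).
Proof.
move=> h; rewrite /cmean RecM/= mul0r subr0 mulr_ge0 ?invr_ge0//.
by apply: Re_cint_ge0 => t _; apply: h; rewrite modulus_circ.
Qed.

End Algebra.

Lemma cmean_cst r k : cmean r (fun=> k) = k.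
Proof.
rewrite /cmean cint_cst// subr0 mulrCA -rmorphM/= mulVf ?mulr1//.
by rewrite gt_eqF ?twopi_gt0.
Qed.

Lemma eq_cmean r F G : 0 <= r -> (forall w, modulus w = r -> F w = G w) ->
  cmean r F = cmean r G.
Proof. by move=> r0 h; congr (_ * _); apply: eq_cint => t _; rewrite h// modulus_circ. Qed.

Lemma circle_cont_cst r k : circle_cont r (fun=> k).
Proof. by move=> w _; exact: ccont_cst. Qed.

Lemma modulus_cmean_le r F (M : R) : 0 <= r -> circle_cont r F ->
  (forall w, modulus w = r -> modulus (F w) <= M) -> modulus (cmean r F) <= M.
Proof.
move=> r0 cF h.
have := @modulus_cmean_dom r F (fun=> M%:C) r0 cF (circle_cont_cst _).
by rewrite cmean_cst; exact.
Qed.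

Lemma cmean0 F : cmean 0 F = F 0.
Proof.
rewrite -[RHS](cmean_cst 0); apply: eq_cmean => // w /eqP.
by rewrite modulus_eq0 => /eqP ->.
Qed.

(** At each angle the values on the two circles are close when the radii are; compactness of the
    interval of angles makes this uniform. *)
Lemma cmean_continuous F r : 0 <= r -> circle_cont r F ->
  (exists2 d : R, 0 < d & forall r', 0 <= r' -> `|r' - r| < d -> circle_cont r' F) ->
  forall e : R, 0 < e -> exists2 d : R, 0 < d &
    forall r', 0 <= r' -> `|r' - r| < d -> modulus (cmean r' F - cmean r F) <= e.
Proof.
move=> r0 cF [d0 d00 cF'] e e0.
pose P (r' t : R) := modulus (F (circ r' t) - F (circ r t)) <= e.
have /compact_near_coveringP : compact `[(0 : R), 2 * pi] by exact: segment_compact.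
move=> /(_ R (nbhs r) P _).
have hyp : forall t, `[(0 : R), 2 * pi]%classic t -> \forall x \near t & i \near nbhs r, P i x.
  move=> t _; have e2 : 0 < e / 2 by rewrite divr_gt0.
  have [d1 d10 h1] := cF _ (modulus_circ t r0) _ e2.
  have d12 : 0 < d1 / 2 by rewrite divr_gt0.
  have r1 : 0 < r + 1 by apply: ltr_wpDl.
  have [d2 d20 h2] := pcont_cis t (divr_gt0 d12 r1).
  have near1 r' t' : `|r' - r| < d1 / 2 -> `|t' - t| < d2 ->
      modulus (F (circ r' t') - F (circ r t)) < e / 2.
    move=> hr /h2 ht; apply: h1; apply: le_lt_trans (circ_dist _ _ _ _) _.
    rewrite (splitr d1) ltrD// ger0_norm//.
    move: ht; rewrite ltr_pdivlMr// mulrC; apply: le_lt_trans.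
    by rewrite ler_wpM2r ?modulus_ge0//; lra.
  exists (ball t d2, ball r (d1 / 2)); first by split; exact: nbhsx_ballx.
  move=> [t' r'] /= [ht hr]; rewrite /ball/= distrC in ht; rewrite /ball/= distrC in hr.
  rewrite /P (_ : _ - _ = (F (circ r' t') - F (circ r t)) - (F (circ r t') - F (circ r t))); last by ring.
  apply: le_trans (modulusB _ _) _; rewrite (splitr e) lerD// ltW//.
    exact: near1.
  by apply: near1 => //; rewrite subrr normr0.
move=> /(_ hyp)/nbhs_ballP[d /= dp hd].
exists (Num.min d d0) => [|r' r'0]; first by rewrite lt_min dp.
rewrite lt_min => /andP[rd rd0].
have cFr' := cF' _ r'0 rd0.
rewrite /cmean -mulrBr -mulN1r -cintZ; last by move=> t _; exact: pcont_circ.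
rewrite -cintD; first last.
- by move=> t _; apply: pcontZ; exact: pcont_circ.
- by move=> t _; exact: pcont_circ.
rewrite modulusM modulus_real ger0_norm ?invr_ge0// mulrC ler_pdivrMr ?twopi_gt0//.
rewrite -[X in _ <= _ * X](subr0 (2 * pi)).
apply: modulus_cint_le => // t ht.
  by apply: pcontD; [|apply: pcontZ]; exact: pcont_circ.
rewrite mulN1r; apply: (hd r'); first by rewrite /ball/= distrC.
by rewrite /= in_itv/=.
Qed.

(** Goursat's theorem for the composite of F with [cexp] on the rectangle with sides [ln r, ln r']
    and [0, 2 pi]. The horizontal sides cancel by periodicity, and the vertical ones are the two
    means. *)
Lemma cmean_annulus F r r' : 0 < r -> r <= r' ->
  (forall w, r <= modulus w <= r' -> chol F w) -> cmean r F = cmean r' F.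
Proof.
move=> r0 rr' hF; have r'0 := lt_le_trans r0 rr'.
have cE x y : cexp (x +i* y) = circ (expR x) y by [].
have holG x y : ln r <= x <= ln r' -> 0 <= y <= 2 * pi -> chol (F \o cexp) (x +i* y).
  move=> /andP[x1 x2] _; apply: chol_comp; first by exists (cexp (x +i* y)); exact: cder_cexp.
  apply: hF; rewrite modulus_cexp /= -[X in X <= _](lnK r0) -[X in _ && (_ <= X)](lnK r'0) !ler_expR.
  by rewrite x1.
have := goursat _ twopi_ge0 holG; rewrite ler_ln ?posrE// => /(_ rr').
rewrite /rect_int (@eq_cint _ (fun x => _ (x +i* (2 * pi)) - _) (fun=> 0)); last first.
  by move=> t _; rewrite /= !cE /circ cis2pi cis0 subrr.
rewrite cint_cst ?ler_ln ?posrE// mul0r subr0 => /eqP.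
rewrite mulf_eq0 -modulus_eq0 modulusi oner_eq0/= => /eqP.
have cr : circle_cont r F by move=> w wr; apply/chol_cont/hF; rewrite wr lexx.
have cr' : circle_cont r' F by move=> w wr; apply/chol_cont/hF; rewrite wr lexx rr'.
have -> : (fun y => (F \o cexp) (ln r' +i* y) - (F \o cexp) (ln r +i* y)) =
   (fun y => F (circ r' y) + -1 * F (circ r y)).
  by apply/funext => y; rewrite /= !cE !lnK ?posrE// mulN1r.
rewrite cintD; first last.
- by move=> t _; apply: pcontZ; apply: pcont_circ => //; exact: ltW.
- by move=> t _; apply: pcont_circ => //; exact: ltW.
rewrite cintZ; last by move=> t _; apply: pcont_circ => //; exact: ltW.
by rewrite mulN1r => /eqP; rewrite subr_eq0 /cmean => /eqP ->.
Qed.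

Section MeanValue.
Variables (F : R[i] -> R[i]) (r0 : R) (p : R[i]).
Hypothesis cF : forall w, modulus w < r0 -> ccont F w.
Hypothesis hF : forall w, modulus w < r0 -> w != p -> chol F w.

Let ccF r : r < r0 -> circle_cont r F.
Proof. by move=> rr w wr; apply: cF; rewrite wr. Qed.

Let cmean_cont r : 0 <= r -> r < r0 -> forall e : R, 0 < e -> exists2 d : R, 0 < d &
    forall r', 0 <= r' -> `|r' - r| < d -> modulus (cmean r' F - cmean r F) <= e.
Proof.
move=> rp rr; apply: cmean_continuous => //; first exact: ccF.
exists (r0 - r) => [|r' _]; first by rewrite subr_gt0.
by rewrite ltr_norml => /andP[_ h]; apply: ccF; lra.
Qed.

Let eq_limit (x y : R[i]) : (forall e : R, 0 < e -> modulus (x - y) <= e) -> x = y.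
Proof.
move=> h; apply/eqP; rewrite -subr_eq0 -modulus_eq0; apply/negPn/negP => n0.
have m0 : 0 < modulus (x - y) by rewrite lt_neqAle eq_sym n0 modulus_ge0.
by have := h _ (divr_gt0 m0 (ltr0n _ 2)); lra.
Qed.

Let cmean_right r r' : 0 <= r -> r < r' -> r' < r0 ->
  (forall s, r < s <= r' -> cmean s F = cmean r' F) -> cmean r' F = cmean r F.
Proof.
move=> rp rr' r'r hs; apply: eq_limit => e /(cmean_cont rp (lt_trans rr' r'r))[d d0 hd].
have m0 : 0 < Num.min (d / 2) (r' - r) by rewrite lt_min divr_gt0// subr_gt0.
have m1 : Num.min (d / 2) (r' - r) <= d / 2 by rewrite ge_min lexx.
have m2 : Num.min (d / 2) (r' - r) <= r' - r by rewrite ge_min lexx orbT.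
rewrite -(hs (r + Num.min (d / 2) (r' - r))); last by apply/andP; split; lra.
by apply: hd; [lra|rewrite addrAC subrr add0r ger0_norm; lra].
Qed.

Let cmean_left r : 0 < r -> r < r0 ->
  (forall s, 0 < s < r -> cmean s F = F 0) -> cmean r F = F 0.
Proof.
move=> rp rr hs; apply: eq_limit => e /(cmean_cont (ltW rp) rr)[d d0 hd].
have m0 : 0 < Num.min (d / 2) (r / 2) by rewrite lt_min !divr_gt0.
have m1 : Num.min (d / 2) (r / 2) <= d / 2 by rewrite ge_min lexx.
have m2 : Num.min (d / 2) (r / 2) <= r / 2 by rewrite ge_min lexx orbT.
rewrite modulusBC -(hs (r - Num.min (d / 2) (r / 2))); last by apply/andP; split; lra.
apply: hd; first lra.
by rewrite addrAC subrr add0r normrN ger0_norm; lra.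
Qed.

(** The mean is constant on radii below |p| and on radii above |p|; its continuity in the radius
    joins the two ranges across |p| and reaches down to 0. The point p, where F is only continuous,
    is there for the difference quotients in [cauchy_formula] and [cauchy_estimate]. *)
Lemma mean_value r : 0 < r < r0 -> cmean r F = F 0.
Proof.
move=> /andP[rp rr].
have inner s : 0 < s -> s < modulus p -> s < r0 -> cmean s F = F 0.
  move=> s0 sp sr; rewrite -cmean0; apply: cmean_right => // s' /andP[s'0 s's].
  apply: cmean_annulus => // w /andP[_ ws]; apply: hF; first exact: le_lt_trans ws sr.
  by apply: contraTN sp => /eqP <-; rewrite -leNgt.
have atp s : 0 < s -> s = modulus p -> s < r0 -> cmean s F = F 0.
  move=> s0 sp sr; apply: cmean_left => // s' /andP[s'0 s's].
  by apply: inner => //; [rewrite -sp|exact: lt_trans sr].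
case: (ltgtP r (modulus p)) => [rlt|pr|rE]; [exact: inner| |exact: atp].
have pE : cmean (modulus p) F = F 0.
  have [p0|p0] := ltP 0 (modulus p); first by apply: atp => //; exact: lt_trans rr.
  by rewrite (_ : modulus p = 0) ?cmean0//; apply/le_anti; rewrite p0 modulus_ge0.
rewrite -pE; apply: cmean_right => //; first exact: modulus_ge0.
move=> s /andP[ps sr]; apply: cmean_annulus => //; first exact: le_lt_trans (modulus_ge0 _) ps.
move=> w /andP[sw wr]; apply: hF; first exact: le_lt_trans wr rr.
by apply: contraTN ps => /eqP <-; rewrite -leNgt.
Qed.

End MeanValue.

End CircleMean.

(** * Cauchy and Poisson formulas *)

Section CauchyPoisson.
Context {R : realType}.
Implicit Types (f g : R[i] -> R[i]) (a k w z : R[i]) (r : R).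

Definition disc_hol r0 f := forall w, modulus w < r0 -> chol f w.

Lemma disc_hol_circle r0 r f : disc_hol r0 f -> r < r0 -> circle_cont r f.
Proof. by move=> hf rr w wr; apply/chol_cont/hf; rewrite wr. Qed.

Lemma ccont_sub a w : ccont (fun z => z - a) w.
Proof. by apply: ccontB; [exact: ccont_id|exact: ccont_cst]. Qed.

Lemma circle_neq r a w : modulus a < r -> modulus w = r -> w - a != 0.
Proof. by move=> ar wr; rewrite subr_eq0; apply: contraTneq ar => <-; rewrite wr ltxx. Qed.

Lemma circle_neq0 r w : 0 < r -> modulus w = r -> w != 0.
Proof. by move=> r0 wr; rewrite -modulus_gt0 wr. Qed.

Lemma circle_conj r w : modulus w = r -> w * w^*%C = (r ^+ 2)%:C.
Proof. by move=> <-; exact: modulus_mulJ. Qed.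

Lemma cmean_over g k r0 r : disc_hol r0 g -> 0 < r < r0 -> modulus k * r < 1 ->
  cmean r (fun w => g w / (1 - k * w)) = g 0.
Proof.
move=> hg /andP[rp rr] kr.
have k0 := modulus_ge0 k.
have k1 : 0 < modulus k + 1 by lra.
(* A radius beyond r up to which the denominator does not vanish: 1 - |k| r2 = (1 - |k| r) / (|k| +
   1). *)
pose r2 := r + (1 - modulus k * r) / (modulus k + 1).
have hr2 : r < r2 by rewrite /r2 ltrDl divr_gt0// subr_gt0.
have kr2 : modulus k * r2 < 1.
  rewrite -subr_gt0 (_ : 1 - _ = (1 - modulus k * r) / (modulus k + 1)).
    by rewrite divr_gt0// subr_gt0.
  by rewrite /r2; field; rewrite gt_eqF.
have nz w : modulus w < r2 -> 1 - k * w != 0.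
  move=> wr; rewrite subr_eq0; apply/eqP => h.
  have : modulus (k * w) = 1 by rewrite -h modulus1.
  rewrite modulusM => h1; have := ler_wpM2l k0 (ltW wr).
  by rewrite h1 leNgt kr2.
have hol w : modulus w < Num.min r0 r2 -> chol (fun w => g w / (1 - k * w)) w.
  rewrite lt_min => /andP[w0 w2]; apply: cholM; first exact: hg.
  apply: cholV; first exact: nz.
  by apply: cholB; [exact: chol_cst|apply: cholM; [exact: chol_cst|exact: chol_id]].
rewrite (@mean_value R _ (Num.min r0 r2) 0).
- by rewrite mulr0 subr0 divr1.
- by move=> w /hol/chol_cont.
- by move=> w /hol.
- by rewrite rp lt_min rr.
Qed.

(** On the circle, w / (w - a) is the conjugate of 1 / (1 - k w) with k the conjugate of a divided
    by r^2, a function holomorphic beyond the circle with value 1 at 0. *)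
Lemma cmean_ratio a r : modulus a < r -> cmean r (fun w => w / (w - a)) = 1.
Proof.
move=> ar; have rp : 0 < r := le_lt_trans (modulus_ge0 _) ar.
have r20 : (r ^+ 2)%:C != 0 :> R[i] by rewrite -modulus_gt0 modulus_real normr_gt0 expf_neq0 ?gt_eqF.
pose k := a^*%C / (r ^+ 2)%:C.
have kr : modulus k * r < 1.
  rewrite modulusM modulusJ modulusV modulus_real ger0_norm ?sqr_ge0//.
  rewrite (_ : _ * _ * _ = modulus a / r); last by field; rewrite gt_eqF.
  by rewrite ltr_pdivrMr// mul1r.
have hol1 : disc_hol (r + 1) (fun=> 1 : R[i]) by move=> w _; exact: chol_cst.
have := @cmean_over (fun=> 1) k (r + 1) r hol1; rewrite rp ltrDl ltr01 => /(_ isT kr) h1.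
transitivity (cmean r (fun w => (1 / (1 - k * w))^*%C)).
  apply: eq_cmean; first exact: ltW.
  move=> w wr; have w0 := circle_neq0 rp wr; have wa := circle_neq ar wr.
  have w0' : w^*%C != 0 by rewrite conjc_eq0.
  have E : (1 - k * w)^*%C = (w - a) / w.
    have -> : k * w = a^*%C / w^*%C.
      by rewrite /k -(circle_conj wr); field; rewrite w0 w0'.
    have -> : (1 - a^*%C / w^*%C)^*%C = 1 - (a^*%C / w^*%C)^*%C.
      by case: (a^*%C / w^*%C) => x y; apply: complex_ext; rewrite //= !sub0r.
    have -> : (a^*%C / w^*%C)^*%C = a / w by rewrite -conjc_inv -(rmorphM (@conjc R))/= conjcK.
    by field.
  by rewrite div1r conjc_inv E invf_div.
rewrite cmeanJ; first by rewrite h1 conjc1.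
  exact: ltW.
move=> w wr; apply: ccontM; first exact: ccont_cst.
apply: ccontV.
  rewrite subr_eq0; apply: contraTneq kr => h.
  by rewrite -leNgt -wr -modulusM -h modulus1.
by apply: ccontB; [exact: ccont_cst|apply: ccontM; [exact: ccont_cst|exact: ccont_id]].
Qed.

(** This is Cauchy's formula, since dw / (2 pi i) = w dt / (2 pi) on the circle. Writing f w = f a +
    (w - a) q w leaves the term w q w, whose mean is its value 0 at the origin. *)
Lemma cauchy_formula f r0 r a : disc_hol r0 f -> modulus a < r -> r < r0 ->
  cmean r (fun w => f w * (w / (w - a))) = f a.
Proof.
move=> hf ar rr; have rp : 0 < r := le_lt_trans (modulus_ge0 _) ar.
have [l [q [cq ql fE]]] := hf a (lt_trans ar rr).
have holq w : modulus w < r0 -> w != a -> chol q w.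
  move=> wr wa.
  have wa0 : 0 < modulus (w - a) by rewrite modulus_gt0 subr_eq0.
  apply: (@chol_near _ (fun w => (f w - f a) / (w - a)) _ _ (modulus (w - a))) => //.
    move=> z zw; rewrite fE addrAC subrr add0r mulrC mulKf// subr_eq0.
    by apply: contraTneq zw => ->; rewrite -leNgt modulusBC.
  apply: cholM; first by apply: cholB; [exact: hf|exact: chol_cst].
  apply: cholV; first by rewrite subr_eq0.
  by apply: cholB; [exact: chol_id|exact: chol_cst].
have cq' w : modulus w < r0 -> ccont q w.
  by move=> wr; have [->//|wa] := eqVneq w a; apply/chol_cont/holq.
have ratc : circle_cont r (fun w => w / (w - a)).
  move=> w wr; apply: ccontM; first exact: ccont_id.
  by apply: ccontV; [exact: circle_neq wr|exact: ccont_sub].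
have qc : circle_cont r (fun w => w * q w).
  by move=> w wr; apply: ccontM; [exact: ccont_id|apply: cq'; rewrite wr].
rewrite (@eq_cmean _ _ _ (fun w => w * q w + f a * (w / (w - a)))).
- rewrite cmeanD ?cmeanZ ?(ltW rp)//; last first.
    by move=> w wr; apply: ccontM; [exact: ccont_cst|exact: ratc].
  rewrite cmean_ratio// mulr1.
  rewrite (@mean_value _ _ r0 a) ?mul0r ?add0r ?rp//.
    by move=> w wr; apply: ccontM; [exact: ccont_id|exact: cq'].
  by move=> w wr wa; apply: cholM; [exact: chol_id|exact: holq].
- exact: (ltW rp).
- by move=> w wr; rewrite fE; field; exact: circle_neq wr.
Qed.

(** The Poisson kernel of the disc of radius r at the point a. *)
Definition pk r a w : R := (r ^+ 2 - modulus a ^+ 2) / modulus (w - a) ^+ 2.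

Lemma pk_cont r a : modulus a < r -> circle_cont r (fun w => (pk r a w)%:C).
Proof.
move=> ar w wr.
rewrite (_ : (fun _ => _) = (fun w => (r ^+ 2 - modulus a ^+ 2)%:C *
    ((modulus (w - a))%:C * (modulus (w - a))%:C)^-1)); last first.
  by apply/funext => z; rewrite /pk rmorphM/= fmorphV expr2 rmorphM.
apply: ccontM; first exact: ccont_cst.
apply: ccontV; first by rewrite -rmorphM/= -modulus_gt0 modulus_real normr_gt0 mulf_neq0// modulus_eq0 (circle_neq ar wr).
by apply: ccontM; apply: ccont_modulus; exact: ccont_sub.
Qed.

(** The conjugate of w is r^2 / w on the circle. The second summand is holomorphic in the disc and
    vanishes at 0, so it contributes nothing to a mean against a holomorphic function; this is how
    Poisson's formula follows from Cauchy's. *)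
Lemma pkE r a w : modulus a < r -> modulus w = r ->
  (pk r a w)%:C = w / (w - a) + (a^*%C / (r ^+ 2)%:C) * w / (1 - a^*%C / (r ^+ 2)%:C * w).
Proof.
move=> ar wr; have rp : 0 < r := le_lt_trans (modulus_ge0 _) ar.
have w0 := circle_neq0 rp wr; have wa := circle_neq ar wr.
have w0' : w^*%C != 0 by rewrite conjc_eq0.
have wa' : w^*%C - a^*%C != 0 by rewrite -rmorphB conjc_eq0.
rewrite /pk rmorphM/= fmorphV rmorphB/= -!modulus_mulJ -(circle_conj wr) rmorphB/=.
by field; rewrite wa' wa w0' w0.
Qed.

Lemma poisson_formula f r0 r a : disc_hol r0 f -> modulus a < r -> r < r0 ->
  cmean r (fun w => f w * (pk r a w)%:C) = f a.
Proof.
move=> hf ar rr; have rp : 0 < r := le_lt_trans (modulus_ge0 _) ar.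
pose k := a^*%C / (r ^+ 2)%:C.
have kr : modulus k * r < 1.
  rewrite modulusM modulusJ modulusV modulus_real ger0_norm ?sqr_ge0//.
  rewrite (_ : _ * _ * _ = modulus a / r); last by field; rewrite gt_eqF.
  by rewrite ltr_pdivrMr// mul1r.
pose g w := f w * (k * w).
have hg : disc_hol r0 g.
  by move=> w /hf h; apply: cholM => //; apply: cholM; [exact: chol_cst|exact: chol_id].
have fc := disc_hol_circle hf rr.
have gc := disc_hol_circle hg rr.
have c1 : circle_cont r (fun w => f w * (w / (w - a))).
  move=> w wr; apply: ccontM; first exact: fc.
  apply: ccontM; first exact: ccont_id.
  by apply: ccontV; [exact: circle_neq wr|exact: ccont_sub].
have c2 : circle_cont r (fun w => g w / (1 - k * w)).
  move=> w wr; apply: ccontM; first exact: gc.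
  apply: ccontV.
    rewrite subr_eq0; apply: contraTneq kr => h.
    by rewrite -leNgt -wr -modulusM -h modulus1.
  by apply: ccontB; [exact: ccont_cst|apply: ccontM; [exact: ccont_cst|exact: ccont_id]].
rewrite (@eq_cmean _ _ _ (fun w => f w * (w / (w - a)) + g w / (1 - k * w))).
- rewrite cmeanD ?(ltW rp)// (cauchy_formula hf)// (@cmean_over _ _ r0)// ?rp//.
  by rewrite /g mulr0 mulr0 addr0.
- exact: ltW.
- by move=> w wr; rewrite pkE// /g -/k mulrDr; congr (_ + _); rewrite !mulrA.
Qed.

(** On the circle |w - a| lies between r - |a| and r + |a|. These are the constants of Harnack's
    inequality. *)
Lemma pk_bounds r a w : modulus a < r -> modulus w = r ->
  (r - modulus a) / (r + modulus a) <= pk r a w <= (r + modulus a) / (r - modulus a).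
Proof.
move=> ar wr; have a0 := modulus_ge0 a.
have h1 : modulus (w - a) <= r + modulus a by apply: le_trans (modulusB _ _) _; rewrite wr.
have h2 : r - modulus a <= modulus (w - a).
  by have := modulusD (w - a) a; rewrite subrK wr; lra.
have ra : 0 < r - modulus a by rewrite subr_gt0.
have ra' : 0 < r + modulus a by lra.
have m0 : 0 < modulus (w - a) by exact: lt_le_trans h2.
rewrite /pk (_ : r ^+ 2 - _ = (r - modulus a) * (r + modulus a)); last by ring.
rewrite ler_pdivlMr ?exprn_gt0// ler_pdivrMr ?exprn_gt0//; apply/andP; split.
  rewrite mulrAC ler_pdivrMr// -mulrA ler_pM2l// -expr2.
  by rewrite ler_sqr// nnegrE ltW.
rewrite mulrAC ler_pdivlMr// mulrAC -expr2 mulrC ler_pM2l//.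
by rewrite ler_sqr// nnegrE ltW.
Qed.

Lemma pk_gt0 r a w : modulus a < r -> modulus w = r -> 0 < pk r a w.
Proof.
move=> ar wr; have /andP[h _] := pk_bounds ar wr; apply: lt_le_trans h.
by rewrite divr_gt0 ?subr_gt0// ltr_wpDr ?modulus_ge0//; apply: le_lt_trans (modulus_ge0 _) ar.
Qed.

Lemma cmean_mul_le r f g (B : R) : 0 <= r -> circle_cont r f -> circle_cont r g ->
  (forall w, modulus w = r -> modulus (g w) <= B) ->
  modulus (cmean r (fun w => f w * g w)) <= Re (cmean r (fun w => (modulus (f w))%:C)) * B.
Proof.
move=> r0 cf cg gB.
have cm : circle_cont r (fun w => (modulus (f w))%:C).
  by move=> w wr; apply: ccont_modulus; exact: cf.
have -> : forall x : R[i], Re x * B = Re (B%:C * x).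
  by move=> x; rewrite RecM/= mul0r subr0 mulrC.
rewrite -cmeanZ//; apply: modulus_cmean_dom => //.
- by move=> w wr; apply: ccontM; [exact: cf|exact: cg].
- by move=> w wr; apply: ccontM; [exact: ccont_cst|exact: cm].
- move=> w wr; rewrite modulusM RecM/= mul0r subr0 mulrC.
  by rewrite ler_wpM2r ?modulus_ge0// gB.
Qed.

(** The difference quotient of the kernel 1 / (w - z) is 1 / ((w - x) (w - z)), and it differs from
    its value at x = z by at most |x - z| / d^3, where d is half the distance from z to the
    circle. *)
Lemma cauchy_integral_hol r f z : circle_cont r f -> modulus z < r ->
  chol (fun z => cmean r (fun w => f w / (w - z))) z.
Proof.
move=> cf zr; have rp : 0 < r := le_lt_trans (modulus_ge0 _) zr.
have cinv x : modulus x < r -> circle_cont r (fun w => (w - x)^-1).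
  by move=> xr w wr; apply: ccontV; [exact: circle_neq wr|exact: ccont_sub].
pose q x := cmean r (fun w => f w / ((w - x) * (w - z))).
pose d := (r - modulus z) / 2.
have d0 : 0 < d by rewrite divr_gt0// subr_gt0.
have xin x : modulus (x - z) < d -> modulus x < r - d.
  by move=> /modulus_sub_lt; rewrite /d; lra.
have xin' x : modulus (x - z) < d -> modulus x < r.
  by move=> /xin; lra.
pose M := Re (cmean r (fun w => (modulus (f w))%:C)).
have M0 : 0 <= M.
  apply: Re_cmean_ge0 => [|w _]; first exact: ltW.
  exact: modulus_ge0.
exists (q z); apply: (@cder_near _ (fun x => cmean r (fun w => f w / (w - z)) + (x - z) * q x) _ _ d) => //.
  move=> x /xin' xr; rewrite /q -cmeanZ ?(ltW rp)//; last first.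
    move=> w wr; apply: ccontM; first exact: cf.
    apply: ccontV; first by rewrite mulf_neq0// (circle_neq _ wr).
    by apply: ccontM; exact: ccont_sub.
  rewrite -cmeanD ?(ltW rp)//.
  - apply: eq_cmean; first exact: ltW.
    by move=> w wr; field; rewrite (circle_neq xr wr) (circle_neq zr wr).
  - by move=> w wr; apply: ccontM; [exact: cf|exact: cinv].
  - move=> w wr; apply: ccontM; first exact: ccont_cst.
    apply: ccontM; first exact: cf.
    apply: ccontV; first by rewrite mulf_neq0// (circle_neq _ wr).
    by apply: ccontM; exact: ccont_sub.
exists q; split => //; last by move=> w; rewrite subrr mul0r addr0.
move=> e e0; pose K := M / d ^+ 3 + 1.
have K0 : 0 < K by rewrite /K ltr_wpDl// divr_ge0// exprn_ge0// ltW.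
exists (Num.min d (e / K)) => [|x]; first by rewrite lt_min d0 divr_gt0.
rewrite lt_min => /andP[xd xe].
have xr := xin' _ xd; have xr' := xin _ xd.
have qE : q x - q z = cmean r (fun w => f w * ((x - z) * ((w - x) * (w - z) * (w - z))^-1)).
  rewrite /= /q -[- cmean _ _]mulN1r -cmeanZ ?(ltW rp)//; last first.
    move=> w wr; apply: ccontM; first exact: cf.
    apply: ccontV; first by rewrite mulf_neq0// (circle_neq _ wr).
    by apply: ccontM; exact: ccont_sub.
  rewrite -cmeanD ?(ltW rp)//.
  - apply: eq_cmean; first exact: ltW.
    by move=> w wr; field; rewrite (circle_neq xr wr) (circle_neq zr wr).
  - move=> w wr; apply: ccontM; first exact: cf.
    apply: ccontV; first by rewrite mulf_neq0// ?(circle_neq xr wr) ?(circle_neq zr wr).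
    by apply: ccontM; exact: ccont_sub.
  - move=> w wr; apply: ccontM; first exact: ccont_cst.
    apply: ccontM; first exact: cf.
    apply: ccontV; first by rewrite mulf_neq0// (circle_neq _ wr).
    by apply: ccontM; exact: ccont_sub.
rewrite qE; apply: (@le_lt_trans _ _ (M * (modulus (x - z) / d ^+ 3))).
  apply: cmean_mul_le => //; first exact: ltW.
    move=> w wr; apply: ccontM; first exact: ccont_cst.
    apply: ccontV; first by rewrite !mulf_neq0// ?(circle_neq xr wr) ?(circle_neq zr wr).
    by do 2 (apply: ccontM; last exact: ccont_sub); exact: ccont_sub.
  move=> w wr; rewrite modulusM modulusV !modulusM ler_wpM2l ?modulus_ge0//.
  have low y : modulus y <= r - d -> d <= modulus (w - y).
    by move=> yr; have := modulusD (w - y) y; rewrite subrK wr; lra.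
  have lx := low _ (ltW xr').
  have lz : d <= modulus (w - z) by apply: low; rewrite /d; have := modulus_ge0 z; lra.
  rewrite lef_pV2 ?posrE ?exprn_gt0// ?mulr_gt0//; try exact: lt_le_trans d0 _.
  rewrite exprSr expr2.
  exact: ler_pM (mulr_ge0 (ltW d0) (ltW d0)) (ltW d0) (ler_pM (ltW d0) (ltW d0) lx lz) lz.
rewrite mulrCA; apply: (@le_lt_trans _ _ (modulus (x - z) * K)).
  by rewrite ler_wpM2l ?modulus_ge0// /K lerDl.
by rewrite -ltr_pdivlMr.
Qed.

(** Subtracting two Cauchy formulas shows that the difference quotient of f at a is a Cauchy
    integral [Q] in a neighbourhood of a, hence holomorphic at a as well. *)
Lemma removable f r0 a : disc_hol r0 f -> modulus a < r0 ->
  exists q, disc_hol r0 q /\ forall w, f w = f a + (w - a) * q w.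
Proof.
move=> hf ar0; pose r := (modulus a + r0) / 2.
have ar : modulus a < r by rewrite /r; lra.
have rr : r < r0 by rewrite /r; lra.
have rp : 0 < r := le_lt_trans (modulus_ge0 _) ar.
have fc := disc_hol_circle hf rr.
have gc : circle_cont r (fun w => f w * w / (w - a)).
  move=> w wr; apply: ccontM; first by apply: ccontM; [exact: fc|exact: ccont_id].
  by apply: ccontV; [exact: circle_neq wr|exact: ccont_sub].
pose Q z := cmean r (fun w => f w * w / (w - a) / (w - z)).
pose q w := if w == a then Q a else (f w - f a) / (w - a).
have qE w : f w = f a + (w - a) * q w.
  rewrite /q; case: eqP => [->|/eqP wa]; first by rewrite subrr mul0r addr0.
  by rewrite mulrC divfK ?subr_eq0// subrKC.
exists q; split=> // w wr.
have [->|wa] := eqVneq w a; last first.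
  have wa0 : 0 < modulus (w - a) by rewrite modulus_gt0 subr_eq0.
  apply: (@chol_near _ (fun w => (f w - f a) / (w - a)) _ _ (modulus (w - a))) => //.
    move=> z zw; rewrite /q ifN//.
    by apply: contraTneq zw => ->; rewrite -leNgt modulusBC.
  apply: cholM; first by apply: cholB; [exact: hf|exact: chol_cst].
  apply: cholV; first by rewrite subr_eq0.
  by apply: cholB; [exact: chol_id|exact: chol_cst].
apply: (@chol_near _ Q _ _ (r - modulus a)); rewrite ?subr_gt0//.
  move=> z /modulus_sub_lt; rewrite subrKC => zr; rewrite /q; case: eqP => [->//|/eqP za].
  rewrite -(cauchy_formula hf zr rr) -(cauchy_formula hf ar rr).
  have c0 x : modulus x < r -> circle_cont r (fun w => f w * (w / (w - x))).
    move=> xr u ur; apply: ccontM; first exact: fc.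
    apply: ccontM; first exact: ccont_id.
    by apply: ccontV; [exact: circle_neq ur|exact: ccont_sub].
  rewrite -[- cmean _ _]mulN1r -cmeanZ ?(ltW rp)//; last exact: c0.
  rewrite -cmeanD ?(ltW rp)//; last 2 first.
  - exact: c0.
  - by move=> u ur; apply: ccontM; [exact: ccont_cst|exact: c0].
  rewrite mulrC -cmeanZ ?(ltW rp)//; last first.
    move=> u ur; apply: ccontD; first exact: c0.
    by apply: ccontM; [exact: ccont_cst|exact: c0].
  apply: eq_cmean; first exact: ltW.
  move=> u ur; have := circle_neq ar ur; have := circle_neq zr ur => h1 h2.
  by field; rewrite h1 h2 subr_eq0 za.
exact: cauchy_integral_hol.
Qed.

(** The derivative is the value at 0 of the difference quotient, hence its mean over the circle. *)
Lemma cauchy_estimate f r0 r (l : R[i]) (M : R) : disc_hol r0 f -> 0 < r < r0 -> cder f 0 l ->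
  (forall w, modulus w = r -> modulus (f w - f 0) <= M) -> modulus l <= M / r.
Proof.
move=> hf /andP[rp rr] [q [cq ql fE]] hM.
have r00 : 0 < r0 := lt_trans rp rr.
have holq w : modulus w < r0 -> w != 0 -> chol q w.
  move=> wr w0; have w00 : 0 < modulus w by rewrite modulus_gt0.
  apply: (@chol_near _ (fun w => (f w - f 0) / w) _ _ (modulus w)) => //.
    move=> z zw; rewrite fE addrAC subrr add0r subr0 mulrC mulKf//.
    by apply: contraTneq zw => ->; rewrite sub0r modulusN ltxx.
  apply: cholM; first by apply: cholB; [exact: hf|exact: chol_cst].
  by apply: cholV; [|exact: chol_id].
have cq' w : modulus w < r0 -> ccont q w.
  by move=> wr; have [->//|wa] := eqVneq w 0; apply/chol_cont/holq.
rewrite -ql -(@mean_value _ q r0 0 cq' holq r) ?rp//.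
apply: modulus_cmean_le; first exact: ltW.
  by move=> w wr; apply: cq'; rewrite wr.
move=> w wr; rewrite ler_pdivlMr// -{1}wr -modulusM.
have := hM w wr; rewrite fE addrAC subrr add0r subr0 mulrC; exact.
Qed.

End CauchyPoisson.

(** * Euclidean geometry of C^n *)

Section Euclid.
Context {R : realType} {n : nat}.
Implicit Types (u v w z : 'rV[R[i]]_n) (c : R[i]) (t : R).

Definition cdot u v : R[i] := \sum_j u 0 j * (v 0 j)^*%C.
(* Locked, so that unification never unfolds a norm into its coordinates. *)
Definition rdot u v : R := locked (Re (cdot u v)).
Definition en u : R := locked (Num.sqrt (rdot u u)).

Lemma rdotE u v : rdot u v = Re (cdot u v).
Proof. by rewrite /rdot -lock. Qed.

Lemma enE u : en u = Num.sqrt (rdot u u).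
Proof. by rewrite /en -lock. Qed.

Lemma cdotDl u v w : cdot (u + v) w = cdot u w + cdot v w.
Proof. by rewrite -big_split/=; apply: eq_bigr => j _; rewrite mxE mulrDl. Qed.

Lemma cdotZl c u v : cdot (c *: u) v = c * cdot u v.
Proof. by rewrite mulr_sumr; apply: eq_bigr => j _; rewrite mxE mulrA. Qed.

Lemma cdotNl u v : cdot (- u) v = - cdot u v.
Proof. by rewrite -scaleN1r cdotZl mulN1r. Qed.

Lemma cdotBl u v w : cdot (u - v) w = cdot u w - cdot v w.
Proof. by rewrite cdotDl cdotNl. Qed.

Lemma cdotJ u v : (cdot u v)^*%C = cdot v u.
Proof.
rewrite (big_morph _ (rmorphD (@conjc R)) (rmorph0 (@conjc R))).
by apply: eq_bigr => j _; rewrite rmorphM/= conjcK mulrC.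
Qed.

Lemma rdotC u v : rdot u v = rdot v u.
Proof. by rewrite ?rdotE -cdotJ; case: (cdot v u). Qed.

Lemma rdotDl u v w : rdot (u + v) w = rdot u w + rdot v w.
Proof. by rewrite ?rdotE cdotDl RecD. Qed.

Lemma rdotNl u v : rdot (- u) v = - rdot u v.
Proof. by rewrite ?rdotE cdotNl RecN. Qed.

Lemma rdotBl u v w : rdot (u - v) w = rdot u w - rdot v w.
Proof. by rewrite rdotDl rdotNl. Qed.

Lemma rdotZl t u v : rdot (t%:C *: u) v = t * rdot u v.
Proof. by rewrite ?rdotE cdotZl RecM/= mul0r subr0. Qed.

Lemma rdotDr u v w : rdot u (v + w) = rdot u v + rdot u w.
Proof. by rewrite rdotC rdotDl !(rdotC u). Qed.

Lemma rdotNr u v : rdot u (- v) = - rdot u v.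
Proof. by rewrite rdotC rdotNl rdotC. Qed.

Lemma rdotBr u v w : rdot u (v - w) = rdot u v - rdot u w.
Proof. by rewrite rdotDr rdotNr. Qed.

Lemma rdotZr t u v : rdot u (t%:C *: v) = t * rdot u v.
Proof. by rewrite rdotC rdotZl rdotC. Qed.

Lemma rdot0r u : rdot u 0 = 0.
Proof. by rewrite -(subrr u) rdotBr subrr. Qed.

Lemma cdot_sqr u : cdot u u = (\sum_j modulus (u 0 j) ^+ 2)%:C.
Proof. by rewrite (rmorph_sum (real_complex R)); apply: eq_bigr => j _; rewrite modulus_mulJ. Qed.

Lemma rdot_sqrE u : rdot u u = \sum_j modulus (u 0 j) ^+ 2.
Proof. by rewrite ?rdotE cdot_sqr. Qed.

Lemma rdot_ge0 u : 0 <= rdot u u.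
Proof. by rewrite rdot_sqrE sumr_ge0// => j _; rewrite sqr_ge0. Qed.

Lemma en_ge0 u : 0 <= en u.
Proof. by rewrite enE sqrtr_ge0. Qed.

Lemma en_sqr u : en u ^+ 2 = rdot u u.
Proof. by rewrite enE sqr_sqrtr// rdot_ge0. Qed.

Lemma modulus_le_en u j : modulus (u 0 j) <= en u.
Proof.
rewrite -(@ler_pXn2r _ 2) ?nnegrE ?modulus_ge0 ?en_ge0// en_sqr rdot_sqrE (bigD1 j)//= lerDl.
by rewrite sumr_ge0// => i _; rewrite sqr_ge0.
Qed.

Lemma en0 : en 0 = 0.
Proof.
by rewrite ?enE rdot_sqrE big1 ?sqrtr0// => j _; rewrite mxE modulus0 expr0n.
Qed.

Lemma en_eq0 u : (en u == 0) = (u == 0).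
Proof.
apply/eqP/eqP => [h|->]; last exact: en0.
apply/rowP => j; rewrite mxE; apply/eqP; rewrite -modulus_eq0 eq_le modulus_ge0 andbT.
by rewrite -h modulus_le_en.
Qed.

Lemma en_gt0 u : (0 < en u) = (u != 0).
Proof. by rewrite lt_neqAle en_ge0 andbT eq_sym en_eq0. Qed.

Lemma enZ c u : en (c *: u) = modulus c * en u.
Proof.
rewrite ?enE !rdot_sqrE (_ : \sum_j _ = modulus c ^+ 2 * \sum_j modulus (u 0 j) ^+ 2).
  by rewrite sqrtrM ?sqr_ge0// sqrtr_sqr ger0_norm ?modulus_ge0.
by rewrite mulr_sumr; apply: eq_bigr => j _; rewrite mxE modulusM exprMn.
Qed.

Lemma enZr t u : en (t%:C *: u) = `|t| * en u.
Proof. by rewrite enZ modulus_real. Qed.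

Lemma enN u : en (- u) = en u.
Proof. by rewrite -scaleN1r enZ modulusN modulus1 mul1r. Qed.

Lemma enBC u v : en (u - v) = en (v - u).
Proof. by rewrite -enN opprB. Qed.

Lemma rdot_le u v : rdot u v <= en u * en v.
Proof.
have [->|v0] := eqVneq v 0.
  by rewrite en0 mulr0 rdotC rdotE /cdot big1// => j _; rewrite mxE mul0r.
have ev : 0 < en v by rewrite en_gt0.
have := rdot_ge0 ((en v ^+ 2)%:C *: u - (rdot u v)%:C *: v).
rewrite rdotBl !rdotBr !rdotZl !rdotZr (rdotC v u) -!en_sqr => h.
have h2 : rdot u v ^+ 2 <= (en u * en v) ^+ 2.
  rewrite exprMn; have : 0 <= en v ^+ 2 * (en u ^+ 2 * en v ^+ 2 - rdot u v ^+ 2).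
    by apply: le_trans h _; rewrite le_eqVlt; apply/orP; left; apply/eqP; ring.
  by rewrite pmulr_rge0 ?exprn_gt0// subr_ge0.
have e0 : 0 <= en u * en v by rewrite mulr_ge0 ?en_ge0.
by apply: le_trans (ler_norm _) _; rewrite -sqrtr_sqr -(ger0_norm e0) -[leRHS]sqrtr_sqr ler_wsqrtr.
Qed.

Lemma rdot_norm_le u v : `|rdot u v| <= en u * en v.
Proof.
rewrite ler_norml rdot_le andbT lerNl -rdotNl.
by apply: le_trans (rdot_le _ _) _; rewrite enN.
Qed.

Lemma enD u v : en (u + v) <= en u + en v.
Proof.
rewrite -(@ler_pXn2r _ 2) ?nnegrE ?addr_ge0 ?en_ge0// en_sqr rdotDl !rdotDr (rdotC v u).
by rewrite sqrrD !en_sqr; have := rdot_le u v; lra.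
Qed.

Lemma enB u v : en (u - v) <= en u + en v.
Proof. by rewrite -(enN v) enD. Qed.

Lemma en_sqrB u v : en (u - v) ^+ 2 = en u ^+ 2 - 2 * rdot u v + en v ^+ 2.
Proof. by rewrite !en_sqr rdotBl !rdotBr (rdotC v u); ring. Qed.

Lemma en_dist_trans u v w : en (u - w) <= en (u - v) + en (v - w).
Proof. by apply: le_trans (enD _ _); rewrite subrKA. Qed.

Lemma en_le_sum u : en u <= \sum_j modulus (u 0 j).
Proof.
have s0 : 0 <= \sum_j modulus (u 0 j) by rewrite sumr_ge0// => j _; exact: modulus_ge0.
rewrite -(@ler_pXn2r _ 2) ?nnegrE ?en_ge0// en_sqr rdot_sqrE expr2 mulr_suml ler_sum// => j _.
rewrite expr2 ler_wpM2l ?modulus_ge0// (bigD1 j)//= lerDl.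
by rewrite sumr_ge0// => i _; exact: modulus_ge0.
Qed.

(** Library balls are taken coordinatewise with radii in [R[i]], and a positive element of [R[i]] is
    real. Dividing by n + 1 instead of n covers the case n = 0. *)
Lemma nbhs_enP z (A : set 'rV[R[i]]_n) :
  nbhs z A <-> exists2 e : R, 0 < e & forall w, en (w - z) < e -> A w.
Proof.
split=> [/nbhs_ballP[e /= e0 he]|[e e0 he]].
  have eE : e = (Re e)%:C by case: e e0 {he} => x y /=; rewrite ltcE/= => /andP[/eqP -> _].
  exists (Re e) => [|w wz]; first by move: e0; rewrite {1}eE ltcR.
  apply: he; split=> [//|i j]; rewrite eE /ball/= modulus_ltC ord1.
  by apply: le_lt_trans wz; rewrite modulusBC; have := modulus_le_en (w - z) j; rewrite !mxE.
apply/nbhs_ballP; exists (e / n.+1%:R)%:C => /=; first by rewrite ltcR divr_gt0.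
move=> w h; apply: he; apply: le_lt_trans (en_le_sum _) _.
apply: (@le_lt_trans _ _ (\sum_(j < n) (e / n.+1%:R))).
  apply: ler_sum => j _; rewrite ltW// !mxE.
  by have [_ /(_ 0 j)] := h; rewrite /ball/= modulus_ltC modulusBC.
rewrite sumr_const card_ord -[X in X < _]mulr_natl mulrA ltr_pdivrMr// mulrC.
by rewrite ltr_pM2l// ltr_nat.
Qed.

Lemma open_enP (D : set 'rV[R[i]]_n) : open D <->
  forall z, D z -> exists2 e : R, 0 < e & forall w, en (w - z) < e -> D w.
Proof.
rewrite openE; split => h z /h; first by move/nbhs_enP.
by move=> ?; apply/nbhs_enP.
Qed.

Lemma continuous_enP (r : 'rV[R[i]]_n -> R) z : {for z, continuous r} <->
  forall e : R, 0 < e -> exists2 d : R, 0 < d & forall w, en (w - z) < d -> `|r w - r z| < e.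
Proof.
split => [/cvgrPdist_lt h e /h /nbhs_enP[d d0 hd]|h].
  by exists d => // w /hd; rewrite distrC.
apply/(@cvgrPdist_lt _ _ _ _ (nbhs_filter z)) => e /h[d d0 hd]; apply/nbhs_enP; exists d => // w /hd.
by rewrite distrC.
Qed.

Lemma bounded_set_en (D : set 'rV[R[i]]_n) : bounded_set D ->
  exists2 M : R, 0 < M & forall z, D z -> en z <= M.
Proof.
move=> [K [_ /(_ (K + 1))]].
rewrite ltrDl ltr01 => /(_ isT) hK.
exists (n%:R * Re (K + 2) + 1 + `|n%:R * Re (K + 2)|).
  by have := ler_norm (- (n%:R * Re (K + 2))); rewrite normrN; lra.
move=> z /hK /= h; apply: le_trans (en_le_sum _) _.
have hb : ball (0 : 'rV[R[i]]_n) (K + 2) (- z).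
  rewrite mx_norm_ball /ball_/= sub0r opprK; apply: le_lt_trans h _.
  by rewrite ltrD2l ltr1n.
apply: (@le_trans _ _ (\sum_(j < n) Re (K + 2))).
  apply: ler_sum => j _.
  have [_ /(_ 0 j)] := hb; rewrite /ball/= !mxE sub0r opprK => /ltW.
  by rewrite -modulusC lecE => /andP[].
by rewrite sumr_const card_ord -[X in X <= _]mulr_natl; have := normr_ge0 (n%:R * Re (K + 2)); lra.
Qed.

End Euclid.

#[global] Opaque modulus.

(** * Passage to the topology of the library, and compactness in C^n *)

Section Bridge.
Context {R : realType} {n : nat}.
Implicit Types (u v w z : 'rV[R[i]]_n) (t : R).

Lemma nbhs_modulusP (z : R[i]) (A : set R[i]) :
  nbhs z A <-> exists2 e : R, 0 < e & forall w : R[i], modulus (w - z) < e -> A w.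
Proof.
split=> [/nbhs_ballP[e /= e0 he]|[e e0 he]].
  have eE : e = (Re e)%:C by case: e e0 {he} => x y /=; rewrite ltcE/= => /andP[/eqP -> _].
  exists (Re e) => [|w wz]; first by move: e0; rewrite {1}eE ltcR.
  by apply: he; rewrite eE /ball/= modulus_ltC modulusBC.
apply/nbhs_ballP; exists e%:C => /=; first by rewrite ltcR.
by move=> w; rewrite /ball/= modulus_ltC modulusBC => /he.
Qed.

Lemma derivable_rowP (f : R[i] -> 'rV[R[i]]_n) (z : R[i]) :
  derivable f z 1 <-> forall j, chol (fun w : R[i] => f w 0 j) z.
Proof.
split.
  move=> /cvg_ex[l hl] j.
  exists (l 0 j), (fun w : R[i] => if w == z then l 0 j else (f w 0 j - f z 0 j) / (w - z)); split.
  - move=> e e0.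
    have : nbhs l [set v | modulus (v 0 j - l 0 j) < e].
      apply/nbhs_enP; exists e => // w; apply: le_lt_trans.
      by have := modulus_le_en (w - l) j; rewrite !mxE.
    move=> /hl /nbhs_modulusP[d d0 hd]; exists d => // w wd; rewrite eqxx.
    case: eqP => [_|/eqP wz]; first by rewrite subrr modulus0.
    have := hd (w - z); rewrite subr0 => /(_ wd); rewrite subr_eq0 => /(_ wz) /=.
    rewrite !mxE; apply: le_lt_trans.
    by rewrite /GRing.scale/= mulr1 subrK mulrC.
  - by rewrite eqxx.
  - move=> w; case: eqP => [->|/eqP wz]; first by rewrite subrr mul0r addr0.
    by rewrite mulrC divfK ?subr_eq0// subrKC.
move=> h; have /choice[q hq] : forall j, exists q, ccont q z /\
    forall w : R[i], f w 0 j = f z 0 j + (w - z) * q w.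
  by move=> j; have [l [q [cq _ fE]]] := h j; exists q.
apply/cvg_ex; exists (\row_j q j z) => A /nbhs_enP[e e0 he].
have e1 : 0 < e / n.+1%:R by rewrite divr_gt0.
have /choice[d hd] : forall j, exists d : R, 0 < d /\
    forall w : R[i], modulus (w - z) < d -> modulus (q j w - q j z) < e / n.+1%:R.
  by move=> j; have [d d0 hd] := (hq j).1 _ e1; exists d.
apply/nbhs_modulusP; exists (\big[Order.min/1]_j d j).
  by apply: lt_bigmin => [|j _]; [exact: ltr01|exact: (hd j).1].
move=> k; rewrite subr0 => kd k0; apply: he.
have kj j : modulus k < d j by apply: lt_le_trans kd _; exact: bigmin_le_cond.
apply: le_lt_trans (en_le_sum _) _.
apply: (@le_lt_trans _ _ (\sum_(j < n) (e / n.+1%:R))); last first.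
  rewrite sumr_const card_ord -[X in X < _]mulr_natl mulrA ltr_pdivrMr// mulrC.
  by rewrite ltr_pM2l// ltr_nat.
apply: ler_sum => j _; rewrite ltW// !mxE.
have := (hd j).2 (k + z); rewrite addrK => /(_ (kj j)); apply: le_lt_trans.
rewrite /= /GRing.scale/= mulr1 (hq j).2 addrAC subrr add0r addrK.
by rewrite mulKf.
Qed.

Lemma compact_box (M : R) : compact [set c : R[i] | `|Re c| <= M /\ `|Im c| <= M].
Proof.
have -> : [set c : R[i] | `|Re c| <= M /\ `|Im c| <= M] =
   (fun p : R * R => p.1 +i* p.2) @` (`[-M, M]%classic `*` `[-M, M]%classic).
  apply/seteqP; split => [[x y] /= [hx hy]|_ [[x y] /= [hx hy] <-]] /=.
    by exists (x, y) => //=; rewrite !in_itv/= -!ler_norml.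
  by move: hx hy; rewrite !in_itv/= -!ler_norml.
apply: continuous_compact; last by apply: compact_setX; exact: segment_compact.
apply: continuous_subspaceT => -[x y] A /nbhs_modulusP[e e0 he].
have e2 : 0 < e / 2 by rewrite divr_gt0.
exists (ball x (e / 2), ball y (e / 2)); first by split; exact: nbhsx_ballx.
move=> [x' y'] /= [hx hy]; apply: he; apply: le_lt_trans (modulus_le_ReIm _) _.
by rewrite RecD ImcD RecN ImcN/= (splitr e) distrC [X in _ + X]distrC ltrD.
Qed.

Lemma compact_en (K : set 'rV[R[i]]_n) (M : R) : closed K ->
  (forall z, K z -> en z <= M) -> compact K.
Proof.
move=> cK KM; have h := @rV_compact R[i] n _ (fun=> @compact_box M).
apply: (subclosed_compact cK h).
move=> z /KM zM j /=; split; apply: le_trans zM; apply: le_trans (modulus_le_en z j).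
  exact: Re_le_modulus.
exact: Im_le_modulus.
Qed.

(** The compactness principle behind the uniform constants below. One parameter e is both the radius
    of the neighbourhood and the constant in [P]; since [P] has to persist when e decreases, upper
    bounds are written as e^-1 later on. *)
Lemma compact_uniform (K : set 'rV[R[i]]_n) (M : R) (P : 'rV[R[i]]_n -> R -> Prop) :
  closed K -> (forall z, K z -> en z <= M) ->
  (forall x e e', P x e -> 0 < e' -> e' <= e -> P x e') ->
  (forall x, K x -> exists2 e : R, 0 < e & forall y, K y -> en (y - x) < e -> P y e) ->
  exists2 e : R, 0 < e & forall y, K y -> P y e.
Proof.
move=> cK KM Pmono Ploc.
have /compact_near_coveringP := compact_en cK KM.
move=> /(_ R (at_right 0) (fun e y => K y -> P y e) _).
have hyp : forall x, K x -> \forall y \near x & e \near at_right (0 : R), K y -> P y e.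
  move=> x /Ploc[e e0 he].
  exists ([set y | en (y - x) < e], [set d : R | 0 < d < e]).
    split; first by apply/nbhs_enP; exists e.
    by near=> d => /=; apply/andP; split; near: d; [exact: nbhs_right_gt|exact: nbhs_right_lt].
  move=> [y d] /= [yx /andP[d0 de]] Ky.
  by apply: (Pmono _ e) => //; [exact: he|exact: ltW].
move=> /(_ hyp) H.
have /filter_ex[e [e0 he]] : \forall e \near at_right (0 : R), 0 < e /\ (K `<=` (fun y => K y -> P y e)).
  by near=> e; split; near: e => //; exact: nbhs_right_gt.
by exists e => // y Ky; exact: he.
Unshelve. all: by end_near. Qed.

Lemma closed_enP (K : set 'rV[R[i]]_n) : closed K <->
  forall z, (forall e : R, 0 < e -> exists2 w, K w & en (w - z) < e) -> K z.
Proof.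
rewrite -openC open_enP; split=> [h z hz|h z /= Kz].
  apply: contrapT => /h[e /hz[w Kw wz]] /(_ w wz); exact.
apply: contrapT => hno; apply: Kz; apply: h => e e0; apply: contrapT => hw.
by apply: hno; exists e => // w wz Kw; apply: hw; exists w.
Qed.

Lemma closure_enP (A : set 'rV[R[i]]_n) z : closure A z <->
  forall e : R, 0 < e -> exists2 w, A w & en (w - z) < e.
Proof.
split=> [h e e0|h B /nbhs_enP[e /h[w Aw wz] hB]].
  by have [|w [Aw wz]] := h [set w | en (w - z) < e]; [apply/nbhs_enP; exists e|exists w].
by exists w; split => //; exact: hB.
Qed.

(** C may be unbounded, so it is first cut down to a ball about p. *)
Lemma nearest_point (C : set 'rV[R[i]]_n) (p : 'rV[R[i]]_n) : closed C -> C !=set0 ->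
  exists2 x, C x & forall w, C w -> en (x - p) <= en (w - p).
Proof.
move=> cC [c Cc]; pose K := C `&` [set w | en (w - p) <= en (c - p)].
have cK : closed K.
  apply/closed_enP => z hz; split.
    by apply/(closed_enP C).1 => // e /hz[w [Cw _] wz]; exists w.
  rewrite /= leNgt; apply/negP; rewrite -subr_gt0 => /hz[w [_ /= wc] wz].
  have := en_dist_trans z w p; rewrite (enBC z w) => h.
  by move: wz; rewrite ltrBrDl ltNge; move/negP; apply; apply: le_trans h _; lra.
have KM z : K z -> en z <= en (c - p) + en p.
  by move=> [_ /= h]; rewrite -{1}(subrK p z); apply: le_trans (enD _ _) _; rewrite lerD2r.
have [|||x] := @compact_EVT_max _ R (fun w => - en (w - p)) K.
- by exists c; split => //=; exact: lexx.
- exact: (compact_en cK KM).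
- apply: continuous_subspaceT => z; apply/continuous_enP => e e0; exists e => // w wz.
  apply: le_lt_trans wz; rewrite opprK addrC ler_norml.
  have := en_dist_trans z w p; have := en_dist_trans w z p; rewrite (enBC z w) => h1 h2.
  by apply/andP; split; lra.
rewrite inE => -[Cx xc] hx; exists x => // w Cw.
have [wc|wc] := leP (en (w - p)) (en (c - p)).
  by have := hx w; rewrite inE lerN2; apply; split.
by apply: le_trans (ltW wc).
Qed.

End Bridge.

(** * Supporting hyperplanes of open convex sets *)

Section Convex.
Context {R : realType} {n : nat}.
Implicit Types (X : set 'rV[R[i]]_n) (u v w x y z : 'rV[R[i]]_n) (t : R).

Definition cvx X := forall x y t, X x -> X y -> 0 <= t <= 1 -> X (x + t%:C *: (y - x)).

Definition eopen X := forall z, X z -> exists2 e : R, 0 < e & forall w, en (w - z) < e -> X w.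

Lemma convex_set_cvx X : convex_set X -> cvx X.
Proof.
move=> cX x y t Xx Xy /andP[t0 t1].
have t0' : 0 <= t%:C by rewrite ler0c.
have t1' : t%:C <= 1 by rewrite -[1]/(1%:C) lecR.
have := cX y x (Itv01 t0' t1'); rewrite !inE => /(_ Xy Xx).
rewrite /conv/=; congr X; apply/rowP => j; rewrite !mxE /=. rewrite /unstable.onem; ring.
Qed.

Lemma closure_cvx X : cvx X -> cvx (closure X).
Proof.
move=> cX x y t /closure_enP Xx /closure_enP Xy t01; apply/closure_enP => e e0.
have e2 : 0 < e / 2 by rewrite divr_gt0.
have [x' Xx' hx] := Xx _ e2; have [y' Xy' hy] := Xy _ e2.
exists (x' + t%:C *: (y' - x')); first exact: cX.
have -> : x' + t%:C *: (y' - x') - (x + t%:C *: (y - x)) =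
  (1 - t)%:C *: (x' - x) + t%:C *: (y' - y).
  by apply/rowP => j; rewrite !mxE rmorphB/=; ring.
have /andP[t0 t1] := t01.
apply: le_lt_trans (enD _ _) _; rewrite !enZr !ger0_norm ?subr_ge0//.
have h1 : (1 - t) * en (x' - x) <= (1 - t) * (e / 2) by rewrite ler_wpM2l ?subr_ge0// ltW.
have h2 : t * en (y' - y) <= t * (e / 2) by rewrite ler_wpM2l// ltW.
have [t2|t2] := ltP t (1 / 2).
  have h3 : (1 - t) * en (x' - x) < (1 - t) * (e / 2) by rewrite ltr_pM2l//; lra.
  by lra.
have h3 : t * en (y' - y) < t * (e / 2) by rewrite ltr_pM2l//; lra.
by lra.
Qed.

(** If a ball about w lay in the closure, the point z' slightly beyond w on the ray from o would be
    approximated by points x of X, and w would lie on the segment from such an x to a point o' close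
    to o, hence in X. *)
Lemma off_closure_near X o w : eopen X -> cvx X -> X o -> ~ X w ->
  forall e : R, 0 < e -> exists2 w', ~ closure X w' & en (w' - w) < e.
Proof.
move=> oX cX Xo nXw e e0; apply: contrapT => hno.
have hcl z : en (z - w) < e -> closure X z.
  by move=> zw; apply: contrapT => nz; apply: hno; exists z.
have [h h0 hX] := oX _ Xo.
have wo0 : 0 <= en (w - o) := en_ge0 _.
have wo1 : 0 < en (w - o) + 1 by rewrite ltr_wpDl.
pose t := e / (en (w - o) + 1).
have t0 : 0 < t by rewrite divr_gt0.
pose z' := w + t%:C *: (w - o).
have zz : closure X z'.
  apply: hcl; rewrite /z' addrAC subrr add0r enZr gtr0_norm//.
  by rewrite /t mulrAC ltr_pdivrMr// ltr_pM2l// ltrDl.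
have [x Xx xz] := (closure_enP X z').1 zz _ (mulr_gt0 t0 h0).
have tC : t%:C != 0 :> R[i] by rewrite -modulus_gt0 modulus_real normr_gt0 gt_eqF.
have tC1 : (1 + t)%:C != 0 :> R[i] by rewrite -modulus_gt0 modulus_real normr_gt0 gt_eqF// addr_gt0.
pose o' := o + (t^-1)%:C *: (z' - x).
have Xo' : X o'.
  apply: hX; rewrite /o' addrAC subrr add0r enZr gtr0_norm ?invr_gt0//.
  by rewrite mulrC ltr_pdivrMr// enBC mulrC.
apply: nXw.
have t1 : 0 <= (1 + t)^-1 * t <= 1.
  rewrite mulr_ge0 ?invr_ge0 ?addr_ge0 ?(ltW t0)//= mulrC ler_pdivrMr ?addr_gt0//.
  by rewrite mul1r lerDr.
have -> : w = x + ((1 + t)^-1 * t)%:C *: (o' - x); last exact: cX.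
apply/rowP => j; rewrite /o' /z' !mxE rmorphM/= !fmorphV/=.
have tC1' : 1 + t%:C != 0 by rewrite -[1]/(1%:C) -rmorphD.
by rewrite rmorphD/=; field; rewrite tC tC1'.
Qed.

(** u points from the nearest point p of the closure to w. A point y of X on the wrong side would
    give points of the segment from p to y that are nearer to w. *)
Lemma separation X w : cvx X -> X !=set0 -> ~ closure X w ->
  exists u, en u = 1 /\ forall y, X y -> 0 <= rdot u (w - y).
Proof.
move=> cX [c0 Xc0] nw.
have [p Kp hp] : exists2 p : 'rV[R[i]]_n, closure X p & forall v, closure X v -> en (p - w) <= en (v - w).
  apply: nearest_point; first exact: closed_closure.
  by exists c0; exact: subset_closure.
have wp : 0 < en (w - p).
  by rewrite en_gt0 subr_eq0; apply/eqP => h; apply: nw; rewrite h.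
clear nw.
exists (((en (w - p))^-1)%:C *: (w - p)); split.
  rewrite enZr gtr0_norm; last by rewrite invr_gt0.
  by apply: mulVf; rewrite gt_eqF.
move=> y Xy; rewrite rdotZl; apply: mulr_ge0; first by rewrite invr_ge0 ltW.
have key : rdot (w - p) (y - p) <= 0.
  rewrite leNgt; apply/negP => d0.
  set d := rdot (w - p) (y - p) in d0.
  have yp : 0 < en (y - p) ^+ 2.
    apply: exprn_gt0; rewrite en_gt0; apply: contraTneq d0 => h.
    by rewrite /d h rdot0r ltxx.
  pose t := Num.min 1 (d / en (y - p) ^+ 2).
  have t0 : 0 < t by rewrite lt_min ltr01 divr_gt0.
  have t1 : t <= 1 by rewrite ge_min lexx.
  have td : t * en (y - p) ^+ 2 <= d by rewrite -ler_pdivlMr// ge_min lexx orbT.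
  have cl : closure X (p + t%:C *: (y - p)).
    by apply: (closure_cvx cX Kp (subset_closure Xy)); rewrite (ltW t0) t1.
  have := hp _ cl; rewrite enBC (enBC _ w) -(@ler_pXn2r _ 2) ?nnegrE ?en_ge0//.
  rewrite opprD addrA. rewrite (en_sqrB (w - p)) rdotZr enZr ger0_norm ?(ltW t0)// -/d => h.
  have : t * (2 * d - t * en (y - p) ^+ 2) <= 0.
    by move: h; rewrite exprMn; clear; lra.
  by rewrite pmulr_rle0//; clear -td d0; lra.
have -> : w - y = (w - p) - (y - p) by rewrite opprB addrA subrK.
by rewrite rdotBr -en_sqr subr_ge0; apply: le_trans key _; rewrite sqr_ge0.
Qed.

(** w may be a boundary point. If every unit u failed, compactness of the sphere would make all of
    them fail by a common e, against the separation of a point w' off the closure with |w' - w| < e.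
    Openness of X makes the inequality strict. *)
Lemma support_functional X w : eopen X -> cvx X -> X !=set0 -> ~ X w ->
  exists u, en u = 1 /\ forall y, X y -> 0 < rdot u (w - y).
Proof.
move=> oX cX X0 nXw; have [c0 Xc0] := X0.
suff [u [u1 hu]] : exists u, en u = 1 /\ forall y, X y -> 0 <= rdot u (w - y).
  exists u; split => // y Xy; have [e e0 he] := oX _ Xy.
  have := hu (y + (e / 2)%:C *: u); rewrite opprD addrA (rdotBr _ (w - y)) rdotZr -en_sqr u1 expr1n mulr1.
  have e2 : 0 < e / 2 by rewrite divr_gt0.
  have Xy' : X (y + (e / 2)%:C *: u).
    apply: he; rewrite addrAC subrr add0r enZr u1 mulr1 gtr0_norm//.
    by lra.
  by move=> /(_ Xy'); lra.
apply: contrapT => hno.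
have hneg u : en u = 1 -> exists2 y, X y & rdot u (w - y) < 0.
  move=> u1; apply: contrapT => h; apply: hno; exists u; split=> // y Xy.
  by rewrite leNgt; apply/negP => hy; apply: h; exists y.
have [| | | |e e0 he] := @compact_uniform R n [set u | en u = 1] 1
    (fun u e => exists2 y, X y & rdot u (w - y) < - e).
- apply/closed_enP => z hz /=; apply/eqP; rewrite eq_le; apply/andP; split.
    rewrite leNgt; apply/negP; rewrite -subr_gt0 => /hz[v /= v1 vz].
    by have := enD (z - v) v; rewrite subrK v1 enBC; lra.
  rewrite leNgt; apply/negP; rewrite -subr_gt0 => /hz[v /= v1 vz].
  by have := enD (v - z) z; rewrite subrK v1; lra.
- by move=> z /= ->.
- by move=> u a b [y Xy hy] b0 ba; exists y => //; lra.
- move=> u /= /hneg[y Xy hy].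
  have wy : 0 < en (w - y) + 1 by rewrite ltr_wpDl// en_ge0.
  pose d := - rdot u (w - y); have d0 : 0 < d by rewrite /d; lra.
  exists (Num.min (d / 2) (d / 2 / (en (w - y) + 1))) => [|v _].
    by rewrite lt_min !divr_gt0.
  rewrite lt_min => /andP[_ vu]; exists y => //.
  have h1 : Num.min (d / 2) (d / 2 / (en (w - y) + 1)) <= d / 2 by rewrite ge_min lexx.
  have h2 : rdot (v - u) (w - y) < d / 2.
    apply: le_lt_trans (rdot_le _ _) _.
    move: vu; rewrite ltr_pdivlMr//; apply: le_lt_trans.
    by rewrite ler_wpM2l ?en_ge0// lerDl.
  by move: h2; rewrite rdotBl; rewrite /d in d0 h1 *; lra.
have [w' nw' ww'] := off_closure_near oX cX Xc0 nXw e0.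
have [u [u1 hu]] := separation cX X0 nw'.
have [y Xy hy] := he u u1.
have := hu y Xy; rewrite (_ : w' - y = (w - y) + (w' - w)); last first.
  by rewrite [RHS]addrC addrA subrK.
rewrite rdotDr; have := rdot_le u (w' - w); rewrite u1 mul1r; lra.
Qed.

End Convex.

(** * Harnack's inequality *)

Section Harmonic.
Context {R : realType}.
Implicit Types (g : R[i] -> R[i]) (a w : R[i]) (r : R).

(** By continuity the integrand stays above half its value at angle 0 on a short arc; the rest of
    the circle contributes a nonnegative amount. *)
Lemma Re_cmean_gt0 r (F : R[i] -> R[i]) : 0 <= r -> circle_cont r F ->
  (forall w, modulus w = r -> 0 < Re (F w)) -> 0 < Re (cmean r F).
Proof.
move=> r0 cF F0; rewrite /cmean RecM/= mul0r subr0 mulr_gt0 ?invr_gt0 ?twopi_gt0//.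
have cp t : pcont (fun t => F (circ r t)) t by exact: pcont_circ.
have F00 : 0 < Re (F (circ r 0)) by apply: F0; rewrite modulus_circ.
have [d d0 hd] := cp 0 _ (divr_gt0 F00 (ltr0n _ 2)).
pose c := Num.min (d / 2) pi.
have c0 : 0 < c by rewrite lt_min divr_gt0// pi_gt0.
have cd : c <= d / 2 by rewrite ge_min lexx.
have cpi : c <= pi by rewrite ge_min lexx orbT.
have c2 : 0 <= c <= 2 * pi by rewrite (ltW c0)/=; have := pi_gt0 R; lra.
rewrite -Re_cint (@cint_split _ 0 (2 * pi) _ (fun t _ => cp t) c c2) RecD ltr_wpDr//.
  by apply: Re_cint_ge0 => t _; rewrite ltW// F0// modulus_circ.
apply: (@lt_le_trans _ _ (rint (fun=> Re (F (circ r 0)) / 2) 0 c)).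
  by rewrite rint_cst ?(ltW c0)// subr0 mulr_gt0// divr_gt0.
rewrite Re_cint; apply: le_rint => [t _|t _|t /andP[t0 tc]].
- exact: cvg_cst.
- by apply: pcont_Re.
- have := hd t; rewrite subr0 ger0_norm// => /(_ _)/(le_lt_trans (Re_le_modulus _)).
  have td : t < d by lra.
  by move=> /(_ td); rewrite RecD RecN ltr_norml => /andP[+ _]; lra.
Qed.

Lemma harnack g r0 r a : disc_hol r0 g -> modulus a < r -> r < r0 ->
  (forall w, modulus w = r -> 0 <= Re (g w)) ->
  (r - modulus a) / (r + modulus a) * Re (g 0) <= Re (g a).
Proof.
move=> hg ar rr g0; have rp : 0 < r := le_lt_trans (modulus_ge0 _) ar.
have gc := disc_hol_circle hg rr.
set k := (r - modulus a) / (r + modulus a).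
rewrite -(poisson_formula hg ar rr).
have -> : k * Re (g 0) = Re (k%:C * g 0) by rewrite RecM/= mul0r subr0.
rewrite -(@mean_value _ g r0 0 _ _ r); last 3 first.
- by move=> w /hg/chol_cont.
- by move=> w /hg.
- by rewrite rp.
rewrite -cmeanZ ?(ltW rp)// -subr_ge0 -RecN -RecD -mulN1r.
have c1 : circle_cont r (fun w => g w * (pk r a w)%:C).
  by move=> w wr; apply: ccontM; [exact: gc|exact: pk_cont].
have c2 : circle_cont r (fun w => k%:C * g w).
  by move=> w wr; apply: ccontM; [exact: ccont_cst|exact: gc].
have c3 : circle_cont r (fun w => -1 * (k%:C * g w)).
  by move=> w wr; apply: ccontM; [exact: ccont_cst|exact: c2].
rewrite -cmeanZ ?(ltW rp)// -cmeanD ?(ltW rp)//.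
apply: Re_cmean_ge0 => [|w wr]; first exact: (ltW rp).
have -> : g w * (pk r a w)%:C + -1 * (k%:C * g w) = (pk r a w - k)%:C * g w.
  by rewrite rmorphB/=; ring.
rewrite RecM/= mul0r subr0 mulr_ge0 ?g0// subr_ge0.
by have /andP[] := pk_bounds ar wr.
Qed.

(** Positivity is known inside the disc only, so [harnack] is applied on radii 1 - e with e
    small. *)
Lemma harnack_disc g a : disc_hol 1 g -> modulus a < 1 ->
  (forall w, modulus w < 1 -> 0 <= Re (g w)) ->
  (1 - modulus a) / (1 + modulus a) * Re (g 0) <= Re (g a).
Proof.
move=> hg a1 g0; have a0 := modulus_ge0 a.
have ap : 0 < 1 + modulus a by lra.
rewrite mulrAC ler_pdivrMr// leNgt; apply/negP.
set m := modulus a in a1 a0 ap *.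
set H := Re (g 0); set h := Re (g a) => lt1.
have hr r : m < r -> r < 1 -> (r - m) * H <= h * (r + m).
  move=> mr r1; have := harnack hg mr r1; rewrite -/m mulrAC ler_pdivrMr; last lra.
  by apply=> w wr; apply: g0; rewrite wr.
pose d := (1 - m) * H - h * (1 + m).
have d0 : 0 < d by rewrite /d subr_gt0.
pose e := Num.min ((1 - m) / 2) (d / 2 / (`|H| + `|h| + 1)).
have K0 : 0 < `|H| + `|h| + 1 by rewrite ltr_wpDl// addr_ge0.
have e0 : 0 < e by rewrite lt_min !divr_gt0// subr_gt0.
have e1 : e <= (1 - m) / 2 by rewrite ge_min lexx.
have e2 : e * (`|H| + `|h| + 1) <= d / 2 by rewrite -ler_pdivlMr// ge_min lexx orbT.
have := hr (1 - e); have -> : m < 1 - e by lra.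
have -> : 1 - e < 1 by lra.
move=> /(_ isT isT).
have h1 : e * (H - h) <= e * (`|H| + `|h| + 1).
  rewrite ler_wpM2l ?(ltW e0)//; have := ler_norm H; have := ler_norm (- h); rewrite normrN; lra.
by rewrite /d in d0 e2; nra.
Qed.

End Harmonic.

(** * Holomorphic discs in convex sets *)

Section VectorDiscs.
Context {R : realType} {n : nat}.
Implicit Types (f : R[i] -> 'rV[R[i]]_n) (X : set 'rV[R[i]]_n) (r : R).

Definition vhol r f := forall j, disc_hol r (fun z => f z 0 j).

Lemma vhol_cdot r f (u w : 'rV[R[i]]_n) : vhol r f ->
  disc_hol r (fun z => cdot (w - f z) u).
Proof.
move=> hf z zr; apply: chol_sum => j; apply: cholM; last exact: chol_cst.
rewrite (_ : (fun _ => _) = (fun z => w 0 j - f z 0 j)); last by apply/funext => ?; rewrite !mxE.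
by apply: cholB; [exact: chol_cst|exact: hf].
Qed.

(** A maximum principle. If f a were outside X, a functional supporting X at f a would be positive
    on the boundary values, while its Poisson mean is its value 0 at a. *)
Lemma hull X f (r0 : R) : eopen X -> cvx X -> X !=set0 -> vhol r0 f -> 1 < r0 ->
  (forall z : R[i], modulus z = 1 -> X (f z)) -> forall z : R[i], modulus z < 1 -> X (f z).
Proof.
move=> oX cX X0 hf r01 fX a a1; apply: contrapT => nX.
have [u [u1 hu]] := support_functional oX cX X0 nX.
have hg := vhol_cdot u (f a) hf.
have := poisson_formula hg a1 r01.
rewrite subrr [RHS]/cdot big1; last by move=> j _; rewrite mxE mul0r.
move=> E.
suff : 0 < Re (cmean 1 (fun z => cdot (f a - f z) u * (pk 1 a z)%:C)) by rewrite E /= ltxx.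
apply: Re_cmean_gt0 => //.
  by move=> w wr; apply: ccontM; [apply: (disc_hol_circle hg r01)|exact: pk_cont].
move=> w wr; rewrite RecM/= mulr0 subr0 mulr_gt0//.
  by rewrite -rdotE rdotC; apply: hu; exact: fX.
exact: pk_gt0.
Qed.

Definition margin X z (e : R) := forall w, en (w - z) < e -> X w.

(** For every w outside X, the functional supporting X at w is a positive harmonic function along f,
    and its value at 0 is at least e. Harnack's inequality bounds it from below at z, hence also the
    distance from f z to w. *)
Lemma harnack_margin X f (e : R) : eopen X -> cvx X -> vhol 1 f ->
  (forall z : R[i], modulus z < 1 -> X (f z)) -> margin X (f 0) e ->
  forall z : R[i], modulus z < 1 -> margin X (f z) (e * ((1 - modulus z) / (1 + modulus z))).
Proof.
move=> oX cX hf fX me z z1 w wz; apply: contrapT => nX.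
have X0 : X !=set0 by exists (f 0); apply: fX; rewrite modulus0 ltr01.
have [u [u1 hu]] := support_functional oX cX X0 nX.
have hg := vhol_cdot u w hf.
have /(_ _)/= := harnack_disc hg z1.
have g0 y : modulus y < 1 -> 0 <= Re (cdot (w - f y) u).
  by move=> y1; rewrite -rdotE rdotC; apply: ltW; apply: hu; exact: fX.
move=> /(_ g0); rewrite -!rdotE; apply/negP; rewrite -ltNge.
have k0 : 0 < (1 - modulus z) / (1 + modulus z).
  by rewrite divr_gt0 ?subr_gt0// ltr_wpDr ?modulus_ge0.
rewrite rdotC; apply: le_lt_trans (rdot_le _ _) _.
rewrite u1 mul1r; apply: lt_le_trans wz _; rewrite mulrC ler_wpM2l ?(ltW k0)//.
rewrite leNgt; apply/negP => lt1.
set H := rdot (w - f 0) u in lt1.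
have H0 : 0 < H by rewrite /H rdotC; apply: hu; apply: fX; rewrite modulus0 ltr01.
have : X (f 0 + H%:C *: u).
  by apply: me; rewrite addrAC subrr add0r enZr u1 mulr1 gtr0_norm.
move=> /hu; rewrite opprD addrA rdotBr rdotZr -en_sqr u1 expr1n mulr1 rdotC -/H subrr.
by rewrite ltxx.
Qed.

End VectorDiscs.

(** * Kobayashi discs *)

Section Moebius.
Context {R : realType}.
Implicit Types (z w a : R[i]) (T U V r : R).

(* The point of the real axis at signed hyperbolic distance ln U from 0. *)
Definition tp U : R := (U - 1) / (U + 1).

Lemma tp1 : tp 1 = 0.
Proof. by rewrite /tp subrr mul0r. Qed.

Lemma tp_lt1 U : 0 < U -> -1 < tp U < 1.
Proof.
move=> U0; have U1 : 0 < U + 1 by lra.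
by rewrite /tp ltr_pdivlMr// ltr_pdivrMr//; apply/andP; split; lra.
Qed.

Lemma modulus_tp U : 0 < U -> modulus (tp U)%:C < 1.
Proof. by move=> /tp_lt1 h; rewrite modulus_real ltr_norml. Qed.

Lemma tpV U : 0 < U -> tp U^-1 = - tp U.
Proof.
move=> U0; rewrite /tp; field.
by rewrite gt_eqF ?gt_eqF//; lra.
Qed.

Lemma tp_ge0 U : 1 <= U -> 0 <= tp U.
Proof. by move=> U1; rewrite /tp divr_ge0//; lra. Qed.

Lemma tp_gt0 U : 1 < U -> 0 < tp U.
Proof. by move=> U1; rewrite /tp divr_gt0//; lra. Qed.

Lemma tp_lt U V : 0 < U -> U < V -> tp U < tp V.
Proof.
move=> U0 UV; rewrite /tp ltr_pdivrMr; last lra.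
rewrite mulrAC ltr_pdivlMr; last lra.
lra.
Qed.

Lemma tpK r : -1 < r < 1 -> tp ((1 + r) / (1 - r)) = r.
Proof.
move=> /andP[r1 r2]; rewrite /tp; field.
by rewrite gt_eqF ?gt_eqF//; lra.
Qed.

Definition moeb a z := (z + a) / (1 + a^*%C * z).

Lemma moeb_identity a z :
  modulus (1 + a^*%C * z) ^+ 2 - modulus (z + a) ^+ 2 = (1 - modulus a ^+ 2) * (1 - modulus z ^+ 2).
Proof.
rewrite !modulus_sqr; case: a => b c; case: z => x y /=; ring.
Qed.

Lemma moeb_den a z : modulus a < 1 -> modulus z < 1 -> 1 + a^*%C * z != 0.
Proof.
move=> a1 z1; rewrite addrC addr_eq0; apply/eqP => h.
have : modulus (a^*%C * z) = 1 by rewrite h modulusN modulus1.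
rewrite modulusM modulusJ => E.
have := modulus_ge0 a; have := modulus_ge0 z; move: E a1 z1; clear; nra.
Qed.

Lemma modulus_moeb a z : modulus a < 1 -> modulus z < 1 -> modulus (moeb a z) < 1.
Proof.
move=> a1 z1; have d0 := moeb_den a1 z1.
rewrite modulusM modulusV ltr_pdivrMr ?modulus_gt0// mul1r.
rewrite -(@ltr_pXn2r _ 2) ?nnegrE ?modulus_ge0// -subr_gt0 moeb_identity mulr_gt0// subr_gt0.
  by rewrite -(expr1n _ 2) ltr_pXn2r ?nnegrE ?modulus_ge0.
by rewrite -(expr1n _ 2) ltr_pXn2r ?nnegrE ?modulus_ge0.
Qed.

Lemma moeb_hol a : modulus a < 1 -> disc_hol 1 (moeb a).
Proof.
move=> a1 z z1; apply: cholM; first by apply: cholD; [exact: chol_id|exact: chol_cst].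
apply: cholV; first exact: moeb_den.
by apply: cholD; [exact: chol_cst|apply: cholM; [exact: chol_cst|exact: chol_id]].
Qed.

(** [tp U] is tanh (ln U / 2), so this is the addition theorem of tanh: translations along the real
    diameter multiply the parameters. *)
Lemma moeb_tp U V : 0 < U -> 0 < V -> moeb (tp V)%:C (tp U)%:C = (tp (U * V))%:C.
Proof.
move=> U0 V0; rewrite /moeb conjc_real -[1]/(1%:C) -!rmorphM/= -!rmorphD/= -fmorphV -rmorphM/=.
congr (_%:C); rewrite /tp.
have UV : 0 < U * V by rewrite mulr_gt0.
have e1 : U + 1 != 0 by rewrite gt_eqF//; lra.
have e2 : V + 1 != 0 by rewrite gt_eqF//; lra.
have e3 : U * V + 1 != 0 by rewrite gt_eqF//; lra.
have e4 : 1 + (V - 1) / (V + 1) * ((U - 1) / (U + 1)) = 2 * (U * V + 1) / ((U + 1) * (V + 1)).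
  by field; rewrite e1 e2.
by rewrite e4; field; rewrite e1 e2 e3.
Qed.

Lemma moebK a z : modulus a < 1 -> modulus z < 1 -> moeb a (moeb (- a) z) = z.
Proof.
move=> a1 z1.
have d0 : 1 + (- a)^*%C * z != 0 by apply: moeb_den; rewrite ?modulusN.
have w1 : modulus (moeb (- a) z) < 1 by apply: modulus_moeb; rewrite ?modulusN.
have d1 := moeb_den a1 w1.
apply: (mulIf d1); rewrite /moeb mulfVK//.
move: d0; rewrite rmorphN/= mulNr => d0.
by field.
Qed.

End Moebius.

Section KobayashiDiscs.
Context {R : realType} {n : nat}.
Implicit Types (f g : R[i] -> 'rV[R[i]]_n) (X : set 'rV[R[i]]_n) (x y z w : 'rV[R[i]]_n) (r T U : R).

Definition disc_in X f := vhol 1 f /\ forall z : R[i], modulus z < 1 -> X (f z).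

Lemma vhol_comp r r' f (h : R[i] -> R[i]) : vhol r' f -> disc_hol r h ->
  (forall z : R[i], modulus z < r -> modulus (h z) < r') -> vhol r (f \o h).
Proof.
move=> hf hh hr j z zr; apply: (@chol_comp _ (fun u => f u 0 j)); first exact: hh.
by apply: hf; exact: hr.
Qed.

Lemma disc_in_comp X f (h : R[i] -> R[i]) : disc_in X f -> disc_hol 1 h ->
  (forall z : R[i], modulus z < 1 -> modulus (h z) < 1) -> disc_in X (f \o h).
Proof.
move=> [hf fX] hh h1; split; first exact: vhol_comp hf hh h1.
by move=> z /h1/fX.
Qed.

Lemma disc_shift X f U : disc_in X f -> 0 < U ->
  exists g, disc_in X g /\ forall V, 0 < V -> g (tp V)%:C = f (tp (V * U))%:C.
Proof.
move=> df U0; exists (f \o moeb (tp U)%:C); split.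
  apply: disc_in_comp df (moeb_hol (modulus_tp U0)) _ => z; exact: modulus_moeb (modulus_tp U0).
by move=> V V0 /=; rewrite moeb_tp.
Qed.

Lemma chol_scale (c : R[i]) (z : R[i]) : chol (fun u => c * u) z.
Proof. by apply: cholM; [exact: chol_cst|exact: chol_id]. Qed.

Lemma disc_flip X f : disc_in X f ->
  exists g, disc_in X g /\ forall V, 0 < V -> g (tp V)%:C = f (tp V^-1)%:C.
Proof.
move=> df; exists (f \o (fun u => -1 * u)); split.
  apply: disc_in_comp df _ _ => z; first by move=> _; exact: chol_scale.
  by rewrite mulN1r modulusN.
by move=> V V0 /=; rewrite tpV// rmorphN/= mulN1r.
Qed.

(** The position of the two points in the disc is normalised; [kobayashi_lt] brings any other
    position to this one by an automorphism of the disc. *)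
Definition Kd X z w T := 1 <= T /\
  exists f, [/\ disc_in X f, f 0 = z & f (tp T)%:C = w].

(* The closure of Kd in T, which makes infima attained. *)
Definition Kle X z w T := forall T', T < T' -> Kd X z w T'.

Lemma Kd_points X f U V : disc_in X f -> 0 < U -> U <= V ->
  Kd X (f (tp U)%:C) (f (tp V)%:C) (V / U).
Proof.
move=> df U0 UV; split; first by rewrite ler_pdivlMr// mul1r.
have [g [dg gE]] := disc_shift df U0; exists g; split => //.
  by have := gE 1 ltr01; rewrite tp1 mul1r.
rewrite gE; first by rewrite divfK// gt_eqF.
by rewrite divr_gt0//; exact: lt_le_trans UV.
Qed.

(** Precomposition with a real contraction of the disc moves the second point from [tp T] out to
    [tp T']. *)
Lemma Kd_mono X z w T T' : T <= T' -> Kd X z w T -> Kd X z w T'.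
Proof.
move=> TT [T1 [f [df f0 fT]]]; split; first exact: le_trans TT.
have [T'1|T'1] := leP T' 1.
  have TE : T' = T by apply/le_anti; rewrite TT (le_trans T'1 T1).
  by exists f; rewrite TE.
have t'0 := tp_gt0 T'1; have t0 := tp_ge0 T1.
have tt : tp T <= tp T'.
  move: TT; rewrite le_eqVlt => /orP[/eqP -> //|TT].
  by rewrite ltW// tp_lt//; lra.
have c0 : 0 <= tp T / tp T' by rewrite divr_ge0// ltW.
have c1 : tp T / tp T' <= 1 by rewrite ler_pdivrMr// mul1r.
exists (f \o (fun u => (tp T / tp T')%:C * u)); split => /=.
- apply: disc_in_comp df _ _ => u; first by move=> _; exact: chol_scale.
  move=> u1; rewrite modulusM modulus_real ger0_norm//.
  by apply: le_lt_trans u1; rewrite ler_piMl ?modulus_ge0.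
- by rewrite mulr0.
- by rewrite -rmorphM/= divfK// gt_eqF.
Qed.

Lemma Kd_Kle X z w T : Kd X z w T -> Kle X z w T.
Proof. by move=> h T' TT'; apply: Kd_mono h; exact: ltW. Qed.

Lemma Kle_mono X z w T T' : T <= T' -> Kle X z w T -> Kle X z w T'.
Proof. by move=> TT h S TS; apply: h; exact: le_lt_trans TS. Qed.

Lemma Kle_ge1 X z w T : Kle X z w T -> 1 <= T.
Proof.
move=> h; rewrite leNgt; apply/negP => T1.
by have [] := h ((T + 1) / 2) ltac:(lra); lra.
Qed.

Lemma KdC X z w T : Kd X z w T -> Kd X w z T.
Proof.
move=> [T1 [f [df <- <-]]]; have T0 : 0 < T by lra.
have [g [dg gE]] := disc_flip df.
have := @Kd_points X g T^-1 1 dg; rewrite invr_gt0 invf_le1// => /(_ T0 T1).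
by rewrite gE ?invr_gt0// invrK gE// invr1 tp1 mul1r.
Qed.

Lemma KleC X z w T : Kle X z w T -> Kle X w z T.
Proof. by move=> h T' /h; exact: KdC. Qed.

Lemma Kle_in X z w T : Kle X z w T -> X z /\ X w.
Proof.
move=> h; have [|T1 [f [[hf fX] <- <-]]] := h (T + 1); first lra.
split; apply: fX; first by rewrite modulus0 ltr01.
by apply: modulus_tp; lra.
Qed.

Lemma Kle_refl X z : X z -> Kle X z z 1.
Proof.
move=> Xz; apply: Kd_Kle; split => //; exists (fun=> z); split => //; split => //.
by move=> j u _; exact: chol_cst.
Qed.

End KobayashiDiscs.

Section KobayashiBridge.
Context {R : realType} {n : nat}.
Implicit Types (f g : R[i] -> 'rV[R[i]]_n) (X : set 'rV[R[i]]_n) (x y z w : 'rV[R[i]]_n) (r T U : R).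

Lemma holomorphic_disc_in X f : holomorphic_disc X f <-> disc_in X f.
Proof.
have ud (z : R[i]) : unit_disc z <-> modulus z < 1.
  by rewrite /unit_disc /= -[1]/(1%:C) modulus_ltC.
split => [h|[hf fX] z /ud z1]; last first.
  by split; [apply/derivable_rowP => j; exact: hf|exact: fX].
split=> [j z /ud/h[dz _]|z /ud/h[]//].
by move/derivable_rowP : dz; exact.
Qed.

Lemma hyperbolic_dist0 T : 1 <= T -> hyperbolic_dist 0 (tp T)%:C = ln T.
Proof.
move=> T1; rewrite /hyperbolic_dist subr0 conjc0 mul0r subr0 divr1 modulus_real ger0_norm ?tp_ge0//.
by congr (ln _); rewrite /tp; field; rewrite gt_eqF//; lra.
Qed.

Lemma kobayashi_le X z w T : Kd X z w T -> (kobayashi X z w <= (ln T)%:E)%E.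
Proof.
move=> [T1 [f [df f0 fT]]]; apply: ereal_inf_lbound.
exists 0, (tp T)%:C; split.
- by rewrite /unit_disc /= normr0 ltr01.
- by rewrite /unit_disc /= -[1]/(1%:C) modulus_ltC modulus_tp//; lra.
- by exists f; split => //; apply/holomorphic_disc_in.
- by rewrite hyperbolic_dist0.
Qed.

(** A Moebius map sends 0 to zeta, and the rotation c turns the positive real axis towards the
    preimage of eta. *)
Lemma kobayashi_lt X z w (t : R) : (kobayashi X z w < t%:E)%E ->
  exists2 T, ln T < t & Kd X z w T.
Proof.
move=> /ereal_inf_lt[_ [zeta [eta [hz he [f [/holomorphic_disc_in df f1 f2]] ->]]]].
have z1 : modulus zeta < 1 by rewrite -modulus_ltC.
have e1 : modulus eta < 1 by rewrite -modulus_ltC.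
rewrite lte_fin /hyperbolic_dist.
have sE : (eta - zeta) / (1 - zeta^*%C * eta) = moeb (- zeta) eta.
  by rewrite /moeb rmorphN/= mulNr.
rewrite sE; set s := moeb _ _; set m := modulus s => ht.
have m1 : m < 1 by apply: modulus_moeb; rewrite ?modulusN.
have m0 : 0 <= m := modulus_ge0 _.
have [c [c1 cE]] : exists c : R[i], modulus c = 1 /\ c * m%:C = s.
  have [s0|s0] := eqVneq s 0.
    by exists 1; rewrite modulus1 /m s0 modulus0 mulr0.
  have mC : m%:C != 0 :> R[i] by rewrite -modulus_gt0 modulus_real normr_gt0 gt_eqF// modulus_gt0.
  exists (s / m%:C); rewrite divfK// modulusM modulusV modulus_real ger0_norm// mulfV//.
  by rewrite gt_eqF// modulus_gt0.
exists ((1 + m) / (1 - m)) => //; split.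
  by rewrite ler_pdivlMr ?subr_gt0//; lra.
exists (f \o (fun u => moeb zeta (c * u))); split => /=.
- apply: disc_in_comp df _ _ => u u1.
    apply: (@chol_comp _ (moeb zeta)); first exact: chol_scale.
    by apply: moeb_hol => //; rewrite modulusM c1 mul1r.
  by apply: modulus_moeb => //; rewrite modulusM c1 mul1r.
- by rewrite mulr0 /moeb mulr0 addr0 add0r divr1.
- by rewrite tpK ?m1 ?andbT ?cE ?moebK//; lra.
Qed.

(** An infimum at most ln T says that every T' above T is reached, which is what [Kle] records; both
    directions pass through strictly larger parameters. *)
Lemma KleP X z w T : 1 <= T -> Kle X z w T <-> (kobayashi X z w <= (ln T)%:E)%E.
Proof.
move=> T1; have T0 : 0 < T by lra.
split => [h|h T' TT'].
  apply/lee_addgt0Pr => e e0; rewrite -EFinD -[e]expRK -lnM ?posrE ?expR_gt0//.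
  apply: kobayashi_le; apply: h.
  by rewrite ltr_pMr// -expR0 ltr_expR.
have T'0 : 0 < T' by exact: lt_trans TT'.
have hlt : ((ln T)%:E < (ln T')%:E)%E by rewrite lte_fin ltr_ln ?posrE.
have [S hS KS] := @kobayashi_lt X z w (ln T') (le_lt_trans h hlt).
have S1 := KS.1; apply: (Kd_mono _ KS).
by rewrite -ler_ln ?posrE//; [exact: ltW|lra].
Qed.

End KobayashiBridge.

Section DiscAlgebra.
Context {R : realType} {n : nat}.
Implicit Types (f g : R[i] -> 'rV[R[i]]_n) (X : set 'rV[R[i]]_n) (r s : R).

Lemma vholD r f g : vhol r f -> vhol r g -> vhol r (fun z => f z + g z).
Proof.
move=> hf hg j z zr.
rewrite (_ : (fun _ => _) = (fun z => f z 0 j + g z 0 j)); last by apply/funext => ?; rewrite mxE.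
by apply: cholD; [exact: hf|exact: hg].
Qed.

Lemma vholZ r (c : R[i] -> R[i]) f : disc_hol r c -> vhol r f -> vhol r (fun z => c z *: f z).
Proof.
move=> hc hf j z zr.
rewrite (_ : (fun _ => _) = (fun z => c z * f z 0 j)); last by apply/funext => ?; rewrite mxE.
by apply: cholM; [exact: hc|exact: hf].
Qed.

Lemma vhol_cst r v : vhol r (fun=> v : 'rV[R[i]]_n).
Proof. by move=> j z _; exact: chol_cst. Qed.

Lemma vhol_sub r s f : s <= r -> vhol r f -> vhol s f.
Proof. by move=> sr hf j z zs; apply: hf; exact: lt_le_trans sr. Qed.

Lemma vholB r f g : vhol r f -> vhol r g -> vhol r (fun z => f z - g z).
Proof.
move=> hf hg j z zr.
rewrite (_ : (fun _ => _) = (fun z => f z 0 j - g z 0 j)); last by apply/funext => ?; rewrite !mxE.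
by apply: cholB; [exact: hf|exact: hg].
Qed.

Lemma vremovable f r (a : R[i]) : vhol r f -> modulus a < r -> f a = 0 ->
  exists q, vhol r q /\ forall z, f z = (z - a) *: q z.
Proof.
move=> hf ar fa.
have /choice[q hq] : forall j, exists q, disc_hol r q /\ forall z, f z 0 j = f a 0 j + (z - a) * q z.
  by move=> j; exact: removable.
exists (fun z => \row_j q j z); split => [j z zr|z].
  rewrite (_ : (fun _ => _) = q j); last by apply/funext => ?; rewrite mxE.
  exact: (hq j).1.
by apply/rowP => j; rewrite !mxE (hq j).2 fa mxE add0r.
Qed.

Lemma vhol_dilate r f (c : R) : 0 < c -> vhol r f ->
  vhol (r / c) (fun z => f (c%:C * z)).
Proof.
move=> c0 hf; apply: (vhol_comp (h := fun z => c%:C * z) hf) => z.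
  by move=> _; exact: chol_scale.
by rewrite modulusM modulus_real gtr0_norm// ltr_pdivlMr// mulrC.
Qed.

(** On the unit circle 1 + c z is z times the conjugate of z + c. Divided by z, the polynomial (z +
    c) (1 + c z) is therefore real and nonnegative there, which is the source of the gluing
    coefficients. *)
Lemma circle_square (c : R) (z : R[i]) : modulus z = 1 ->
  (z + c%:C) * (1 + c%:C * z) = (modulus (z + c%:C) ^+ 2)%:C * z.
Proof.
move=> z1; rewrite -modulus_mulJ -mulrA; congr (_ * _).
have -> : (z + c%:C)^*%C = z^*%C + c%:C.
  by apply: complex_ext; case: z {z1} => x y //=; rewrite opprD oppr0.
by rewrite mulrDl (mulrC z^*%C) (circle_conj z1) expr1n.
Qed.

Lemma modulus_addc_sqr (c : R) (z : R[i]) : modulus z = 1 ->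
  modulus (z + c%:C) ^+ 2 = 1 + c ^+ 2 + 2 * c * Re z.
Proof.
move=> z1; have := modulus_sqr z; rewrite z1 expr1n => h.
rewrite modulus_sqr; case: z z1 h => x y z1 /= h.
by rewrite addr0 sqrrD; lra.
Qed.

End DiscAlgebra.

(** * The triangle inequality and elementary bounds for the distance *)

Section Triangle.
Context {R : realType} {n : nat}.
Implicit Types (X : set 'rV[R[i]]_n) (x y z w : 'rV[R[i]]_n) (r S T U : R).

(* Lempert's gluing: the coefficient mu = k q (u + p) (1 + p u) / u is real with values
   in [0, 1] on the unit circle, vanishes at -p, equals 1 at q, and its pole at 0 is
   compensated by the equality of the two discs there. *)
Lemma Kd_glue X x y z S T S' T' : eopen X -> cvx X ->
  Kd X y x S -> Kd X y z T -> 1 < S -> 1 < T -> S < S' -> T < T' -> Kd X x z (S' * T').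
Proof.
move=> oX cX [_ [f [[hf fX] f0 fS]]] [_ [g [[hg gX] g0 gT]]] S1 T1 SS TT.
have X0 : X !=set0 by exists (f 0); apply: fX; rewrite modulus0 ltr01.
set p := tp S'; set q := tp T'.
have S'1 : 1 < S' by exact: lt_trans SS.
have T'1 : 1 < T' by exact: lt_trans TT.
have p0 : 0 < p by exact: tp_gt0.
have q0 : 0 < q by exact: tp_gt0.
have /andP[_ p1] : -1 < p < 1 by apply: tp_lt1; lra.
have /andP[_ q1] : -1 < q < 1 by apply: tp_lt1; lra.
have s0 := tp_gt0 S1; have t0 := tp_gt0 T1.
have sp : tp S < p by apply: tp_lt; lra.
have tq : tp T < q by apply: tp_lt; lra.
(* The dilations move the end points out to p and q and make both discs holomorphic beyond the
   closed unit disc, as [hull] requires; the strict inequalities between S and S' and between T and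
   T' are spent here. The sign in [F] places x at -p. *)
pose c1 := tp S / p; pose c2 := tp T / q.
have c10 : 0 < c1 by rewrite divr_gt0.
have c20 : 0 < c2 by rewrite divr_gt0.
have c11 : c1 < 1 by rewrite ltr_pdivrMr// mul1r.
have c21 : c2 < 1 by rewrite ltr_pdivrMr// mul1r.
pose F (u : R[i]) := f (c1%:C * (-1 * u)).
pose G (u : R[i]) := g (c2%:C * u).
pose rr := Num.min (1 / c1) (1 / c2).
have rr1 : 1 < rr by rewrite lt_min !div1r !invf_gt1// c11.
have hF : vhol rr F.
  apply: (@vhol_sub _ _ (1 / c1)); first by rewrite ge_min lexx.
  apply: (@vhol_comp _ _ _ _ (fun u => f (c1%:C * u)) (fun u => -1 * u) (vhol_dilate c10 hf)) => u.
    by move=> _; exact: chol_scale.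
  by rewrite mulN1r modulusN.
have hG : vhol rr G.
  by apply: (@vhol_sub _ _ (1 / c2)); [rewrite ge_min lexx orbT|exact: vhol_dilate].
have FX u : modulus u = 1 -> X (F u).
  by move=> u1; apply: fX; rewrite mulN1r modulusM modulusN u1 mulr1 modulus_real gtr0_norm.
have GX u : modulus u = 1 -> X (G u).
  by move=> u1; apply: gX; rewrite modulusM u1 mulr1 modulus_real gtr0_norm.
have Fp : F (- p%:C) = x.
  by rewrite /F mulN1r opprK -rmorphM/= divfK ?gt_eqF.
have Gq : G q%:C = z by rewrite /G -rmorphM/= divfK ?gt_eqF.
have [|||Q [hQ QE]] := @vremovable _ _ (fun u => G u - F u) rr 0.
- exact: vholB.
- by rewrite modulus0; exact: lt_trans rr1.
- by rewrite /F /G !mulr0 f0 g0 subrr.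
pose k := ((p + q) * (1 + p * q))^-1.
have pq0 : 0 < p + q by rewrite addr_gt0.
have pq1 : 0 < 1 + p * q by rewrite ltr_wpDr// mulr_ge0 ?(ltW p0) ?(ltW q0).
have k0 : 0 < k by rewrite invr_gt0 mulr_gt0.
pose m (u : R[i]) := (k * q)%:C * ((u + p%:C) * (1 + p%:C * u)).
pose h u := F u + m u *: Q u.
have hh : vhol rr h.
  apply: vholD => //; apply: vholZ => // u _.
  apply: cholM; first exact: chol_cst.
  apply: cholM; first by apply: cholD; [exact: chol_id|exact: chol_cst].
  by apply: cholD; [exact: chol_cst|exact: chol_scale].
have hX u : modulus u = 1 -> X (h u).
  move=> u1; pose t := k * q * modulus (u + p%:C) ^+ 2.
  have -> : h u = F u + t%:C *: (G u - F u).
    by rewrite /h /m circle_square// QE subr0 mulrA -rmorphM/= -/t -scalerA.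
  apply: cX; [exact: FX|exact: GX|].
  have -> /= : 0 <= t.
    apply: mulr_ge0; first by apply: mulr_ge0; exact: ltW.
    by apply: exprn_ge0; exact: modulus_ge0.
  rewrite /t.
  have kE : k * ((p + q) * (1 + p * q)) = 1 by apply: mulVf; rewrite gt_eqF// mulr_gt0.
  rewrite -kE -mulrA ler_pM2l//.
  (* The coefficient is at most 1 by the identity (p + q) (1 + p q) - q |u + p|^2 = p |u - q|^2. *)
  have e1 := @modulus_addc_sqr R p u u1; have e2 := @modulus_addc_sqr R (- q) u u1.
  have e3 : 0 <= p * modulus (u + (- q)%:C) ^+ 2 by rewrite mulr_ge0 ?(ltW p0)// exprn_ge0// modulus_ge0.
  rewrite -subr_ge0; apply: le_trans e3 _.
  by rewrite le_eqVlt; apply/orP; left; apply/eqP; rewrite e1 e2; ring.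
have dh : disc_in X h.
  by split; [exact: vhol_sub (ltW rr1) hh|exact: hull hh rr1 hX].
have := @Kd_points _ _ X h S'^-1 T' dh.
rewrite invr_gt0 (lt_trans ltr01 S'1) invrK tpV; last by apply: lt_trans S'1.
rewrite -/p -/q mulrC; have -> : S'^-1 <= T'.
  by rewrite (@le_trans _ _ 1) ?invf_le1 ?ltW//; apply: lt_trans S'1.
move=> /(_ isT isT).
rewrite {1}/h /m rmorphN/= addNr mul0r mulr0 scale0r addr0 Fp.
rewrite /h (_ : m q%:C *: Q q%:C = G q%:C - F q%:C); last first.
  rewrite QE subr0; congr (_ *: _); rewrite /m -[1]/(1%:C) -!rmorphM/= -!rmorphD/= -!rmorphM/=; congr (_%:C).
  by rewrite /k; field; rewrite !gt_eqF.
by rewrite subrKC Gq.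
Qed.

(** Any U above S T is a product S' T' with S' above S and T' above T. The midpoints of S, S' and of
    T, T' keep the inequalities of [Kd_glue] strict, also when S or T equals 1. *)
Lemma Kle_triangle X x y z S T : eopen X -> cvx X ->
  Kle X x y S -> Kle X y z T -> Kle X x z (S * T).
Proof.
move=> oX cX /KleC hx hz U; have S1 := Kle_ge1 hx; have T1 := Kle_ge1 hz => STU.
have T0 : 0 < T by lra.
have SU : S < U / T by rewrite ltr_pdivlMr.
pose S' := (S + U / T) / 2.
have S'1 : S < S' by rewrite /S'; lra.
have S'2 : S' < U / T by rewrite /S'; lra.
have S'0 : 0 < S' by lra.
have T'1 : T < U / S' by rewrite ltr_pdivlMr// mulrC -ltr_pdivlMr.
set T' := U / S' in T'1.
have -> : U = S' * T' by rewrite /T' mulrC divfK// gt_eqF.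
apply: (@Kd_glue X x y z ((S + S') / 2) ((T + T') / 2)) => //; try lra.
- by apply: hx; lra.
- by apply: hz; lra.
Qed.

(** The Harnack factor (1 - t) / (1 + t) at t = [tp T] is exactly 1 / T. *)
Lemma Kd_margin X x w T (e : R) : eopen X -> cvx X -> margin X x e -> Kd X x w T ->
  margin X w (e / T).
Proof.
move=> oX cX me [T1 [f [[hf fX] f0 fT]]].
have T0 : 0 < T by lra.
have := harnack_margin oX cX hf fX; rewrite f0 => /(_ _ me _ (modulus_tp T0)).
rewrite fT modulus_real ger0_norm ?tp_ge0//.
rewrite (_ : (1 - _) / _ = T^-1)//.
rewrite /tp; field; rewrite !gt_eqF//; lra.
Qed.

Lemma Kle_margin X x w T (e : R) : eopen X -> cvx X -> margin X x e -> 0 < e -> Kle X x w T ->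
  margin X w (e / T).
Proof.
move=> oX cX me e0 h y yw; have T1 := Kle_ge1 h; have T0 : 0 < T by lra.
have y0 := en_ge0 (y - w).
pose s := (en (y - w) + e / T) / 2.
have s1 : en (y - w) < s by rewrite /s; lra.
have s2 : s < e / T by rewrite /s; lra.
have s0 : 0 < s by lra.
have := Kd_margin oX cX me (h (e / s) _); apply; first by rewrite ltr_pdivlMr// mulrC -ltr_pdivlMr.
by rewrite invf_div mulrC divfK// gt_eqF.
Qed.

(** The affine disc centred at x of radius 2 |w - x| stays in X and reaches w at 1/2, which is
    [tp 3]. *)
Lemma Kle_affine X x w (e : R) : margin X x e -> en (w - x) <= e / 2 -> 0 < e -> Kle X x w 3.
Proof.
move=> me we e0; apply: Kd_Kle; split; first lra.
exists (fun u => x + (2 * u) *: (w - x)); split.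
- split.
    apply: vholD; first exact: vhol_cst.
    by apply: vholZ; [move=> u _; exact: chol_scale|exact: vhol_cst].
  move=> u u1; apply: me; rewrite addrAC subrr add0r enZ modulusM.
  have -> : modulus (2 : R[i]) = 2.
    by rewrite -(rmorph_nat (real_complex R)) modulus_real ger0_norm.
  apply: (@le_lt_trans _ _ (2 * modulus u * (e / 2))).
    by rewrite ler_wpM2l// mulr_ge0// modulus_ge0.
  by have := modulus_ge0 u; move: u1 e0; clear; nra.
- by rewrite mulr0 scale0r addr0.
- rewrite (_ : 2 * (tp 3)%:C = 1) ?scale1r ?subrKC//.
  have -> : tp 3 = 2^-1 :> R by rewrite /tp; field.
  by rewrite fmorphV rmorph_nat mulfV// pnatr_eq0.
Qed.

Lemma margin_segment X x w (e t : R) : cvx X -> margin X x e -> margin X w e -> 0 <= t <= 1 ->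
  margin X (x + t%:C *: (w - x)) e.
Proof.
move=> cX mx mw t01 v vx.
pose d := v - (x + t%:C *: (w - x)).
have -> : v = (x + d) + t%:C *: ((w + d) - (x + d)).
  by rewrite opprD addrACA subrr addr0 addrAC addrC subrK.
by apply: cX => //; [apply: mx|apply: mw]; rewrite addrAC subrr add0r.
Qed.

(** N affine steps of length at most e / 2 along the segment from x to w, on which the margin e
    persists by convexity; each step costs a factor 3. *)
Lemma Kle_chain X (e : R) N x w : eopen X -> cvx X -> 0 < e -> margin X x e -> margin X w e ->
  en (w - x) <= N%:R * (e / 2) -> Kle X x w (3 ^+ N).
Proof.
move=> oX cX e0; elim: N x => [|N ih] x mx mw.
  rewrite mul0r expr0 => h.
  have -> : w = x by apply/eqP; rewrite -subr_eq0 -en_eq0 eq_le h en_ge0.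
  by apply: Kle_refl; apply: mx; rewrite subrr en0.
move=> h; pose t : R := N.+1%:R^-1.
have N0 : 0 < N.+1%:R :> R by rewrite ltr0n.
have t0 : 0 < t by rewrite invr_gt0.
have t1 : t <= 1 by rewrite invf_le1// ler1n.
have tN : 1 - t = N%:R * t.
  have : N.+1%:R * t = 1 by apply: mulfV; rewrite gt_eqF.
  by rewrite -natr1 mulrDl mul1r; lra.
pose y := x + t%:C *: (w - x).
have my : margin X y e by apply: margin_segment => //; rewrite (ltW t0).
rewrite exprS; apply: (@Kle_triangle X x y w) => //.
  apply: Kle_affine mx _ e0; rewrite /y addrAC subrr add0r enZr gtr0_norm//.
  by rewrite mulrC ler_pdivrMr// mulrC.
apply: ih => //.
have -> : w - y = (1 - t)%:C *: (w - x).
  by apply/rowP => j; rewrite /y !mxE rmorphB/=; ring.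
rewrite enZr tN ger0_norm ?mulr_ge0 ?(ltW t0)// -mulrA ler_wpM2l//.
by rewrite mulrC ler_pdivrMr// mulrC.
Qed.

End Triangle.

(** * Approximate midpoints in bounded convex domains *)

Section Lines.
Context {R : realType} {n : nat}.
Implicit Types (X : set 'rV[R[i]]_n) (x y z w v : 'rV[R[i]]_n) (r S T U : R).

Lemma eopen_margin X x : eopen X -> X x -> exists2 e : R, 0 < e & margin X x e.
Proof. by move=> oX /oX. Qed.

(* The second disc agrees with the first one at a and -a, so that gluing them with the
   coefficient c u^2 / ((u^2 - a^2)(1 - a^2 u^2)), real and in (0, 1] on the circle, keeps the
   1-jet at 0 while pushing the boundary values into the interior. *)
Lemma glue_jet X (F G : R[i] -> 'rV[R[i]]_n) (rr a e : R) : eopen X -> cvx X ->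
  1 < rr -> 0 < a < 1 -> 0 < e -> vhol rr F -> vhol rr G ->
  (forall u : R[i], modulus u = 1 -> X (F u)) ->
  (forall u : R[i], modulus u = 1 -> margin X (G u) e) ->
  F a%:C = G a%:C -> F (- a%:C) = G (- a%:C) ->
  exists h, [/\ vhol 1 h, h 0 = F 0,
    (forall u : R[i], modulus u < 1 -> margin X (h u) (((1 - a ^+ 2) / (1 + a ^+ 2)) ^+ 2 * e)) &
    forall j l, cder (fun u => F u 0 j) 0 l -> cder (fun u => h u 0 j) 0 l].
Proof.
move=> oX cX rr1 /andP[a0 a1] e0 hF hG FX GX Fa Fma.
have a2 : a ^+ 2 < 1 by rewrite expr2; move: a0 a1; clear; nra.
have a20 : 0 < a ^+ 2 by rewrite exprn_gt0.
have a2p : 0 < 1 + a ^+ 2 by lra.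
have ma : modulus a%:C < rr by rewrite modulus_real gtr0_norm// (lt_trans a1).
have aC : a%:C != 0 :> R[i] by rewrite -modulus_gt0 modulus_real normr_gt0 gt_eqF.
have D0 : G a%:C - F a%:C = 0 by rewrite Fa subrr.
have [Q1 [hQ1 Q1E]] := @vremovable _ _ (fun u => G u - F u) rr a%:C (vholB hG hF) ma D0.
have Q1a : Q1 (- a%:C) = 0.
  have := Q1E (- a%:C); rewrite Fma subrr => /esym/eqP; rewrite scaler_eq0.
  case/orP => [|/eqP//]; rewrite -opprD oppr_eq0 -mulr2n mulrn_eq0/=.
  by rewrite (negbTE aC).
have mna : modulus (- a%:C) < rr by rewrite modulusN.
have [Q [hQ QE]] := @vremovable _ _ Q1 rr (- a%:C) hQ1 mna Q1a.
have DE u : G u - F u = (u ^+ 2 - (a ^+ 2)%:C) *: Q u.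
  by rewrite Q1E QE scalerA opprK -subr_sqr rmorphXn.
pose c : R := (1 - a ^+ 2) ^+ 2.
have c0 : 0 < c by rewrite exprn_gt0// subr_gt0.
pose rs := Num.min rr (1 / a).
have rs1 : 1 < rs by rewrite lt_min rr1 div1r invf_gt1.
have rsr : rs <= rr by rewrite ge_min lexx.
pose k (u : R[i]) := c%:C * (u / (1 - (a ^+ 2)%:C * (u * u))).
have den u : modulus u < rs -> 1 - (a ^+ 2)%:C * (u * u) != 0.
  rewrite lt_min => /andP[_]; rewrite ltr_pdivlMr// => ua.
  rewrite subr_eq0; apply/eqP => E.
  have : modulus ((a ^+ 2)%:C * (u * u)) = 1 by rewrite -E modulus1.
  rewrite !modulusM modulus_real gtr0_norm// => E'.
  have m0 := modulus_ge0 u; move: E' ua a0 m0; clear.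
  move: (modulus u) => m E ma1 a0 m0.
  have : 0 < (1 - m * a) * (1 + m * a).
    by rewrite mulr_gt0// ?subr_gt0// ltr_wpDr// mulr_ge0// ltW.
  by rewrite (_ : _ * _ = 1 - a ^+ 2 * (m * m)); [rewrite E subrr ltxx|ring].
have hk : disc_hol rs k.
  move=> u us; apply: cholM; first exact: chol_cst.
  apply: cholM; first exact: chol_id.
  apply: cholV; first exact: den.
  apply: cholB; first exact: chol_cst.
  by apply: cholM; [exact: chol_cst|apply: cholM; exact: chol_id].
pose V u := k u *: Q u.
have hV : vhol rs V by apply: vholZ => //; exact: vhol_sub hQ.
pose h (u : R[i]) := F u + u *: V u.
have hh : vhol rs h.
  apply: vholD; first exact: vhol_sub hF.
  by apply: vholZ => // u _; exact: chol_id.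
exists h; split.
- exact: vhol_sub (ltW rs1) hh.
- by rewrite /h scale0r addr0.
- have X0 : X !=set0 by exists (F 1); apply: FX; rewrite modulus1.
  move=> u u1 w wu; pose d := w - h u.
  have -> : w = h u + d by rewrite subrKC.
  have hhd : vhol rs (fun u => h u + d) by apply: vholD => //; exact: vhol_cst.
  move: u u1 wu @d hhd => u u1 wu d hhd.
  apply: (hull oX cX X0 hhd rs1) => // {u1} s s1.
  have [t [t0 t1 tE]] : exists t : R, [/\ ((1 - a ^+ 2) / (1 + a ^+ 2)) ^+ 2 <= t, t <= 1 &
      h s = F s + t%:C *: (G s - F s)].
    pose m := modulus (s ^+ 2 + (- a ^+ 2)%:C) ^+ 2.
    have s2 : modulus (s ^+ 2) = 1 by rewrite modulusX s1 expr1n.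
    have mE := modulus_addc_sqr (- a ^+ 2) s2.
    have rs2 := Re_le_modulus (s ^+ 2); rewrite s2 ler_norml in rs2.
    have m1 : c <= m by rewrite /m mE /c; case/andP: rs2 a20 => + +; clear; nra.
    have m2 : m <= (1 + a ^+ 2) ^+ 2 by rewrite /m mE; case/andP: rs2 a20 => + +; clear; nra.
    have m0 : 0 < m by exact: lt_le_trans m1.
    exists (c / m); split.
    + rewrite expr_div_n -/c; apply: ler_wpM2l; first exact: ltW.
      by rewrite lef_pV2 ?posrE//; apply: exprn_gt0.
    + by rewrite ler_pdivrMr// mul1r.
    rewrite /h /V /k DE !scalerA; congr (_ + _ *: _).
    have sd : 1 - (a ^+ 2)%:C * (s * s) != 0 by apply: den; rewrite s1.
    have := circle_square (- a ^+ 2) s2; rewrite -/m !rmorphN/= => E.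
    have mC : m%:C != 0 :> R[i] by rewrite -modulus_gt0 modulus_real normr_gt0 gt_eqF.
    rewrite [in RHS]rmorphM/= fmorphV/=.
    have alg (A C D S : R[i]) : D != 0 -> 1 - A * (S * S) != 0 ->
        (S * S - A) * (1 - A * (S * S)) = D * (S * S) ->
        S * (C * (S / (1 - A * (S * S)))) = C / D * (S ^+ 2 - A).
      move=> D0' S0 E'; apply: (mulIf D0'); apply: (mulIf S0).
      rewrite (_ : _ * D * _ = C * (D * (S * S))); last by field.
      rewrite -E'; field; exact: D0'.
    apply: (alg _ _ m%:C) => //.
    by rewrite -E expr2 !mulNr.
  have t00 : 0 < t.
    by apply: lt_le_trans t0; rewrite exprn_gt0// divr_gt0 ?subr_gt0// addr_gt0.
  have -> : h s + d = F s + t%:C *: ((G s + (t^-1)%:C *: d) - F s).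
    rewrite tE; apply/rowP => j; rewrite !mxE fmorphV; field.
    by rewrite -modulus_gt0 modulus_real normr_gt0 gt_eqF.
  apply: cX; [exact: FX| |by rewrite (ltW t00)].
  apply: (GX s s1); rewrite addrAC subrr add0r enZr gtr0_norm ?invr_gt0//.
  rewrite mulrC ltr_pdivrMr//; apply: lt_le_trans wu _.
  by rewrite mulrC ler_wpM2l// ltW.
- move=> j l Fl; rewrite -[l]addr0.
  have V0 : V 0 0 j = 0 by rewrite /V /k mul0r mulr0 scale0r mxE.
  have [dV hdV] : chol (fun u => V u 0 j) 0 by apply: hV; rewrite modulus0; exact: lt_trans rs1.
  rewrite (_ : (fun _ => _) = (fun u => F u 0 j + u * V u 0 j)); last by apply/funext => u; rewrite /h !mxE.
  apply: cderD => //; have := cderM (cder_id 0) hdV.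
  by rewrite V0 mulr0 mul0r addr0.
Qed.

(** The two points are the values at [tp T] and its opposite of a disc centred at x whose derivative
    at 0, a multiple l of a fixed vector v, is nearly as large as possible. If these values were too
    close to each other, a second disc through them would have room to be dilated; [glue_jet] would
    then give a disc with the same derivative and a definite margin, and adding a small multiple of
    u v would raise l above the supremum. *)
Lemma line_points X (M : R) x T : (0 < n)%N -> eopen X -> cvx X ->
  (forall y, X y -> en y <= M) -> X x -> 1 < T ->
  exists x1 x2, [/\ Kd X x x1 T, Kd X x x2 T & ~ Kle X x1 x2 (T ^+ 2 / 2)].
Proof.
move=> n0 oX cX XM Xx T1; apply: contrapT => hno.
have H x1 x2 : Kd X x x1 T -> Kd X x x2 T -> Kle X x1 x2 (T ^+ 2 / 2).
  by move=> h1 h2; apply: contrapT => h3; apply: hno; exists x1, x2.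
have T0 : 0 < T by lra.
have [e e0 me] := eopen_margin oX Xx.
pose j0 : 'I_n := Ordinal n0.
pose v : 'rV[R[i]]_n := delta_mx 0 j0.
have v1 : v 0 j0 = 1 by rewrite mxE !eqxx.
have v0 : 0 < en v.
  by rewrite en_gt0; apply/eqP => h; move: v1; rewrite h mxE => /esym/eqP; rewrite oner_eq0.
pose L := [set l : R | exists f, [/\ disc_in X f, f 0 = x & forall j, cder (fun u => f u 0 j) 0 (l%:C * v 0 j)]].
have L0 : L 0.
  exists (fun=> x); split => //.
    by split => //; exact: vhol_cst.
  by move=> j; rewrite mul0r; exact: cder_cst.
have M0 : 0 <= M by apply: le_trans (XM _ Xx); exact: en_ge0.
have Lub l : L l -> l <= 4 * M.
  move=> [f [[hf fX] f0 fl]].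
  have r1 : 0 < (1 / 2 : R) < 1 by apply/andP; split; lra.
  have := @cauchy_estimate R _ 1 (1 / 2) _ (2 * M) (hf j0) r1 (fl j0).
  rewrite v1 mulr1 modulus_real => /(_ _)/(le_trans (ler_norm _)).
  rewrite (_ : 2 * M / (1 / 2) = 4 * M); last by field.
  apply => w w1; apply: le_trans (modulusB _ _) _.
  have b (u : R[i]) : modulus u < 1 -> modulus (f u 0 j0) <= M.
    by move=> u1; apply: le_trans (modulus_le_en _ _) (XM _ (fX _ u1)).
  have bw := b w ltac:(by rewrite w1; lra); have b0 := b 0 ltac:(by rewrite modulus0).
  lra.
have hsL : has_sup L by split; [exists 0|exists (4 * M)].
pose s := sup L.
have s0 : 0 <= s by exact: sup_upper_bound.
have sM : s <= 4 * M by apply: ge_sup => //; exists 0.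
have TT : 1 <= T ^+ 2 / 2.
  have Kxx : Kd X x x T by apply: (@Kd_mono _ _ X x x 1); [exact: ltW|split => //; exists (fun=> x); split => //; split => //; exact: vhol_cst].
  exact: Kle_ge1 (H _ _ Kxx Kxx).
pose B := Num.sqrt (3 / 4 * T ^+ 2).
(* B^2 lies strictly between T^2 / 2 and T^2. So a disc of parameter B^2 joins the two points, and
   after centring it meets them at b and -b with b < a, which leaves room for the dilation by q = b
   / a. *)
have B2 : B ^+ 2 = 3 / 4 * T ^+ 2 by rewrite sqr_sqrtr// mulr_ge0// exprn_ge0// ltW.
have B0 : 0 <= B := sqrtr_ge0 _.
have B1 : 1 < B by move: B2 B0 TT; clear; move: (T ^+ 2) => T2; nra.
have BT : B < T by move: B2 B0 T0; clear; nra.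
pose a := tp T; pose b := tp B.
have a01 : 0 < a < 1 by rewrite /a tp_gt0//=; have /andP[] := tp_lt1 T0.
have b0 : 0 < b by exact: tp_gt0.
have ba : b < a by apply: tp_lt => //; lra.
have /andP[a0 a1] := a01.
pose q := b / a.
have q0 : 0 < q by rewrite divr_gt0.
have q1 : q < 1 by rewrite ltr_pdivrMr// mul1r.
pose e1 := e / T / B * ((1 - q) / (1 + q)).
have e10 : 0 < e1 by rewrite mulr_gt0 ?divr_gt0//; lra.
pose e2 := ((1 - a ^+ 2) / (1 + a ^+ 2)) ^+ 2 * e1.
have a2 : a ^+ 2 < 1 by rewrite expr2; move: a0 a1; clear; nra.
have a20 : 0 < a ^+ 2 by exact: exprn_gt0.
have e20 : 0 < e2.
  apply: mulr_gt0 => //; apply: exprn_gt0; apply: divr_gt0; first by rewrite subr_gt0.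
  exact: addr_gt0.
(* [de] depends on x, v and T but not on the disc f chosen next, so a disc within [de] / 2 of the
   supremum can be improved by more than its defect. *)
pose de := e2 / (2 * en v).
have de0 : 0 < de by rewrite divr_gt0// mulr_gt0.
have [l Ll ls] : exists2 l, L l & s - de / 2 < l by apply: sup_adherent => //; rewrite divr_gt0.
have [f [[hf fX] f0 fl]] := Ll.
have lM := Lub l Ll.
(* Shrinking f by r = 1 - [et] makes it holomorphic beyond the closed disc and lowers its derivative
   l <= 4 M by at most [de] / 2. *)
pose et := Num.min (1 / 2) (de / 2 / (4 * M + 1)).
have M1 : 0 < 4 * M + 1 by lra.
have et0 : 0 < et by rewrite lt_min; apply/andP; split; [lra|apply: divr_gt0 => //; apply: divr_gt0].
have et1 : et <= 1 / 2 by rewrite ge_min lexx.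
have et2 : et * (4 * M + 1) <= de / 2 by rewrite -ler_pdivlMr// ge_min lexx orbT.
pose r := 1 - et.
have r0 : 0 < r by rewrite /r; lra.
have r1 : r < 1 by rewrite /r; lra.
pose F (u : R[i]) := f (r%:C * u).
have hF : vhol (1 / r) F by exact: vhol_dilate.
have FX (u : R[i]) : modulus u <= 1 -> X (F u).
  move=> u1; apply: fX; rewrite modulusM modulus_real gtr0_norm//.
  by have := modulus_ge0 u; move: u1 r0 r1; clear; nra.
have dF : disc_in X F.
  split; last by move=> u /ltW; exact: FX.
  by apply: vhol_sub hF; rewrite div1r ltW// invf_gt1.
have F0 : F 0 = x by rewrite /F mulr0.
have Fl j : cder (fun u => F u 0 j) 0 ((r * l)%:C * v 0 j).
  have h1 : cder (fun u : R[i] => r%:C * u) 0 r%:C.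
    have := cderM (cder_cst r%:C 0) (cder_id (0 : R[i])).
    by rewrite mul0r add0r mulr1.
  have := @cder_comp _ (fun u => f u 0 j) _ 0 _ _ h1; rewrite mulr0 => /(_ _ (fl j)).
  by rewrite rmorphM/= (mulrC r%:C) mulrAC.
have rl : s - de < r * l.
  rewrite /r mulrBl mul1r; have : et * l <= et * (4 * M + 1) by rewrite ler_wpM2l ?(ltW et0)//; lra.
  by move: ls et2; clear; lra.
have T'0 : 0 < T^-1 by rewrite invr_gt0.
have Kp : Kd X x (F (tp T)%:C) T.
  by split; [exact: ltW|exists F].
have Km : Kd X x (F (tp T^-1)%:C) T.
  apply: KdC; have := @Kd_points _ _ X F T^-1 1 dF T'0.
  rewrite invf_le1// tp1 F0 div1r invrK => /(_ (ltW T1)); exact.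
have [_ [g0 [dg0 g00 g0T]]] := H _ _ Km Kp (B ^+ 2) ltac:(by rewrite B2; move: TT; clear; lra).
have B00 : 0 < B by lra.
have [g [dg gE]] := disc_shift dg0 B00.
have gB : g b%:C = F a%:C by rewrite gE// -expr2 g0T.
have gmB : g (- b%:C) = F (- a%:C).
  have B'0 : 0 < B^-1 by rewrite invr_gt0.
  have := gE _ B'0; rewrite mulVf ?gt_eqF// tp1 g00 !tpV// !rmorphN/=; exact.
pose G (u : R[i]) := g (q%:C * u).
have hG : vhol (1 / q) G by apply: vhol_dilate => //; exact: dg.1.
have mFa : margin X (F a%:C) (e / T) by apply: Kd_margin me Kp.
have mg0 : margin X (g 0) (e / T / B).
  apply: (@Kd_margin _ _ X (F a%:C)) => //; rewrite -gB.
  apply: KdC; have := @Kd_points _ _ X g 1 B dg ltr01 (ltW B1); rewrite tp1 divr1; exact.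
have GX (u : R[i]) : modulus u = 1 -> margin X (G u) e1.
  move=> u1; have mq : modulus (q%:C * u) = q by rewrite modulusM u1 mulr1 modulus_real gtr0_norm.
  have := harnack_margin oX cX dg.1 dg.2 mg0 (z := q%:C * u).
  by rewrite mq => /(_ q1).
pose rr := Num.min (1 / r) (1 / q).
have rr1 : 1 < rr by rewrite lt_min !div1r !invf_gt1// r1.
have Ga : F a%:C = G a%:C by rewrite /G -rmorphM/= divfK ?gt_eqF// gB.
have Gma : F (- a%:C) = G (- a%:C) by rewrite /G mulrN -rmorphM/= divfK ?gt_eqF// gmB.
have [| | |h [hh h0 hm hl]] := @glue_jet X F G rr a e1 oX cX rr1 a01 e10 _ _ _ GX Ga Gma.
- by apply: vhol_sub hF; rewrite ge_min lexx.
- by apply: vhol_sub hG; rewrite ge_min lexx orbT.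
- by move=> u u1; apply: FX; rewrite u1.
have : L (r * l + de).
  exists (fun u => h u + (de%:C * u) *: v); split.
  - split.
      apply: vholD => //; apply: vholZ; last exact: vhol_cst.
      by move=> u _; exact: chol_scale.
    move=> u u1; apply: (hm u u1); rewrite addrAC subrr add0r enZ modulusM modulus_real gtr0_norm//.
    apply: (@le_lt_trans _ _ (de * en v)).
      by rewrite ler_wpM2r ?(ltW v0)// ler_piMr ?(ltW de0)// ltW.
    rewrite /de invfM mulrA mulfVK ?gt_eqF// -/e2.
    by rewrite ltr_pdivrMr// ltr_pMr// ltr1n.
  - by rewrite mulr0 scale0r addr0 h0.
  - move=> j.
    rewrite (_ : (fun _ => _) = (fun u => h u 0 j + u * (de%:C * v 0 j))); last first.
      by apply/funext => u; rewrite !mxE; ring.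
    rewrite rmorphD/= mulrDl; apply: cderD; first exact: hl.
    have := cderM (cder_id 0) (cder_cst (de%:C * v 0 j) 0).
    by rewrite mul1r mul0r addr0.
by move=> /(sup_upper_bound hsL); rewrite -/s; move: rl; clear; lra.
Qed.

End Lines.

(** * Real directional derivatives *)

Section RealCalculus.
Context {R : realType}.

Lemma mean_value_eq (f df : R -> R) (a b : R) : a < b ->
  (forall t, a <= t <= b -> is_derive t 1 f (df t)) ->
  exists2 c, a <= c <= b & f b - f a = df c * (b - a).
Proof.
move=> ab hf; have [| |c hc ->] := @MVT R f df a b ab.
- by move=> x; rewrite in_itv/= => /andP[xa xb]; apply: hf; rewrite !ltW.
- apply: continuous_in_subspaceT => x; rewrite inE/= in_itv/= => hx.
  apply: differentiable_continuous; apply/derivable1_diffP.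
  by have [] := hf x hx.
- by exists c => //; move: hc; rewrite in_itv/= => /andP[xa xb]; rewrite !ltW.
Qed.

Lemma mean_value_le (f df : R -> R) (a b C : R) : a <= b ->
  (forall t, a <= t <= b -> is_derive t 1 f (df t)) ->
  (forall t, a <= t <= b -> df t <= C) -> f b - f a <= C * (b - a).
Proof.
move=> ab hf hC; move: ab; rewrite le_eqVlt => /orP[/eqP <-|ab].
  by rewrite !subrr mulr0.
have [c hc ->] := mean_value_eq ab hf.
by rewrite ler_wpM2r ?subr_ge0 ?(ltW ab)// hC.
Qed.

Lemma mean_value_ge (f df : R -> R) (a b C : R) : a <= b ->
  (forall t, a <= t <= b -> is_derive t 1 f (df t)) ->
  (forall t, a <= t <= b -> C <= df t) -> C * (b - a) <= f b - f a.
Proof.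
move=> ab hf hC; move: ab; rewrite le_eqVlt => /orP[/eqP <-|ab].
  by rewrite !subrr mulr0.
have [c hc ->] := mean_value_eq ab hf.
by rewrite ler_wpM2r ?subr_ge0 ?(ltW ab)// hC.
Qed.

Section Taylor.
Variables (f f1 f2 : R -> R) (b C : R).
Hypotheses (b0 : 0 <= b) (C0 : 0 <= C).
Hypothesis h1 : forall t, 0 <= t <= b -> is_derive t 1 f (f1 t).
Hypothesis h2 : forall t, 0 <= t <= b -> is_derive t 1 f1 (f2 t).

(** The mean value theorem used twice, with C in place of the sharp constant C / 2. *)
Lemma taylor2_le : (forall t, 0 <= t <= b -> f2 t <= C) ->
  f b <= f 0 + b * f1 0 + C * b ^+ 2.
Proof.
move=> hC.
have h3 t : 0 <= t <= b -> f1 t <= f1 0 + C * b.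
  move=> /andP[t0 tb].
  have : f1 t - f1 0 <= C * (t - 0).
    apply: (@mean_value_le f1 f2) => // s /andP[s0 st].
      by apply: h2; rewrite s0 (le_trans st).
    by apply: hC; rewrite s0 (le_trans st).
  have : C * t <= C * b by rewrite ler_wpM2l.
  by rewrite subr0; lra.
have := mean_value_le b0 h1 h3; rewrite subr0 expr2; lra.
Qed.

(** The interval is halved: on the second half the first derivative has already grown by C b / 2,
    which yields C b^2 / 4. *)
Lemma taylor2_ge : (forall t, 0 <= t <= b -> C <= f2 t) ->
  f 0 + b * f1 0 + C * b ^+ 2 / 4 <= f b.
Proof.
move=> hC.
have h3 t : 0 <= t <= b -> f1 0 + C * t <= f1 t.
  move=> /andP[t0 tb].
  have : C * (t - 0) <= f1 t - f1 0.
    apply: (@mean_value_ge f1 f2) => // s /andP[s0 st].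
      by apply: h2; rewrite s0 (le_trans st).
    by apply: hC; rewrite s0 (le_trans st).
  by rewrite subr0; lra.
have b2 : 0 <= b / 2 by rewrite divr_ge0.
have bb : b / 2 <= b by lra.
have e1 : f1 0 * (b / 2 - 0) <= f (b / 2) - f 0.
  apply: (@mean_value_ge f f1) => // t /andP[t0 tb].
    by apply: h1; rewrite t0 (le_trans tb).
  apply: le_trans (h3 t _); last by rewrite t0 (le_trans tb).
  by rewrite lerDl mulr_ge0.
have e2 : (f1 0 + C * (b / 2)) * (b - b / 2) <= f b - f (b / 2).
  apply: (@mean_value_ge f f1) => // t /andP[t0 tb].
    by apply: h1; rewrite tb (le_trans b2).
  apply: le_trans (h3 t _); last by rewrite tb (le_trans b2).
  by rewrite lerD2l ler_wpM2l.
by move: e1 e2; rewrite subr0 expr2; lra.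
Qed.

End Taylor.

End RealCalculus.

Section Directional.
Context {R : realType} {n : nat}.
Implicit Types (U : set 'rV[R[i]]_n) (g r : 'rV[R[i]]_n -> R) (u v w z : 'rV[R[i]]_n) (t : R).

Lemma line_derive g v z t : real_derivable g v (z + t%:C *: v) ->
  is_derive t 1 (fun s => g (z + s%:C *: v)) (real_derive v g (z + t%:C *: v)).
Proof.
rewrite /real_derivable /real_derive derive1E => d.
have E : (fun h : R => h^-1 *: (((fun s : R => g (z + s%:C *: v)) \o shift t) (h *: (1 : R)) - g (z + t%:C *: v))) =
  (fun h : R => h^-1 *: (((fun s : R => g (z + t%:C *: v + s%:C *: v)) \o shift 0) (h *: (1 : R)) -
     g (z + t%:C *: v + (0 : R)%:C *: v))).
  by apply/funext => h /=; rewrite scale0r !addr0 -[z + _ + _]addrA -scalerDl -rmorphD/= (addrC t).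
by split; [rewrite /derivable E|rewrite /derive E].
Qed.

Definition ccont_on U g := forall z, U z -> forall e : R, 0 < e ->
  exists2 d : R, 0 < d & forall w, en (w - z) < d -> `|g w - g z| < e.

(** Continuity is in the point, for each fixed direction. Linearity in the direction and uniformity
    over directions are proved below. *)
Definition C1_on U g := (forall v z, U z -> real_derivable g v z) /\
  (forall v, ccont_on U (real_derive v g)).

Lemma real_Ck_cont k U g : real_Ck k U g -> ccont_on U g.
Proof. by case: k => [|k] [h _] z /h/continuous_enP. Qed.

Lemma real_Ck_C1 k U g : real_Ck k.+1 U g -> C1_on U g.
Proof.
by move=> [_ h]; split=> v; have [h1 h2] := h v => //; exact: real_Ck_cont h2.
Qed.

Lemma real_derive_littleo g v z : real_derivable g v z -> forall e : R, 0 < e ->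
  exists2 d : R, 0 < d & forall t, `|t| < d ->
  `|g (z + t%:C *: v) - g z - t * real_derive v g z| <= e * `|t|.
Proof.
move=> dg e e0.
have zE : z + (0 : R)%:C *: v = z by rewrite scale0r addr0.
have := @line_derive g v z 0; rewrite zE => /(_ dg) /is_derive_littleo/(_ e e0)[d d0 hd].
by exists d => // t /hd; rewrite add0r zE.
Qed.

Lemma real_derive_unique g v z (l : R) : real_derivable g v z ->
  (forall e : R, 0 < e -> exists2 d : R, 0 < d & forall t, 0 < t -> t < d ->
    `|g (z + t%:C *: v) - g z - t * l| <= e * t) -> real_derive v g z = l.
Proof.
move=> dg h; apply/eqP; rewrite -subr_eq0 -normr_eq0; apply/negPn/negP => n0.
set m := `|_| in n0; have m0 : 0 < m by rewrite lt_neqAle eq_sym n0 normr_ge0.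
have m4 : 0 < m / 4 by rewrite divr_gt0.
have [d1 d10 h1] := real_derive_littleo dg m4; have [d2 d20 h2] := h _ m4.
pose t := Num.min d1 d2 / 2.
have dm : 0 < Num.min d1 d2 by rewrite lt_min d10.
have t0 : 0 < t by rewrite divr_gt0.
have t1 : t < d1 by have : Num.min d1 d2 <= d1 by [rewrite ge_min lexx]; rewrite /t; lra.
have t2 : t < d2 by have : Num.min d1 d2 <= d2 by [rewrite ge_min lexx orbT]; rewrite /t; lra.
have {}h1 := h1 t; rewrite gtr0_norm// in h1; have {h1}h1 := h1 t1.
have {h2}h2 := h2 t t0 t2.
have : t * m <= m / 4 * t + m / 4 * t.
  rewrite /m -{1}(gtr0_norm t0) -normrM.
  rewrite (_ : t * _ = (g (z + t%:C *: v) - g z - t * l) - (g (z + t%:C *: v) - g z - t * real_derive v g z)).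
    by apply: le_trans (ler_normB _ _) _; rewrite lerD.
  by ring.
by move: t0 m0; clear; nra.
Qed.

Section C1.
Variables (U : set 'rV[R[i]]_n) (g : 'rV[R[i]]_n -> R).
Hypotheses (oU : eopen U) (gC : C1_on U g).

(** The increment along v + w is split into one along v from z and one along w from z + t v; the
    mean value theorem and the continuity of the derivative along w handle the second. *)
Lemma real_deriveD v w z : U z -> real_derive (v + w) g z = real_derive v g z + real_derive w g z.
Proof.
move=> Uz; have [dg cg] := gC; apply: real_derive_unique; first exact: dg.
move=> e e0; have e2 : 0 < e / 2 by rewrite divr_gt0.
have [d1 d10 h1] := real_derive_littleo (dg v z Uz) e2.
have [d2 d20 h2] := cg w z Uz _ e2.
have [d3 d30 h3] := oU Uz.
pose K := en v + en w + 1.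
have K0 : 0 < K by rewrite ltr_wpDl// addr_ge0// en_ge0.
exists (Num.min d1 (Num.min d2 d3 / K)) => [|t t0].
  by rewrite lt_min d10 divr_gt0// lt_min d20.
rewrite lt_min => /andP[td1]; rewrite ltr_pdivlMr// lt_min => /andP[td2 td3].
have near s : 0 <= s <= t -> en (z + t%:C *: v + s%:C *: w - z) <= t * K.
  move=> /andP[s0 st]; rewrite -[z + _ + _]addrA addrAC subrr add0r; apply: le_trans (enD _ _) _.
  rewrite !enZr !ger0_norm ?(ltW t0)//.
  have : s * en w <= t * en w by rewrite ler_wpM2r// en_ge0.
  by rewrite /K; move: t0; lra.
have dl s : 0 <= s <= t -> is_derive s 1 (fun s => g (z + t%:C *: v + s%:C *: w))
    (real_derive w g (z + t%:C *: v + s%:C *: w)).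
  by move=> hs; apply: line_derive; apply: dg; apply: h3; apply: le_lt_trans (near s hs) _.
have close s : 0 <= s <= t -> `|real_derive w g (z + t%:C *: v + s%:C *: w) - real_derive w g z| < e / 2.
  by move=> hs; apply: h2; apply: le_lt_trans (near s hs) _.
set b := real_derive w g z in close *; set a := real_derive v g z in h1 *.
have up := @mean_value_le _ _ _ 0 t (b + e / 2) (ltW t0) dl.
have {up} up : g (z + t%:C *: v + t%:C *: w) - g (z + t%:C *: v + 0%:C *: w) <= (b + e / 2) * t.
  rewrite -[X in _ <= _ * X](subr0 t); apply: up => s /close; rewrite ltr_norml => /andP[_]; lra.
have lo := @mean_value_ge _ _ _ 0 t (b - e / 2) (ltW t0) dl.
have {lo} lo : (b - e / 2) * t <= g (z + t%:C *: v + t%:C *: w) - g (z + t%:C *: v + 0%:C *: w).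
  rewrite -[X in _ * X <= _](subr0 t); apply: lo => s /close; rewrite ltr_norml => /andP[+ _]; lra.
have {}h1 := h1 t; rewrite gtr0_norm// in h1; have {h1} := h1 td1.
rewrite scale0r addr0 in up lo.
rewrite scalerDr addrA !ler_norml => /andP[h11 h12]; apply/andP; split; move: up lo h11 h12; lra.
Qed.

Lemma real_deriveZ (c : R) v z : U z -> real_derive (c%:C *: v) g z = c * real_derive v g z.
Proof.
move=> Uz; have [dg cg] := gC; apply: real_derive_unique; first exact: dg.
move=> e e0; have c1 : 0 < `|c| + 1 by rewrite ltr_wpDl.
have e2 : 0 < e / (`|c| + 1) by rewrite divr_gt0.
have [d1 d10 h1] := real_derive_littleo (dg v z Uz) e2.
exists (d1 / (`|c| + 1)) => [|t t0]; first by rewrite divr_gt0.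
rewrite ltr_pdivlMr// => td.
have tc : `|t * c| < d1.
  by rewrite normrM gtr0_norm//; apply: le_lt_trans td; rewrite ler_wpM2l ?(ltW t0)// lerDl.
have := h1 _ tc; rewrite scalerA -rmorphM/= mulrA => /le_trans; apply.
rewrite mulrAC ler_pdivrMr// -mulrA ler_wpM2l ?(ltW e0)// normrM gtr0_norm// ler_wpM2l ?(ltW t0)//.
by rewrite lerDl.
Qed.

Lemma real_derive0 z : U z -> real_derive 0 g z = 0.
Proof. by move=> Uz; have := real_deriveZ 0 0 Uz; rewrite scaler0 mul0r. Qed.

Lemma real_deriveN v z : U z -> real_derive (- v) g z = - real_derive v g z.
Proof.
by move=> Uz; have := real_deriveZ (-1) v Uz; rewrite rmorphN1 scaleN1r mulN1r.
Qed.

Lemma real_derive_sum (I : Type) (s : seq I) (c : I -> R) (b : I -> 'rV[R[i]]_n) z : U z ->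
  real_derive (\sum_(i <- s) (c i)%:C *: b i) g z = \sum_(i <- s) c i * real_derive (b i) g z.
Proof.
move=> Uz; elim: s => [|i s ih]; first by rewrite !big_nil real_derive0.
by rewrite !big_cons real_deriveD// real_deriveZ// ih.
Qed.

End C1.

Definition rbasis (b : 'I_n * bool) : 'rV[R[i]]_n :=
  (if b.2 then 'i%C else 1) *: delta_mx 0 b.1.

Definition rcoord v (b : 'I_n * bool) : R := if b.2 then Im (v 0 b.1) else Re (v 0 b.1).

Lemma rcoord_le v b : `|rcoord v b| <= en v.
Proof.
apply: le_trans (modulus_le_en v b.1); rewrite /rcoord; case: b.2; first exact: Im_le_modulus.
exact: Re_le_modulus.
Qed.

Lemma rbasis_expand v : v = \sum_b (rcoord v b)%:C *: rbasis b.
Proof.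
rewrite -(pair_big xpredT xpredT (fun j c => (rcoord v (j, c))%:C *: rbasis (j, c)))/=.
rewrite [LHS]row_sum_delta; apply: eq_bigr => j _.
rewrite big_bool /rcoord /rbasis /= !scalerA -scalerDl; congr (_ *: _).
by rewrite mulr1 {1}(complexE (v 0 j)) addrC mulrC.
Qed.

End Directional.

#[global] Opaque real_derive.

(** * Estimates uniform in the direction *)

Section Equicontinuity.
Context {R : realType} {n : nat}.
Implicit Types (U : set 'rV[R[i]]_n) (g r : 'rV[R[i]]_n -> R) (u v w z : 'rV[R[i]]_n) (t : R).

Lemma finite_uniform (I : finType) (P : I -> R -> Prop) :
  (forall i e e', P i e -> 0 < e' -> e' <= e -> P i e') ->
  (forall i, exists2 e : R, 0 < e & P i e) -> exists2 e : R, 0 < e & forall i, P i e.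
Proof.
move=> mono h; have /choice[d hd] : forall i, exists e : R, 0 < e /\ P i e.
  by move=> i; have [e e0 Pe] := h i; exists e.
have m0 : 0 < \big[Order.min/1]_i d i.
  by apply: lt_bigmin => [|i _]; [exact: ltr01|exact: (hd i).1].
exists (\big[Order.min/1]_i d i) => // i.
by apply: mono (hd i).2 m0 _; exact: bigmin_le_cond.
Qed.

Let N : R := #|{: 'I_n * bool}|%:R.

Lemma N_ge0 : 0 <= N. Proof. exact: ler0n. Qed.

Lemma sum_le_N (F : 'I_n * bool -> R) (K : R) : (forall b, `|F b| <= K) -> `|\sum_b F b| <= N * K.
Proof.
move=> h; apply: le_trans (ler_norm_sum _ _ _) _.
apply: le_trans (ler_sum _ (fun b _ => h b)) _.
by rewrite sumr_const -[X in X <= _]mulr_natl.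
Qed.

Section C1.
Variables (U : set 'rV[R[i]]_n) (g : 'rV[R[i]]_n -> R).
Hypotheses (oU : eopen U) (gC : C1_on U g).

Lemma real_derive_expand v z : U z ->
  real_derive v g z = \sum_b rcoord v b * real_derive (rbasis b) g z.
Proof. by move=> Uz; rewrite {1}(rbasis_expand v) (real_derive_sum oU gC). Qed.

Lemma real_derive_bound z : U z -> exists2 K : R, 0 <= K &
  forall v, `|real_derive v g z| <= K * en v.
Proof.
move=> Uz; pose K := \sum_b `|real_derive (rbasis b) g z|.
have K0 : 0 <= K by apply: sumr_ge0.
exists (N * K) => [|v]; first by rewrite mulr_ge0// N_ge0.
rewrite real_derive_expand// -mulrA; apply: sum_le_N => b.
rewrite normrM mulrC; apply: ler_pM => //; last exact: rcoord_le.
by rewrite /K (bigD1 b)//= lerDl sumr_ge0.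
Qed.

Lemma real_derive_equi z0 (e : R) : U z0 -> 0 < e -> exists2 d : R, 0 < d &
  forall z, en (z - z0) < d -> U z /\ forall v, `|real_derive v g z - real_derive v g z0| <= e * en v.
Proof.
move=> Uz0 e0; have N1 : 0 < N + 1 by rewrite ltr_wpDl// N_ge0.
have eN : 0 < e / (N + 1) by rewrite divr_gt0.
have [d1 d10 h1] := oU Uz0.
have [|b|d d0 hd] := @finite_uniform ('I_n * bool)%type (fun b d => forall z, en (z - z0) < d ->
  `|real_derive (rbasis b) g z - real_derive (rbasis b) g z0| < e / (N + 1)).
- by move=> b a a' h a'0 a'a z za; apply: h; exact: lt_le_trans a'a.
- exact: (gC.2 (rbasis b) _ Uz0 _ eN).
exists (Num.min d1 d) => [|z]; first by rewrite lt_min d10.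
rewrite lt_min => /andP[/h1 Uz zd]; split => // v.
rewrite !real_derive_expand// -sumrB.
apply: (@le_trans _ _ (N * (e / (N + 1) * en v))).
  apply: sum_le_N => b; rewrite -mulrBr normrM mulrC.
  by apply: ler_pM => //; [rewrite ltW// hd|exact: rcoord_le].
rewrite mulrA ler_wpM2r ?en_ge0// mulrCA ger_pMr// ler_pdivrMr// mul1r.
by rewrite lerDl.
Qed.

End C1.

Section C2.
Variables (U : set 'rV[R[i]]_n) (r : 'rV[R[i]]_n -> R).
Hypotheses (oU : eopen U) (rC : C1_on U r) (rC2 : forall w, C1_on U (real_derive w r)).

Definition qhess z v := real_hessian r z v v.

(** Both arguments of the Hessian vary with v. Expanding the inner derivative in the basis, with the
    coordinates of v as constants, leaves terms linear in the outer direction. *)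
Lemma qhess_expand v z : U z ->
  qhess z v = \sum_b rcoord v b * real_derive v (real_derive (rbasis b) r) z.
Proof.
move=> Uz; apply: real_derive_unique; first exact: (rC2 v).1.
move=> e e0; have N1 : 0 < N + 1 by rewrite ltr_wpDl// N_ge0.
have v1 : 0 < en v + 1 by rewrite ltr_wpDl// en_ge0.
have eN : 0 < e / (N + 1) / (en v + 1) by rewrite !divr_gt0.
have [d1 d10 h1] := oU Uz.
have [|b|d d0 hd] := @finite_uniform ('I_n * bool)%type (fun b d => forall t, `|t| < d ->
  `|real_derive (rbasis b) r (z + t%:C *: v) - real_derive (rbasis b) r z -
    t * real_derive v (real_derive (rbasis b) r) z| <= e / (N + 1) / (en v + 1) * `|t|).
- by move=> b a a' h a'0 a'a t ta; apply: h; exact: lt_le_trans a'a.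
- by apply: real_derive_littleo => //; exact: (rC2 (rbasis b)).1.
exists (Num.min d (d1 / (en v + 1))) => [|t t0].
  by rewrite lt_min d0 divr_gt0.
rewrite lt_min ltr_pdivlMr// => /andP[td td1].
have tn : `|t| = t by rewrite gtr0_norm.
have Uzt : U (z + t%:C *: v).
  apply: h1; rewrite addrAC subrr add0r enZr tn; apply: le_lt_trans td1.
  by rewrite ler_wpM2l ?(ltW t0)// lerDl.
rewrite !(@real_derive_expand U r oU rC)// mulr_sumr -!sumrB.
apply: (@le_trans _ _ (N * (e / (N + 1) * t))).
  apply: sum_le_N => b.
  have := hd b t; rewrite tn => /(_ td) h.
  rewrite (_ : _ - _ - _ = rcoord v b * (real_derive (rbasis b) r (z + t%:C *: v) -
     real_derive (rbasis b) r z - t * real_derive v (real_derive (rbasis b) r) z)); last by ring.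
  rewrite normrM; apply: le_trans (ler_pM _ _ (rcoord_le v b) h) _ => //.
  rewrite [leLHS](_ : _ = e / (N + 1) * t * (en v / (en v + 1))); last by ring.
  apply: ler_piMr; first by rewrite mulr_ge0 ?(ltW t0)// divr_ge0 ?(ltW e0) ?(ltW N1).
  by rewrite ler_pdivrMr// mul1r lerDl.
rewrite mulrA ler_wpM2r ?(ltW t0)// mulrCA ger_pMr// ler_pdivrMr// mul1r.
by rewrite lerDl.
Qed.

Lemma rcoordB v w b : rcoord (v - w) b = rcoord v b - rcoord w b.
Proof. by rewrite /rcoord !mxE; case: b.2; rewrite ?ImcD ?RecD ?ImcN ?RecN. Qed.

Lemma rcoordZ (c : R) v b : rcoord (c%:C *: v) b = c * rcoord v b.
Proof.
by rewrite /rcoord mxE; case: b.2; rewrite ?ImcM ?RecM/= mul0r ?addr0 ?subr0.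
Qed.

Lemma qhessZ (c : R) v z : U z -> qhess z (c%:C *: v) = c ^+ 2 * qhess z v.
Proof.
move=> Uz; rewrite !qhess_expand// mulr_sumr; apply: eq_bigr => b _.
by rewrite rcoordZ (real_deriveZ (rC2 (rbasis b)))//; ring.
Qed.

Lemma qhess_lip z : U z -> exists2 K : R, 0 <= K &
  forall u v, `|qhess z u - qhess z v| <= K * en (u - v) * (en u + en v).
Proof.
move=> Uz.
have /choice[K hK] : forall b, exists K : R, 0 <= K /\
    forall v, `|real_derive v (real_derive (rbasis b) r) z| <= K * en v.
  by move=> b; have [K K0 h] := real_derive_bound oU (rC2 (rbasis b)) Uz; exists K.
pose K' := \sum_b K b.
have K'0 : 0 <= K' by apply: sumr_ge0 => b _; exact: (hK b).1.
have bK b v : `|real_derive v (real_derive (rbasis b) r) z| <= K' * en v.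
  apply: le_trans ((hK b).2 v) _; rewrite ler_wpM2r ?en_ge0// /K' (bigD1 b)//= lerDl.
  by apply: sumr_ge0 => c _; exact: (hK c).1.
exists (N * K') => [|u v]; first by rewrite mulr_ge0// N_ge0.
rewrite !qhess_expand// -sumrB -!mulrA; apply: sum_le_N => b.
rewrite (_ : _ - _ = rcoord (u - v) b * real_derive u (real_derive (rbasis b) r) z +
  rcoord v b * real_derive (u - v) (real_derive (rbasis b) r) z); last first.
  rewrite (real_deriveD oU (rC2 (rbasis b)))// (real_deriveN (rC2 (rbasis b)))//.
  rewrite rcoordB; move: (real_derive u _ z) (real_derive v _ z) (rcoord u b) (rcoord v b) => a1 a2 a3 a4.
  ring.
have h1 := ler_pM (normr_ge0 _) (normr_ge0 _) (rcoord_le (u - v) b) (bK b u).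
have h2 := ler_pM (normr_ge0 _) (normr_ge0 _) (rcoord_le v b) (bK b (u - v)).
move: h1 h2; move: (real_derive u _ z) (real_derive (u - v) _ z) (rcoord _ b) (rcoord v b) => a1 a2 a3 a4.
rewrite -!normrM => h1 h2; apply: le_trans (ler_normD _ _) _; apply: le_trans (lerD h1 h2) _.
by rewrite le_eqVlt; apply/orP; left; apply/eqP; ring.
Qed.

Lemma qhess0 z : U z -> qhess z 0 = 0.
Proof. by move=> Uz; have := qhessZ 0 0 Uz; rewrite scaler0 expr0n mul0r. Qed.

Lemma qhess_equi z0 (e : R) : U z0 -> 0 < e -> exists2 d : R, 0 < d &
  forall z, en (z - z0) < d -> U z /\ forall v, `|qhess z v - qhess z0 v| <= e * en v ^+ 2.
Proof.
move=> Uz0 e0; have N1 : 0 < N + 1 by rewrite ltr_wpDl// N_ge0.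
have eN : 0 < e / (N + 1) by rewrite divr_gt0.
have [d1 d10 h1] := oU Uz0.
have [|b|d d0 hd] := @finite_uniform ('I_n * bool)%type (fun b d => forall z, en (z - z0) < d ->
  U z /\ forall v, `|real_derive v (real_derive (rbasis b) r) z - real_derive v (real_derive (rbasis b) r) z0|
    <= e / (N + 1) * en v).
- by move=> b a a' h a'0 a'a z za; apply: h; exact: lt_le_trans a'a.
- exact: (real_derive_equi oU (rC2 (rbasis b)) Uz0 eN).
exists (Num.min d1 d) => [|z]; first by rewrite lt_min d10.
rewrite lt_min => /andP[/h1 Uz zd]; split => // v.
rewrite !qhess_expand// -sumrB.
apply: (@le_trans _ _ (N * (e / (N + 1) * en v ^+ 2))).
  apply: sum_le_N => b; rewrite -mulrBr normrM mulrC expr2 mulrA.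
  by apply: ler_pM => //; [exact: (hd b z zd).2|exact: rcoord_le].
rewrite mulrA ler_wpM2r ?exprn_ge0 ?en_ge0// mulrCA ger_pMr// ler_pdivrMr// mul1r.
by rewrite lerDl.
Qed.

Lemma line_taylor z v :
  (forall t : R, 0 <= t <= 1 -> U (z + t%:C *: v)) ->
  [/\ forall C, 0 <= C -> (forall t : R, 0 <= t <= 1 -> qhess (z + t%:C *: v) v <= C) ->
        r (z + v) <= r z + real_derive v r z + C
    & forall C, 0 <= C -> (forall t : R, 0 <= t <= 1 -> C <= qhess (z + t%:C *: v) v) ->
        r z + real_derive v r z + C / 4 <= r (z + v)].
Proof.
move=> hU.
pose f t := r (z + t%:C *: v).
pose f1 t := real_derive v r (z + t%:C *: v).
pose f2 t := qhess (z + t%:C *: v) v.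
have h1 t : 0 <= t <= 1 -> is_derive t 1 f (f1 t).
  by move=> ht; apply: line_derive; apply: rC.1; exact: hU.
have h2 t : 0 <= t <= 1 -> is_derive t 1 f1 (f2 t).
  by move=> ht; apply: (@line_derive _ _ (real_derive v r)); apply: (rC2 v).1; exact: hU.
have f0E : f 0 = r z by rewrite /f scale0r addr0.
have f10E : f1 0 = real_derive v r z by rewrite /f1 scale0r addr0.
have f1E : f 1 = r (z + v) by rewrite /f scale1r.
split => C C0 hC.
  have := taylor2_le ler01 C0 h1 h2 hC.
  by rewrite f0E f10E f1E expr1n mul1r mulr1.
have := taylor2_ge ler01 C0 h1 h2 hC.
by rewrite f0E f10E f1E expr1n mul1r mulr1.
Qed.

End C2.

End Equicontinuity.

(** * Strongly convex domains *)

Section StronglyConvex.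
Context {R : realType} {n : nat}.
Variables (Y U : set 'rV[R[i]]_n) (r : 'rV[R[i]]_n -> R) (M : R).
Implicit Types (u v w z : 'rV[R[i]]_n).

Definition bd z := closure Y z /\ ~ Y z.

Hypotheses (oY : eopen Y) (cnY : connected Y) (YM : forall y, Y y -> en y <= M).
Hypotheses (oU : eopen U) (bdU : forall z, bd z -> U z) (cr : ccont_on U r).
Hypotheses (rC : C1_on U r) (rC2 : forall w, C1_on U (real_derive w r)).
Hypothesis YU : forall z, U z -> Y z <-> r z < 0.
Hypothesis grad : forall z, bd z -> exists v, real_derive v r z != 0.
Hypothesis hess : forall z, bd z -> forall v, real_derive v r z = 0 -> v != 0 -> 0 < qhess r z v.

Lemma closure_le0 z : closure Y z -> U z -> r z <= 0.
Proof.
move=> /closure_enP cz Uz; rewrite leNgt; apply/negP => rz.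
have [d d0 hd] := cr Uz rz; have [d1 d10 hd1] := oU Uz.
have [|w Yw] := cz (Num.min d d1); first by rewrite lt_min d0.
rewrite lt_min => /andP[/hd w1 /hd1 Uw].
have /YU := Uw => -[/(_ Yw) rw _]; move: w1; rewrite ltr_norml => /andP[+ _]; lra.
Qed.

Lemma bd_eq0 z : bd z -> r z = 0.
Proof.
move=> bz; have Uz := bdU bz; case: bz => cz nYz; apply/le_anti.
rewrite closure_le0//= leNgt; apply/negP => rz.
by apply: nYz; apply/YU.
Qed.

(** r is nonpositive on the segment and vanishes at its centre z, so its derivative along v is 0
    there. Then v is tangent, and the positive Hessian makes r positive next to z. *)
Lemma bd_touch z v (d : R) : bd z -> v != 0 -> 0 < d ->
  ~ (forall t : R, `|t| < d -> closure Y (z + t%:C *: v)).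
Proof.
move=> bz v0 d0 ht; have Uz := bdU bz; have rz := bd_eq0 bz.
have v1 : 0 < en v by rewrite en_gt0.
have [d1 d10 hd1] := oU Uz.
have hUt (t : R) : `|t| < d1 / en v -> U (z + t%:C *: v).
  by rewrite ltr_pdivlMr// => td; apply: hd1; rewrite addrAC subrr add0r enZr.
have le0 (t : R) : `|t| < d -> `|t| < d1 / en v -> r (z + t%:C *: v) <= 0.
  by move=> t1 t2; apply: closure_le0; [exact: ht|exact: hUt].
have d1v : 0 < d1 / en v by rewrite divr_gt0.
have L0 : real_derive v r z = 0.
  apply/eqP; apply/negPn/negP => n0.
  set l := real_derive v r z in n0.
  have l0 : 0 < `|l| by rewrite normr_gt0.
  have l2 : 0 < `|l| / 2 by rewrite divr_gt0.
  have := real_derive_littleo (rC.1 v z Uz) l2; rewrite -/l rz => -[d2 d20 h2].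
  pose m := Num.min d (Num.min (d1 / en v) d2).
  have m0 : 0 < m by rewrite !lt_min d0 d1v.
  have m1 : m <= d by rewrite ge_min lexx.
  have m2 : m <= d1 / en v by rewrite !ge_min lexx orbT.
  have m3 : m <= d2 by rewrite !ge_min lexx !orbT.
  pose t := Num.sg l * (m / 2).
  have nt : `|t| = m / 2.
    by rewrite normrM normr_sg n0 mul1r gtr0_norm// divr_gt0.
  have tl : t * l = m / 2 * `|l| by rewrite /t (normrEsg l); ring.
  have := le0 t; rewrite nt => /(_ ltac:(lra) ltac:(lra)).
  have := h2 t; rewrite nt => /(_ ltac:(lra)); rewrite tl ler_norml => /andP[+ _].
  by move: m0 l0; nra.
have q0 := hess bz L0 v0.
move Eq : (qhess r z v) q0 => q q0.
have e0 : 0 < q / 2 / en v ^+ 2 by rewrite !divr_gt0// exprn_gt0.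
have [d2 d20 h2] : exists2 d2 : R, 0 < d2 & forall w, en (w - z) < d2 -> q / 2 <= qhess r w v.
  have [d2 d20 h2] := qhess_equi oU rC rC2 Uz e0; exists d2 => // w /h2[_ /(_ v)].
  rewrite Eq divfK; last by rewrite gt_eqF// exprn_gt0.
  by move: (qhess r w v) => x; rewrite ler_norml => /andP[+ _]; lra.
pose m := Num.min d (Num.min (d1 / en v) (d2 / en v)).
have d2v : 0 < d2 / en v by rewrite divr_gt0.
have m0 : 0 < m by rewrite !lt_min d0 d1v.
have m1 : m <= d by rewrite ge_min lexx.
have m2 : m <= d1 / en v by rewrite !ge_min lexx orbT.
have m3 : m <= d2 / en v by rewrite !ge_min lexx !orbT.
pose t := m / 2.
have t0 : 0 < t by rewrite divr_gt0.
have nt : `|t| = t by rewrite gtr0_norm.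
have := le0 t; rewrite nt => /(_ ltac:(rewrite /t; lra) ltac:(rewrite /t; lra)) rle.
have close (s : R) : 0 <= s <= 1 -> en (z + s%:C *: (t%:C *: v) - z) < d2 /\ U (z + s%:C *: (t%:C *: v)).
  move=> /andP[s0 s1]; have st0 : 0 <= s * t by rewrite mulr_ge0// ltW.
  have st : s * t <= t by rewrite ler_piMl// ltW.
  rewrite scalerA -rmorphM/=; split; last by apply: hUt; rewrite ger0_norm//; rewrite /t in st *; lra.
  rewrite addrAC subrr add0r enZr ger0_norm// -ltr_pdivlMr//.
  by rewrite /t in st *; lra.
have [_] := line_taylor rC rC2 (fun s hs => (close s hs).2).
move=> /(_ (t ^+ 2 * (q / 2)))/(_ _ _).
have C0 : 0 <= t ^+ 2 * (q / 2) by rewrite mulr_ge0 ?exprn_ge0 ?(ltW t0)// divr_ge0// ltW.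
move=> /(_ C0) H.
have {H} : r z + real_derive (t%:C *: v) r z + t ^+ 2 * (q / 2) / 4 <= r (z + t%:C *: v).
  apply: H => s hs; have [c1 c2] := close s hs.
  rewrite (qhessZ oU rC rC2)//; apply: ler_wpM2l; first by rewrite exprn_ge0// ltW.
  exact: h2.
rewrite (real_deriveZ rC)// L0 mulr0 rz !add0r => H.
have : 0 < t ^+ 2 * (q / 2) / 4 by rewrite divr_gt0// mulr_gt0 ?exprn_gt0// divr_gt0.
by move=> /(lt_le_trans)/(_ H); rewrite ltNge rle.
Qed.

(** The Hessian gives local information; connectedness makes it global. The set [S] of points seen
    from a along a segment in Y is open, and it is closed in Y because a limit segment that left Y
    would touch the boundary from inside, against [bd_touch]. *)
Lemma strongly_convex_cvx : cvx Y.
Proof.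
move=> a b t Ya Yb t01.
pose S := [set b | Y b /\ forall t : R, 0 <= t <= 1 -> Y (a + t%:C *: (b - a))].
have oS : eopen S.
  move=> c [Yc hc].
  (* Each point of the segment tolerates a small motion of c, and compactness of [0, 1] gives a
     common tolerance. *)
  have /compact_near_coveringP : compact `[(0 : R), 1] by exact: segment_compact.
  move=> /(_ _ (nbhs c) (fun c' t => Y (a + t%:C *: (c' - a))) _) H.
  have {}H : \forall c' \near nbhs c, `[(0 : R), 1] `<=` (fun t => Y (a + t%:C *: (c' - a))).
    apply: H => s; rewrite /= in_itv/= => hs.
    have [e e0 he] := oY (hc s hs).
    have e2 : 0 < e / 2 by rewrite divr_gt0.
    have ca : 0 < en (c - a) + 1 by rewrite ltr_wpDl// en_ge0.
    pose d := Num.min 1 (e / 2 / (en (c - a) + 1)).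
    have d0 : 0 < d by rewrite lt_min ltr01 divr_gt0.
    have d1 : d <= 1 by rewrite ge_min lexx.
    have d2 : d * (en (c - a) + 1) <= e / 2 by rewrite -ler_pdivlMr// ge_min lexx orbT.
    exists (ball s d, [set c' | en (c' - c) < e / 4]).
      split; first exact: nbhsx_ballx.
      by apply/nbhs_enP; exists (e / 4) => //; rewrite divr_gt0.
    move=> [s' c'] /= [hs' hc']; apply: he.
    rewrite /ball/= in hs'.
    have -> : a + s'%:C *: (c' - a) - (a + s%:C *: (c - a)) =
      (s' - s)%:C *: (c - a) + s'%:C *: (c' - c).
      by apply/rowP => j; rewrite !mxE rmorphB/=; ring.
    apply: le_lt_trans (enD _ _) _; rewrite !enZr distrC.
    have s'2 : `|s'| <= 2.
      rewrite -(subrK s s'); apply: le_trans (ler_normD _ _) _; rewrite distrC.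
      have /andP[sa sb] := hs; rewrite (ger0_norm sa); move: hs' d1 sb; lra.
    have h1 : `|s - s'| * en (c - a) <= d * (en (c - a) + 1).
      by apply: ler_pM; rewrite ?en_ge0// ?(ltW hs')// lerDl.
    have h2 : `|s'| * en (c' - c) <= 2 * en (c' - c) by rewrite ler_wpM2r// en_ge0.
    by move: h1 h2 d2 hc'; lra.
  have [e e0 he] := (nbhs_enP c _).1 H.
  have [e' e'0 he'] := oY Yc.
  exists (Num.min e e') => [|w]; first by rewrite lt_min e0.
  rewrite lt_min => /andP[/he hw /he' Yw]; split => // s hs; apply: hw; rewrite /= in_itv.
have cS c : Y c -> closure S c -> S c.
  move=> Yc /closure_enP hc; split => // s hs; apply: contrapT => nY.
  have Sc (s' : R) : 0 <= s' <= 1 -> closure Y (a + s'%:C *: (c - a)).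
    move=> hs'; apply/closure_enP => e e0; have [c' [Yc' hc'] cc'] := hc e e0.
    exists (a + s'%:C *: (c' - a)); first exact: hc'.
    have -> : a + s'%:C *: (c' - a) - (a + s'%:C *: (c - a)) = s'%:C *: (c' - c).
      by apply/rowP => j; rewrite !mxE; ring.
    have /andP[h1 h2] := hs'; rewrite enZr ger0_norm//.
    by apply: le_lt_trans cc'; rewrite ler_piMl// en_ge0.
  have bz : bd (a + s%:C *: (c - a)) by split => //; exact: Sc.
  have ca : c - a != 0.
    by apply/eqP => ca; move: bz.2; rewrite ca scaler0 addr0.
  have s0 : s != 0 by apply/eqP => s0; move: bz.2; rewrite s0 scale0r addr0.
  have s1 : s != 1 by apply/eqP => s1; move: bz.2; rewrite s1 scale1r subrKC.
  have /andP[sa sb] := hs.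
  have s0' : 0 < s by rewrite lt_neqAle eq_sym s0.
  have s1' : s < 1 by rewrite lt_neqAle s1.
  have d0 : 0 < Num.min s (1 - s) by rewrite lt_min s0' subr_gt0.
  apply: (@bd_touch _ _ (Num.min s (1 - s)) bz ca d0) => t'.
  rewrite lt_min => /andP[]; rewrite !ltr_norml => /andP[h1 h2] /andP[h3 h4].
  rewrite -addrA -scalerDl -rmorphD/=; apply: Sc; apply/andP; split; lra.
have SY : S = Y.
  apply: cnY.
  - exists a; split => // s _; by rewrite subrr scaler0 addr0.
  - exists S; first by apply/open_enP.
    by apply/seteqP; split => [x [Yx hx]|x [_ //]].
  - exists (closure S); first exact: closed_closure.
    apply/seteqP; split => [x Sx|x [Yx]]; last exact: cS.
    by split; [exact: Sx.1|exact: subset_closure].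
by have : S b by [rewrite SY]; move=> [_]; apply.
Qed.

Let cY : cvx Y. Proof. exact: strongly_convex_cvx. Qed.

Lemma bd_closed : closed bd.
Proof.
have cc : closed (closure Y) by exact: closed_closure.
apply/closed_enP => z hz; split.
  by apply/(closed_enP (closure Y)).1 => // e /hz[w [cw _] wz]; exists w.
move=> /oY[e e0 he]; have [w [_ nw] wz] := hz e e0.
by apply: nw; exact: he.
Qed.

Lemma bd_bounded z : bd z -> en z <= M + 1.
Proof.
move=> [/closure_enP/(_ 1 ltr01)[w Yw wz] _].
rewrite -(subrK w z); apply: le_trans (enD _ _) _; rewrite addrC lerD//; first exact: YM.
by rewrite enBC ltW.
Qed.

Lemma bd_U_uniform : exists2 e : R, 0 < e & forall x, bd x -> margin U x e.
Proof.
have [| | | |e e0 he] := @compact_uniform R n (bd) (M + 1) (fun x e => margin U x e).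
- exact: bd_closed.
- exact: bd_bounded.
- by move=> x e e' h e'0 e'e w wx; apply: h; exact: lt_le_trans e'e.
- move=> x /bdU /oU[e e0 he]; exists (e / 2); first by rewrite divr_gt0.
  move=> y _ yx w wy; apply: he; apply: le_lt_trans (en_dist_trans w y x) _.
  by rewrite (splitr e) ltrD.
- by exists e.
Qed.

Lemma bd_grad_uniform : exists2 e : R, 0 < e &
  forall x, bd x -> exists2 w, en w <= 1 & e <= real_derive w r x.
Proof.
apply: (compact_uniform bd_closed bd_bounded).
  by move=> x e e' [w w1 hw] e'0 e'e; exists w => //; exact: le_trans hw.
move=> x bx; have Ux := bdU bx; have [v hv] := grad bx.
have v0 : v != 0.
  by apply: contraNneq hv => ->; rewrite (real_derive0 rC).
have ev : 0 < en v by rewrite en_gt0.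
set l := real_derive v r x in hv.
have l0 : 0 < `|l| by rewrite normr_gt0.
pose w := (Num.sg l / en v)%:C *: v.
have wl : real_derive w r x = `|l| / en v.
  by rewrite (real_deriveZ rC)// -/l mulrAC -normrEsg.
have w1 : en w = 1.
  by rewrite enZr normrM normr_sg hv mul1r ger0_norm ?invr_ge0 ?en_ge0// mulVf// gt_eqF.
have c0 : 0 < `|l| / en v by rewrite divr_gt0.
have c2 : 0 < `|l| / en v / 2 by rewrite divr_gt0.
have [d d0 hd] := real_derive_equi oU rC Ux c2.
exists (Num.min d (`|l| / en v / 2)) => [|y _]; first by rewrite lt_min d0.
rewrite lt_min => /andP[/hd[_ /(_ w)]]; rewrite w1 mulr1 wl => h _.
exists w; first by rewrite w1.
have m2 : Num.min d (`|l| / en v / 2) <= `|l| / en v / 2 by rewrite ge_min lexx orbT.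
apply: le_trans m2 _; move: (real_derive w r y) h c0 => a.
by move: (`|l| / en v) => b; rewrite ler_norml => /andP[+ _]; lra.
Qed.

(** The same e serves as radius and, inverted, as bound, in the form that [compact_uniform]
    produces. *)
Lemma bd_hess_upper : exists2 e : R, 0 < e & forall x, bd x ->
  forall z, en (z - x) < e -> forall v, qhess r z v <= e^-1 * en v ^+ 2.
Proof.
apply: (compact_uniform bd_closed bd_bounded).
  move=> x e e' h e'0 e'e z zx v; apply: le_trans (h z (lt_le_trans zx e'e) v) _.
  have e0 : 0 < e := lt_le_trans e'0 e'e.
  by rewrite ler_wpM2r ?exprn_ge0 ?en_ge0// lef_pV2 ?posrE.
move=> x bx; have Ux := bdU bx.
have [d d0 hd] := qhess_equi oU rC rC2 Ux ltr01.
have [K K0 hK] := qhess_lip oU rC rC2 Ux.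
have K1 : 0 < K + 1 by lra.
pose e := Num.min (d / 2) (K + 1)^-1.
have e0 : 0 < e by rewrite lt_min divr_gt0// invr_gt0.
have e1 : e <= d / 2 by rewrite ge_min lexx.
have e2 : K + 1 <= e^-1 by rewrite -[K + 1]invrK lef_pV2 ?posrE ?invr_gt0// ge_min lexx orbT.
exists e => // y _ yx z zy v.
have zx : en (z - x) < d.
  apply: le_lt_trans (en_dist_trans z y x) _; move: zy yx e1; lra.
have := (hd z zx).2 v; have := hK v 0.
have q0 : qhess r x 0 = 0 := qhess0 oU rC rC2 Ux.
rewrite {}q0 en0 (subr0 v); move: (qhess r z v) (qhess r x v) => a b.
rewrite (subr0 b) addr0 -mulrA -expr2 mul1r => hb hab.
apply: (@le_trans _ _ ((K + 1) * en v ^+ 2)).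
  by move: hb hab; rewrite !ler_norml => /andP[_ ?] /andP[_ ?]; lra.
by rewrite ler_wpM2r// exprn_ge0// en_ge0.
Qed.

Lemma sphere_closed : closed [set u : 'rV[R[i]]_n | en u = 1].
Proof.
apply/closed_enP => z hz /=; apply/eqP; rewrite eq_le; apply/andP; split.
  rewrite leNgt; apply/negP; rewrite -subr_gt0 => /hz[v /= v1 vz].
  by have := enD (z - v) v; rewrite subrK v1 enBC; lra.
rewrite leNgt; apply/negP; rewrite -subr_gt0 => /hz[v /= v1 vz].
by have := enD (v - z) z; rewrite subrK v1; lra.
Qed.

(* Positivity of the Hessian on the kernel of the differential L becomes positivity of
   the Hessian plus L^2 / e on the whole space, for e small. *)
Lemma hess_coercive x : bd x -> exists2 e : R, 0 < e &
  forall v, e * en v ^+ 2 <= qhess r x v + e^-1 * real_derive v r x ^+ 2.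
Proof.
move=> bx; have Ux := bdU bx.
have [K K0 hK] := qhess_lip oU rC rC2 Ux.
have [K' K'0 hK'] := real_derive_bound oU rC Ux.
have [| |u hu|e e0 he] := @compact_uniform R n [set u | en u = 1] 1
   (fun u e => e <= qhess r x u + e^-1 * real_derive u r x ^+ 2) sphere_closed.
- by move=> u /= ->.
- move=> u e e' h e'0 e'e; have e0 : 0 < e := lt_le_trans e'0 e'e.
  apply: le_trans (e'e) _; apply: le_trans h _.
  by rewrite lerD2l ler_wpM2r// ?sqr_ge0// lef_pV2 ?posrE.
- have u0 : u != 0 by rewrite -en_gt0 hu.
  have lipQ v : en v = 1 -> `|qhess r x v - qhess r x u| <= 2 * K * en (v - u).
    by move=> v1; apply: le_trans (hK v u) _; rewrite v1 hu; have := en_ge0 (v - u); lra.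
  have lipL v : `|real_derive v r x - real_derive u r x| <= K' * en (v - u).
    by rewrite -(real_deriveN rC)// -(real_deriveD oU rC)//; exact: hK'.
  have [L0|L0] := eqVneq (real_derive u r x) 0.
    have q0 := hess bx L0 u0.
    move: lipQ; move Eq : (qhess r x u) q0 => q q0 lipQ.
    pose e := Num.min (q / 2) (q / 2 / (2 * K + 1)).
    have K1 : 0 < 2 * K + 1 by lra.
    have e0 : 0 < e by rewrite lt_min !divr_gt0.
    have e1 : e <= q / 2 by rewrite ge_min lexx.
    have e2 : e * (2 * K + 1) <= q / 2 by rewrite -ler_pdivlMr// ge_min lexx orbT.
    exists e => // v v1 vu.
    have /= := lipQ v v1; move: (qhess r x v) => a; rewrite ler_norml => /andP[ha _].
    have : 0 <= e^-1 * real_derive v r x ^+ 2 by rewrite mulr_ge0 ?sqr_ge0// invr_ge0 ltW.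
    have : 2 * K * en (v - u) <= (2 * K + 1) * e.
      by apply: ler_pM; rewrite ?en_ge0 ?(ltW vu)//; lra.
    by move: ha e1 e2; lra.
  move: lipL L0; move: (real_derive u r x) => l lipL l0.
  have l1 : 0 < `|l| by rewrite normr_gt0.
  pose q := `|qhess r x u|.
  have q0 : 0 <= q by exact: normr_ge0.
  pose B := q + 2 * K + 1.
  have B0 : 0 < B by rewrite /B; lra.
  pose e := Num.min 1 (Num.min (l ^+ 2 / (4 * B)) (`|l| / 2 / (K' + 1))).
  have K'1 : 0 < K' + 1 by lra.
  have l2 : 0 < l ^+ 2 by rewrite exprn_even_gt0.
  have e0 : 0 < e.
    by rewrite !lt_min ltr01; apply/andP; split; rewrite ?divr_gt0 // mulr_gt0.
  have e1 : e <= 1 by rewrite ge_min lexx.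
  have e2 : e * (4 * B) <= l ^+ 2 by rewrite -ler_pdivlMr ?mulr_gt0// !ge_min lexx orbT.
  have e3 : e * (K' + 1) <= `|l| / 2 by rewrite -ler_pdivlMr// !ge_min lexx !orbT.
  exists e => // v v1 vu.
  have hL : `|l| / 2 <= `|real_derive v r x|.
    have := lipL v; have : K' * en (v - u) <= (K' + 1) * e.
      by apply: ler_pM; rewrite ?en_ge0 ?(ltW vu)//; lra.
    move: (real_derive v r x) => a h1 h2.
    have := ler_normD (l - a) a; rewrite subrK distrC; move: h1 h2 e3; lra.
  have hL2 : l ^+ 2 / 4 <= real_derive v r x ^+ 2.
    rewrite -(real_normK (num_real (real_derive v r x))) -(real_normK (num_real l)).
    rewrite (_ : _ / 4 = (`|l| / 2) ^+ 2); last by rewrite expr_div_n -natrX.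
    by rewrite ler_pXn2r ?nnegrE// divr_ge0.
  have hB : B <= e^-1 * real_derive v r x ^+ 2.
    rewrite mulrC ler_pdivlMr//; apply: le_trans hL2; move: e2; lra.
  have := lipQ v v1; have : 2 * K * en (v - u) <= 2 * K * e by rewrite ler_wpM2l ?(ltW vu)//; lra.
  have : 2 * K * e <= 2 * K by rewrite ler_piMr//; lra.
  have hq := ler_norm (- qhess r x u); rewrite normrN -/q in hq.
  move: hB hq; rewrite /B; move: (qhess r x v) (qhess r x u) (e^-1 * _) => a b c.
  by rewrite ler_norml => hB hq h1 h2 /andP[h3 _]; lra.
exists e => // v; have [->|v0] := eqVneq v 0.
  by rewrite en0 expr0n mulr0 (qhess0 oU rC rC2)// (real_derive0 rC)// expr0n mulr0 addr0.
have ev : 0 < en v by rewrite en_gt0.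
pose u := ((en v)^-1)%:C *: v.
have u1 : en u = 1 by rewrite enZr ger0_norm ?invr_ge0 ?en_ge0// mulVf// gt_eqF.
have := he u u1; rewrite (qhessZ oU rC rC2)// (real_deriveZ rC)// exprMn exprVn.
rewrite mulrCA -mulrDr mulrC ler_pdivlMr ?exprn_gt0//.
Qed.

Lemma bd_inward z v (d : R) : bd z -> 0 < d ->
  (forall t : R, 0 < t < d -> closure Y (z + t%:C *: v)) -> real_derive v r z <= 0.
Proof.
move=> bz d0 ht; have Uz := bdU bz; have rz := bd_eq0 bz.
have [d1 d10 hd1] := oU Uz.
rewrite leNgt; apply/negP => l0.
have l2 : 0 < real_derive v r z / 2 by rewrite divr_gt0.
have [d2 d20 h2] := real_derive_littleo (rC.1 v z Uz) l2.
have v1 : 0 < en v + 1 by rewrite ltr_wpDl// en_ge0.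
pose m := Num.min d (Num.min (d1 / (en v + 1)) d2).
have m0 : 0 < m by rewrite !lt_min d0 divr_gt0.
have m1 : m <= d by rewrite ge_min lexx.
have m2 : m <= d1 / (en v + 1) by rewrite !ge_min lexx orbT.
have m3 : m <= d2 by rewrite !ge_min lexx !orbT.
pose t := m / 2.
have t0 : 0 < t by rewrite divr_gt0.
have td : t < d by rewrite /t; lra.
have td1 : en (t%:C *: v) < d1.
  rewrite enZr gtr0_norm//; have : t * (en v + 1) < d1.
    by rewrite -ltr_pdivlMr//; rewrite /t; lra.
  by rewrite mulrDr mulr1; move: t0; lra.
have Ut : U (z + t%:C *: v) by apply: hd1; rewrite addrAC subrr add0r.
have rt : r (z + t%:C *: v) <= 0.
  by apply: (closure_le0) => //; apply: ht; rewrite t0.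
have := h2 t; rewrite gtr0_norm// rz subr0 => /(_ ltac:(rewrite /t; lra)).
move: (real_derive v r z) (r _) l0 rt => l a l0 rt; rewrite ler_norml => /andP[+ _].
by move: t0 l0 rt; nra.
Qed.

Lemma bd_grad_upper : exists2 e : R, 0 < e & forall x, bd x ->
  forall v, `|real_derive v r x| <= e^-1 * en v.
Proof.
apply: (compact_uniform bd_closed bd_bounded).
  move=> x e e' h e'0 e'e v; apply: le_trans (h v) _.
  have e0 : 0 < e := lt_le_trans e'0 e'e.
  by rewrite ler_wpM2r ?en_ge0// lef_pV2 ?posrE.
move=> x bx; have Ux := bdU bx.
have [d d0 hd] := real_derive_equi oU rC Ux ltr01.
have [K K0 hK] := real_derive_bound oU rC Ux.
have K1 : 0 < K + 1 by lra.
pose e := Num.min d (K + 1)^-1.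
have e0 : 0 < e by rewrite lt_min d0 invr_gt0.
have e1 : e <= d by rewrite ge_min lexx.
have e2 : K + 1 <= e^-1 by rewrite -[K + 1]invrK lef_pV2 ?posrE ?invr_gt0// ge_min lexx orbT.
exists e => // y _ yx v.
have := (hd y (lt_le_trans yx e1)).2 v; have := hK v.
move: (real_derive v r x) (real_derive v r y) => a b ha hb.
apply: (@le_trans _ _ ((K + 1) * en v)); last by rewrite ler_wpM2r ?en_ge0.
have := ler_normD (b - a) a; rewrite subrK; move: ha hb; lra.
Qed.

(** Let l be the derivative along v and s = |v|. By [hess_coercive], with constant c, the Hessian
    along the segment is at least c s^2 / 2 - 2 l^2 / c. If this is nonnegative, Taylor's formula
    and r <= 0 at the far end bound -l below by a multiple of s^2; otherwise -l is at least c s / 2,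
    which is more for small s. *)
Lemma bd_strong : exists2 e : R, 0 < e & forall x, bd x ->
  forall v, en v < e -> closure Y (x + v) -> e * en v ^+ 2 <= - real_derive v r x.
Proof.
apply: (compact_uniform bd_closed bd_bounded).
  move=> x e e' h e'0 e'e v ve Yv; apply: le_trans (h v (lt_le_trans ve e'e) Yv).
  by rewrite ler_wpM2r// exprn_ge0// en_ge0.
move=> x bx; have Ux := bdU bx.
have [c c0 hc] := hess_coercive bx.
have [K K0 hK] := real_derive_bound oU rC Ux.
have c4 : 0 < c / 4 by rewrite divr_gt0.
have c2 : 0 < c ^+ 2 by rewrite exprn_gt0.
have [d1 d10 h1] := qhess_equi oU rC rC2 Ux c4.
(* Replacing the derivative at x by that at y costs at most eta s, and this eta keeps the resulting
   error 2 (eta s)^2 / c below c s^2 / 4. *)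
pose eta := Num.min 1 (c ^+ 2 / 8).
have eta0 : 0 < eta by rewrite lt_min ltr01 divr_gt0.
have [d2 d20 h2] := real_derive_equi oU rC Ux eta0.
have eta1 : eta <= 1 by rewrite ge_min lexx.
have eta2 : eta <= c ^+ 2 / 8 by rewrite ge_min lexx orbT.
have K1 : 0 < K + 1 by lra.
pose e := Num.min (Num.min (d1 / 2) d2) (Num.min (Num.min 1 (c / 16)) (c / (4 * (K + 1)))).
have e0 : 0 < e by rewrite !lt_min d20 ltr01 !divr_gt0 ?mulr_gt0.
have e1 : e <= d1 / 2 by rewrite !ge_min lexx.
have e2 : e <= d2 by rewrite !ge_min lexx ?orbT.
have e5 : e <= 1 by rewrite !ge_min lexx ?orbT.
have e3 : e <= c / 16 by rewrite !ge_min lexx ?orbT.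
have e4 : e * (4 * (K + 1)) <= c.
  by rewrite -ler_pdivlMr ?mulr_gt0// !ge_min lexx !orbT.
exists e => // y by_ yx v ve Yv; have Uy := bdU by_; have ry := bd_eq0 by_.
have yd2 : en (y - x) < d2 by exact: lt_le_trans e2.
have hL := (h2 y yd2).2 v.
have cl (t : R) : 0 <= t <= 1 -> en (y + t%:C *: v - x) < d1.
  move=> /andP[t0 t1]; rewrite addrAC; apply: le_lt_trans (enD _ _) _.
  have : en (t%:C *: v) <= en v by rewrite enZr ger0_norm// ler_piMl// en_ge0.
  by move: yx ve e1; lra.
have Uyt (t : R) : 0 <= t <= 1 -> U (y + t%:C *: v) by move=> ht; exact: (h1 _ (cl t ht)).1.
have Uyv : U (y + v) by have := Uyt 1; rewrite scale1r; apply; rewrite ler01 lexx.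
have ryv : r (y + v) <= 0 by exact: (closure_le0).
have L0bound := hK v.
have lneg : real_derive v r y <= 0.
  apply: (bd_inward by_ ltr01) => t /andP[t0 t1].
  have := closure_cvx cY by_.1 Yv (t := t); rewrite addrAC subrr add0r; apply.
  by rewrite !ltW.
have tay := line_taylor rC rC2 Uyt.
move EL : (real_derive v r y) lneg tay hL => l lneg [_ tay] hL.
move EL0 : (real_derive v r x) hL L0bound => l0 hL L0bound.
move Es : (en v) ve hL L0bound => s ve hL L0bound.
have s0 : 0 <= s by rewrite -Es en_ge0.
have hl0 : l0 ^+ 2 <= 2 * l ^+ 2 + 2 * (eta * s) ^+ 2.
  have : (l0 - l) ^+ 2 <= (eta * s) ^+ 2.
    rewrite -(real_normK (num_real (l0 - l))) ler_pXn2r ?nnegrE//; first by rewrite distrC.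
    by rewrite mulr_ge0// ltW.
  by have := sqr_ge0 (l0 - 2 * l); move: (eta * s) => p; nra.
have hes : (eta * s) ^+ 2 <= eta * s ^+ 2.
  by rewrite exprMn ler_wpM2r ?exprn_ge0// expr2 ler_piMl// ltW.
pose D := 2 * c^-1 * l ^+ 2.
have lower (t : R) : 0 <= t <= 1 -> c / 2 * s ^+ 2 - D <= qhess r (y + t%:C *: v) v.
  move=> ht; have := (h1 _ (cl t ht)).2 v; rewrite Es.
  have := hc v; rewrite EL0 Es.
  move: (qhess r x v) (qhess r (y + t%:C *: v) v) => a b ha; rewrite ler_norml => /andP[hb _].
  have : c^-1 * l0 ^+ 2 <= c^-1 * (2 * l ^+ 2 + 2 * (eta * s) ^+ 2).
    by rewrite ler_wpM2l// invr_ge0 ltW.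
  have : c^-1 * (2 * (eta * s) ^+ 2) <= c / 4 * s ^+ 2.
    rewrite mulrC ler_pdivrMr//.
    have : eta * s ^+ 2 <= c ^+ 2 / 8 * s ^+ 2 by rewrite ler_wpM2r// exprn_ge0.
    by move: hes; rewrite (_ : c / 4 * s ^+ 2 * c = 2 * (c ^+ 2 / 8 * s ^+ 2)); [lra|field].
  by rewrite /D; move: ha hb; rewrite mulrDr; lra.
have s20 : 0 <= s ^+ 2 by rewrite exprn_ge0.
have es : e * s ^+ 2 <= c / 16 * s ^+ 2 by rewrite ler_wpM2r.
have Dc : D * c = 2 * l ^+ 2 by rewrite /D; field; rewrite gt_eqF.
have [C0|C0] := leP 0 (c / 2 * s ^+ 2 - D).
  have /= H := tay _ C0 lower.
  have {}H : c / 8 * s ^+ 2 <= - l + D / 4 by move: H; rewrite ry; lra.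
  have lb : - l <= c / 4.
    have : `|l| <= (K + 1) * s.
      have := ler_normD (l - l0) l0; rewrite subrK.
      have : eta * s <= s by rewrite ler_piMl.
      by move: hL L0bound; lra.
    have : (K + 1) * s <= (K + 1) * e by rewrite ler_wpM2l// ltW.
    by rewrite ler0_norm//; move: e4; lra.
  have : D / 4 <= - l / 8.
    rewrite -(ler_pM2r c0) mulrAC Dc.
    have : - l * - l <= - l * (c / 4) by rewrite ler_wpM2l// oppr_ge0.
    by rewrite mulrNN expr2; lra.
  by move: es H; have : 0 <= c / 16 * s ^+ 2 by [rewrite mulr_ge0// divr_ge0// ltW]; lra.
have : (c / 2 * s) ^+ 2 <= (- l) ^+ 2.
  rewrite sqrrN; have : c / 2 * s ^+ 2 * c <= D * c by rewrite ler_wpM2r// ltW//; move: C0; lra.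
  by rewrite Dc; rewrite (_ : (c / 2 * s) ^+ 2 = c / 2 * s ^+ 2 * c / 2); [lra|field].
rewrite ler_pXn2r ?nnegrE ?oppr_ge0// => [h|]; last by rewrite mulr_ge0// divr_ge0// ltW.
have : c / 16 * s ^+ 2 <= c / 16 * s.
  rewrite ler_wpM2l ?divr_ge0 ?(ltW c0)// expr2 ler_piMr//; apply: ltW.
  exact: lt_le_trans e5.
have : 0 <= c * s by rewrite mulr_ge0// ltW.
by move: es h; lra.
Qed.

Hypothesis n0 : (0 < n)%N.

Lemma nearest_bd P : Y P -> exists x u (d : R), [/\ bd x, en u = 1, P = x + d%:C *: u, 0 < d
  & margin Y P d].
Proof.
move=> YP.
have cC : closed (~` Y).
  apply/closed_enP => z hz /oY[e e0 he]; have [w nw wz] := hz e e0.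
  by apply: nw; exact: he.
have nC : ~` Y !=set0.
  pose j : 'I_n := Ordinal n0.
  exists (const_mx (M + 1)%:C) => /YM; apply/negP; rewrite -ltNge.
  apply: lt_le_trans (modulus_le_en _ j); rewrite mxE modulus_real.
  by apply: lt_le_trans (ler_norm _); rewrite ltrDl.
have [x nYx hx] := nearest_point P cC nC.
pose d := en (x - P).
have mP : margin Y P d.
  by move=> w wP; apply: contrapT => nw; move: wP; rewrite ltNge hx.
have d0 : 0 < d.
  rewrite en_gt0 subr_eq0; apply/eqP => xP; apply: nYx; rewrite xP; exact: YP.
exists x, (d^-1%:C *: (P - x)), d; split => //; last 2 first.
- by rewrite enZr ger0_norm ?invr_ge0 ?(ltW d0)// enBC mulVf// gt_eqF.
- by rewrite scalerA -rmorphM/= mulfV ?gt_eqF// scale1r addrC subrK.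
split => //; apply/closure_enP => e e0.
pose t := Num.min (1 / 2) (e / (d + d)).
have dd : 0 < d + d by rewrite addr_gt0.
have t0 : 0 < t by rewrite lt_min !divr_gt0.
have t1 : t <= 1 / 2 by rewrite ge_min lexx.
have t2 : t * (d + d) <= e by rewrite -ler_pdivlMr// ge_min lexx orbT.
exists (x + t%:C *: (P - x)).
  apply: mP; rewrite (_ : _ - P = (1 - t)%:C *: (x - P)).
    by rewrite enZr -/d ger0_norm; [rewrite gtr_pMl//|]; lra.
  by apply/rowP => j; rewrite !mxE rmorphB rmorph1; ring.
rewrite addrAC subrr add0r enZr enBC -/d gtr0_norm//.
by have : 0 < t * d by [rewrite mulr_gt0]; move: t2; rewrite mulrDr; lra.
Qed.

(** Directions with [rdot v u] positive enter the ball, so the derivative is nonpositive on them. By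
    approximation it is nonpositive on the hyperplane orthogonal to u, hence zero there by symmetry,
    and so it is a multiple of [rdot v u]. *)
Lemma normal_functional x u (d : R) : bd x -> en u = 1 -> 0 < d -> margin Y (x + d%:C *: u) d ->
  forall v, real_derive v r x = rdot v u * real_derive u r x.
Proof.
move=> bx u1 d0 mP; have Ux := bdU bx.
have neg v : 0 < rdot v u -> real_derive v r x <= 0.
  move=> vu; have v1 : 0 < en v ^+ 2 + 1 by rewrite ltr_wpDl// exprn_ge0// en_ge0.
  have t00 : 0 < 2 * d * rdot v u / (en v ^+ 2 + 1) by rewrite divr_gt0// !mulr_gt0.
  apply: (bd_inward bx t00) => t /andP[t0]; rewrite ltr_pdivlMr// => tl.
  apply: subset_closure; apply: mP.
  rewrite opprD addrA [x + _]addrC addrK -(@ltr_pXn2r _ 2) ?nnegrE ?en_ge0 ?(ltW d0)//.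
  rewrite en_sqrB !enZr rdotZl rdotZr u1 mulr1 !gtr0_norm// exprMn.
  move: (en v ^+ 2) (rdot v u) tl => a b tl.
  have : t * (t * (a + 1)) < t * (2 * d * b) by rewrite ltr_pM2l.
  by rewrite expr2; nra.
have zero v : rdot v u = 0 -> real_derive v r x <= 0.
  move=> vu; rewrite leNgt; apply/negP => l0.
  pose K := `|real_derive u r x| + 1.
  have K0 : 0 < K by rewrite ltr_wpDl.
  pose t := real_derive v r x / K.
  have t0 : 0 < t by rewrite divr_gt0.
  have := neg (v + t%:C *: u); rewrite rdotDl rdotZl vu -en_sqr u1 expr1n mulr1 add0r => /(_ t0).
  rewrite (real_deriveD oU rC)// (real_deriveZ rC)//.
  have := ler_norm (- real_derive u r x); rewrite normrN.
  have tK : t * K = real_derive v r x by rewrite divfK// gt_eqF.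
  move: tK; rewrite /K; move: (real_derive v r x) (real_derive u r x) (`|_|) => a b c.
  by move=> tK h; have : t * - b <= t * c by [rewrite ler_wpM2l// ltW]; lra.
move=> v; pose w := v - (rdot v u)%:C *: u.
have wu : rdot w u = 0.
  by rewrite rdotBl rdotZl -en_sqr u1 expr1n mulr1 subrr.
have w0 : real_derive w r x = 0.
  apply/le_anti; rewrite zero//= -oppr_le0 -(real_deriveN rC)//; apply: zero.
  by rewrite rdotNl wu oppr0.
have -> : v = w + (rdot v u)%:C *: u by rewrite subrK.
by rewrite (real_deriveD oU rC)// (real_deriveZ rC)// w0 add0r rdotDl wu rdotZl -en_sqr u1 expr1n mulr1 add0r.
Qed.

(** The upper bound on the Hessian gives the interior ball, [bd_strong] gives the quadratic support
    inequality, and the two-sided bounds on the gradient convert between the derivative of r and the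
    product with u. *)
Lemma strong_ball : exists r0 c : R, [/\ 0 < r0, 0 < c & forall P, Y P ->
  exists x u (d : R), [/\ ~ Y x /\ en u = 1, P = x + d%:C *: u, 0 < d /\ margin Y P d,
    margin Y (x + r0%:C *: u) r0
  & forall y, Y y -> c * en (y - x) ^+ 2 <= rdot (y - x) u]].
Proof.
have [eU eU0 hU] := bd_U_uniform.
have [g g0 hg] := bd_grad_uniform.
have [eH eH0 hH] := bd_hess_upper.
have [eK eK0 hK] := bd_grad_upper.
have [e e0 he] := bd_strong.
pose B := Num.max 1 (Num.max (2 * M + 1) (e / 2)).
have B1 : 1 <= B by rewrite le_max lexx.
have B2 : 2 * M + 1 <= B by rewrite !le_max lexx orbT.
have B3 : e / 2 <= B by rewrite !le_max lexx !orbT.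
(* Multiplication by tau brings y - x, of length at most B, into the range of [bd_strong]. The
   shrunken point stays in the closure by convexity, so the local inequality becomes global, with
   its constant multiplied by tau. *)
pose tau := e / 2 / (B + B).
have BB : 0 < B + B by lra.
have tau0 : 0 < tau by rewrite !divr_gt0.
have tauB : tau * (B + B) = e / 2 by rewrite divfK// gt_eqF.
(* A point x + v of the tangent ball has |v|^2 < 2 r0 [rdot v u], and there r is at most |v|^2 / eH
   - k [rdot v u], where k >= g is minus the derivative along u. The last bound makes this negative;
   the other two keep the ball where the estimates hold. *)
pose r0 := Num.min (Num.min (eU / 4) (eH / 4)) (g * eH / 4).
have r00 : 0 < r0 by rewrite !lt_min !divr_gt0// mulr_gt0.
have r01 : r0 <= eU / 4 by rewrite !ge_min lexx.
have r02 : r0 <= eH / 4 by rewrite !ge_min lexx ?orbT.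
have r03 : r0 <= g * eH / 4 by rewrite !ge_min lexx ?orbT.
exists r0, (e * tau * eK); split => //; first exact: (mulr_gt0 (mulr_gt0 e0 tau0) eK0).
move=> P YP; have [x [u [d [bx u1 PE d0 mP]]]] := nearest_bd YP.
exists x, u, d; have Ux := bdU bx.
have LE v : real_derive v r x = rdot v u * real_derive u r x.
  by apply: (@normal_functional x u d) => //; rewrite -PE.
have kappa_ge : g <= - real_derive u r x.
  have [w w1] := hg x bx; rewrite LE.
  have : real_derive u r x <= 0.
    apply: (bd_inward bx d0) => t /andP[t0 td].
    apply: subset_closure; apply: mP; rewrite PE opprD addrA [x + _]addrC addrK -scalerBl -rmorphB.
    by rewrite enZr u1 mulr1 ltr0_norm; lra.
  have := rdot_norm_le w u; rewrite u1 mulr1 ler_norml => /andP[+ _].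
  by move: (rdot w u) (real_derive u r x) => a b; nra.
have kappa_le : - real_derive u r x <= eK^-1.
  have := hK x bx u; rewrite u1 mulr1; have := ler_norm (- real_derive u r x).
  by rewrite normrN; exact: le_trans.
move: (- real_derive u r x) kappa_ge kappa_le (opprK (real_derive u r x)) => k kg kK Ek.
have {}LE v : real_derive v r x = - (k * rdot v u) by rewrite LE -Ek mulrN mulrC.
have k0 : 0 < k by exact: lt_le_trans kg.
split => //; first by split => //; exact: bx.2.
- move=> w; pose v := w - x; have -> : w = x + v by rewrite addrC subrK.
  move=> hw.
  have vlt : en v ^+ 2 < 2 * r0 * rdot v u.
    move: hw; rewrite opprD addrA [x + _]addrC addrK -(@ltr_pXn2r _ 2) ?nnegrE ?en_ge0 ?(ltW r00)//.
    by rewrite en_sqrB enZr rdotZr u1 mulr1 gtr0_norm//; lra.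
  have v2 : en v < 2 * r0.
    move: hw; rewrite opprD addrA [x + _]addrC addrK => hw.
    rewrite -(subrK (r0%:C *: u) v); apply: le_lt_trans (enD _ _) _.
    by rewrite [en (_ *: _)]enZr u1 mulr1 (gtr0_norm r00); lra.
  have tv (t : R) : 0 <= t <= 1 -> en (x + t%:C *: v - x) <= en v.
    move=> /andP[t0 t1]; rewrite addrAC subrr add0r enZr ger0_norm//.
    by rewrite ler_piMl// en_ge0.
  have Uxt (t : R) : 0 <= t <= 1 -> U (x + t%:C *: v).
    by move=> /tv h; apply: (hU x bx); apply: le_lt_trans h _; lra.
  have Uxv : U (x + v) by have := Uxt 1; rewrite scale1r; apply; rewrite ler01 lexx.
  apply/(YU Uxv); have [tay _] := line_taylor rC rC2 Uxt.
  have eH1 : 0 < eH^-1 by rewrite invr_gt0.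
  have C0 : 0 <= eH^-1 * en v ^+ 2 by rewrite mulr_ge0 ?exprn_ge0 ?en_ge0 ?(ltW eH1).
  have : r (x + v) <= r x + real_derive v r x + eH^-1 * en v ^+ 2.
    apply: (tay _ C0) => t /tv h; apply: (hH x bx).
    by apply: le_lt_trans h _; lra.
  move/le_lt_trans; apply; rewrite (bd_eq0 bx) LE add0r.
  rewrite addrC subr_lt0.
  rewrite mulrC ltr_pdivrMr//.
  apply: (lt_le_trans (vlt)).
  have vu : 0 <= rdot v u.
    have : 0 < 2 * r0 * rdot v u by apply: (le_lt_trans _ vlt); rewrite exprn_ge0// en_ge0.
    by rewrite pmulr_rgt0 ?mulr_gt0//; exact: ltW.
  move: (rdot v u) vu => a a0; rewrite [X in _ <= X]mulrAC ler_wpM2r//.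
  have : g * eH <= k * eH by rewrite ler_wpM2r// ltW.
  by move: r03 (mulr_gt0 g0 eH0); lra.
move=> y Yy; pose v := y - x; rewrite -/v.
have vB : en v <= B.
  apply: le_trans (enB _ _) _; have := YM Yy; have := bd_bounded bx; lra.
have te : en (tau%:C *: v) < e.
  rewrite enZr gtr0_norm//.
  have : tau * en v <= tau * B by rewrite ler_wpM2l// ltW.
  by move: tauB; rewrite mulrDr; lra.
have tau1 : tau <= 1.
  by rewrite ler_pdivrMr//; lra.
have cl : closure Y (x + tau%:C *: v).
  apply: (closure_cvx cY); [exact: bx.1|exact: subset_closure|].
  by rewrite tau1 ltW.
have := he x bx _ te cl; rewrite LE opprK rdotZl enZr gtr0_norm// exprMn.
rewrite (_ : k * (tau * _) = tau * (k * rdot v u)); last by ring.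
rewrite (_ : e * _ = tau * (e * tau * en v ^+ 2)); last by ring.
rewrite ler_pM2l// => h.
have a0 : 0 <= e * tau * en v ^+ 2 by rewrite (mulr_ge0 (mulr_ge0 (ltW e0) (ltW tau0)))// exprn_ge0// en_ge0.
have vu : 0 <= rdot v u.
  by have := le_trans a0 h; rewrite pmulr_rge0.
have : k * rdot v u <= eK^-1 * rdot v u by rewrite ler_wpM2r.
move=> /(le_trans h); rewrite [X in _ <= X -> _]mulrC ler_pdivlMr//.
by rewrite mulrAC.
Qed.

End StronglyConvex.

(** * Visibility and the absence of branching *)

Section HarmonicBound.
Context {R : realType}.

(** The mean of g (1 - [pk]) over the circle is g 0 - g a, by the mean value property and Poisson's
    formula; the right-hand side averages to its value at 0. *)
Lemma harmonic_bound (g h : R[i] -> R[i]) (r0 r A B : R) (a : R[i]) :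
  disc_hol r0 g -> disc_hol r0 h -> modulus a < r -> r < r0 ->
  (forall w : R[i], modulus w = r -> Re (g w) * (1 - pk r a w) <= A + B * Re (h w)) ->
  Re (g 0 - g a) <= A + B * Re (h 0).
Proof.
move=> hg hh ar rr H; have rp : 0 < r := le_lt_trans (modulus_ge0 _) ar.
have r1 := ltW rp.
have mv f : disc_hol r0 f -> cmean r f = f 0.
  move=> hf; apply: (mean_value (p := 0) (r0 := r0)); last by rewrite rp.
    by move=> w wr; exact: chol_cont (hf w wr).
  by move=> w wr _; exact: hf.
have cg := disc_hol_circle hg rr; have ch := disc_hol_circle hh rr.
have cgp : circle_cont r (fun w => g w * (pk r a w)%:C).
  by move=> w wr; apply: ccontM; [exact: cg|exact: pk_cont wr].
have cng : circle_cont r (fun w => -1 * g w).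
  by move=> w wr; apply: ccontM; [exact: ccont_cst|exact: cg].
have ckh : circle_cont r (fun w => B%:C * h w).
  by move=> w wr; apply: ccontM; [exact: ccont_cst|exact: ch].
have cG : circle_cont r (fun w => A%:C + B%:C * h w).
  by move=> w wr; apply: ccontD; [exact: ccont_cst|exact: ckh].
have cG1 : circle_cont r (fun w => A%:C + B%:C * h w + -1 * g w).
  by move=> w wr; apply: ccontD; [exact: cG|exact: cng].
have cH : circle_cont r (fun w => A%:C + B%:C * h w + -1 * g w + g w * (pk r a w)%:C).
  by move=> w wr; apply: ccontD; [exact: cG1|exact: cgp].
have := @Re_cmean_ge0 _ _ (fun w => A%:C + B%:C * h w + -1 * g w + g w * (pk r a w)%:C) r1.
rewrite (cmeanD r1 cG1 cgp) (cmeanD r1 cG cng) (cmeanD r1 (circle_cont_cst _) ckh).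
rewrite (cmeanZ r1 cg) (cmeanZ r1 ch) cmean_cst (mv _ hg) (mv _ hh) (poisson_formula hg ar rr).
rewrite mulN1r !RecD !RecN RecM/= mul0r subr0 => Hm; rewrite -subr_ge0 opprD opprK !addrA.
apply: Hm => w wr; have := H w wr; rewrite !RecD !RecM/= !mul0r !mulr0 !subr0.
by move: (Re (g w)) (Re (h w)) (pk r a w) => x y z; lra.
Qed.

End HarmonicBound.

(** * Discs and distances near the boundary *)

Section Pegs.
Context {R : realType} {n : nat}.
Variables (Y : set 'rV[R[i]]_n) (r0 c : R).
Implicit Types (u v w x y o P Q : 'rV[R[i]]_n) (d s T : R) (f : R[i] -> 'rV[R[i]]_n).

(* P hangs at depth d below its nearest boundary point x, with inner normal u; r0 is the radius
   of the interior ball and c the constant of strong convexity. *)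
Definition peg P x u d := [/\ ~ Y x /\ en u = 1, P = x + d%:C *: u, 0 < d /\ margin Y P d,
    margin Y (x + r0%:C *: u) r0
  & forall y, Y y -> c * en (y - x) ^+ 2 <= rdot (y - x) u].

Hypotheses (oY : eopen Y) (cY : cvx Y) (r00 : 0 < r0) (c0 : 0 < c).

(* The support inequality bounds |f - x| on a circle by a harmonic function, by AM-GM. *)
Lemma disc_move f x u d (a : R[i]) : disc_in Y f -> peg (f 0) x u d -> modulus a <= 255 / 257 ->
  en (f a - f 0) <= 514 * Num.sqrt (d / c).
Proof.
move=> [hf fY] [[_ u1] PE [d0 _] _ sup] a1.
set tau := Num.sqrt (d / c).
have tau0 : 0 < tau by rewrite sqrtr_gt0 divr_gt0.
have tau2 : tau * tau * c = d by rewrite -expr2 sqr_sqrtr ?divfK ?gt_eqF// ltW// divr_gt0.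
have [fa|e0] := leP (en (f a - f 0)) 0.
  by apply: le_trans fa _; apply: mulr_ge0; [lra|exact: ltW].
set e := en (f a - f 0) in e0 *.
pose v := e^-1%:C *: (f a - f 0).
have v1 : en v = 1 by rewrite enZr gtr0_norm ?invr_gt0// mulVf// gt_eqF.
(* 255 / 257 is [tp 256], the length of one step in [visibility]. With this r the Poisson kernel is
   at most 511, hence at most 514 = 2 * 257, the constant that the inequality 2 s <= tau + s^2 / tau
   absorbs. *)
pose r : R := 256 / 257.
have ar : modulus a < r by apply: le_lt_trans a1 _; rewrite /r; lra.
have r1 : r < 1 by rewrite /r; lra.
have hg : disc_hol 1 (fun z => cdot (x - f z) v) by exact: vhol_cdot.
have hh : disc_hol 1 (fun z => cdot (x - f z) u) by exact: vhol_cdot.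
have ctau : 0 < c * tau by rewrite mulr_gt0.
have := @harmonic_bound _ _ _ 1 r (257 * tau) (- (257 / (c * tau))) a hg hh ar r1.
rewrite -cdotBl opprB [x - f 0 + _]addrC addrA subrK -!rdotE.
have -> : rdot (f a - f 0) v = e by rewrite rdotZr -en_sqr -/e expr2 mulrA mulVf ?mul1r// gt_eqF.
have -> : rdot (x - f 0) u = - d.
  by rewrite PE opprD addrA subrr add0r rdotNl rdotZl -en_sqr u1 expr1n mulr1.
rewrite mulrNN (_ : 257 / (c * tau) * d = 257 * tau); last first.
  by rewrite -tau2; field; rewrite !gt_eqF.
rewrite -mulrDl (_ : 257 + 257 = 514); last lra.
apply => w wr; rewrite -!rdotE -(opprB (f w)) !rdotNl mulrNN.
have w1 : modulus w < 1 by rewrite wr.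
have /andP[_ p1] := pk_bounds ar wr; have p0 := pk_gt0 ar wr.
have p2 : pk r a w <= 514.
  apply: le_trans p1 _; rewrite ler_pdivrMr ?subr_gt0//.
  by move: (modulus a) a1 => b; rewrite /r; lra.
have := sup _ (fY w w1); set s := en (f w - x) => hs.
have := rdot_norm_le (f w - x) v; rewrite v1 mulr1 -/s => hv.
have s0 : 0 <= s by exact: en_ge0.
have : - rdot (f w - x) v * (1 - pk r a w) <= 514 * s.
  apply: le_trans (ler_norm _) _; rewrite normrM normrN mulrC.
  apply: ler_pM => //; rewrite ler_norml; apply/andP; split; lra.
move/le_trans; apply.
have : 257 / (c * tau) * (c * s ^+ 2) <= 257 / (c * tau) * rdot (f w - x) u.
  by apply: ler_wpM2l => //; apply: divr_ge0; [lra|exact: ltW].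
rewrite (_ : 257 / (c * tau) * (c * s ^+ 2) = 257 * (s ^+ 2 / tau)); last first.
  by field; rewrite !gt_eqF.
have : 2 * s <= tau + s ^+ 2 / tau.
  rewrite -(ler_pM2r tau0) [X in _ <= X]mulrDl divfK ?gt_eqF//.
  by have := sqr_ge0 (s - tau); lra.
move: (s ^+ 2 / tau) (257 / (c * tau) * _) => y z; lra.
Qed.

Lemma peg_ball P x u d s : peg P x u d -> 0 < s -> s <= r0 -> margin Y (x + s%:C *: u) s.
Proof.
move=> [[_ u1] _ _ mr _] s0 sr w ws; apply: mr.
rewrite (_ : w - _ = (w - (x + s%:C *: u)) + (s - r0)%:C *: u); last first.
  by apply/rowP => j; rewrite !mxE rmorphB; ring.
apply: le_lt_trans (enD _ _) _; rewrite [en (_ *: _)]enZr u1 mulr1 ler0_norm; lra.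
Qed.

(** The disc x + s (1 + z) u lies in the ball of radius s tangent at x. It has the target at 0 and P
    at d / s - 1, and the parameter between them is (2 s - d) / d. *)
Lemma peg_inward P x u d s : peg P x u d -> d <= s -> s <= r0 ->
  Kle Y P (x + s%:C *: u) (2 * s / d).
Proof.
move=> pg ds sr; have [[_ u1] PE [d0 _] _ _] := pg.
have s0 : 0 < s := lt_le_trans d0 ds.
pose f (z : R[i]) := (x + s%:C *: u) + (s%:C * z) *: u.
have df : disc_in Y f.
  split.
    apply: vholD; first exact: vhol_cst.
    by apply: vholZ; [move=> z _; exact: chol_scale|exact: vhol_cst].
  move=> z z1; apply: (peg_ball pg s0 sr).
  rewrite addrAC subrr add0r enZ u1 mulr1 modulusM modulus_real gtr0_norm//.
  by rewrite gtr_pMr.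
have f0 : f (tp 1)%:C = x + s%:C *: u by rewrite /f tp1 rmorph0 mulr0 scale0r addr0.
pose U := d / (2 * s - d).
have U0 : 0 < U by rewrite divr_gt0//; lra.
have U1 : U <= 1 by rewrite ler_pdivrMr; lra.
have tU : tp U = d / s - 1.
  by rewrite /tp /U; field; rewrite !gt_eqF//; lra.
have fU : f (tp U)%:C = P.
  rewrite /f PE tU; apply/rowP => j; rewrite !mxE -rmorphM/= (_ : s * (d / s - 1) = d - s).
    by rewrite rmorphB/=; ring.
  by field; rewrite gt_eqF.
have := Kd_points df U0 U1; rewrite f0 fU => /Kd_Kle; apply: Kle_mono.
rewrite /U div1r invf_div ler_pM2r ?invr_gt0//; lra.
Qed.

(** The support inequality at y = P reads c d^2 <= d. *)
Lemma peg_depth_le P x u d : Y P -> peg P x u d -> d <= c^-1.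
Proof.
move=> YP [[_ u1] PE [d0 _] _ /(_ P YP)].
rewrite {1 2}PE addrAC subrr add0r enZr rdotZl -en_sqr u1 mulr1 expr1n mulr1 gtr0_norm// => h.
rewrite -(ler_pM2l c0) mulfV ?gt_eqF// -(ler_pM2r d0) mul1r -mulrA -expr2 //.
Qed.

(** By Harnack the ball of radius e / T about P lies in Y, while x, at distance d from P, does
    not. *)
Lemma peg_depth_ge P x u d o (e T : R) : peg P x u d -> margin Y o e -> 0 < e -> Kle Y o P T ->
  e / T <= d.
Proof.
move=> [[nx u1] PE [d0 _] _ _] mo e0 /(Kle_margin oY cY mo e0) mP.
rewrite leNgt; apply/negP => h; apply: nx; apply: mP.
by rewrite PE opprD addrA subrr add0r enN enZr u1 mulr1 gtr0_norm.
Qed.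

(** The path goes from P inward to depth s, across, and back out to P'. The crossing has length at
    most 3 s, six affine steps, which costs 3^6. Each inward part costs 2 s / d <= 2 s T / e, and
    2916 = 4 * 3^6. *)
Lemma peg_close P P' x x' u u' d d' o (e s T : R) : peg P x u d -> peg P' x' u' d' ->
  margin Y o e -> 0 < e -> Kle Y o P T -> Kle Y o P' T ->
  en (P - P') <= s -> d <= s -> d' <= s -> s <= r0 ->
  Kle Y P P' (2916 * (s * T / e) ^+ 2).
Proof.
move=> pg pg' mo e0 KP KP' PP ds d's sr.
have [[_ u1] PE [d0 _] _ _] := pg; have [[_ u'1] P'E [d'0 _] _ _] := pg'.
have s0 : 0 < s := lt_le_trans d0 ds.
have T0 : 0 < T by have := Kle_ge1 KP; lra.
have h1 := peg_inward pg ds sr; have h2 := peg_inward pg' d's sr.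
have h3 : Kle Y (x + s%:C *: u) (x' + s%:C *: u') (3 ^+ 6).
  apply: (Kle_chain oY cY s0) (peg_ball pg s0 sr) (peg_ball pg' s0 sr) _.
  rewrite (_ : _ - _ = (s - d')%:C *: u' + (- (P - P')) - (s - d)%:C *: u); last first.
    by rewrite PE P'E; apply/rowP => j; rewrite !mxE !rmorphB; ring.
  apply: le_trans (enB _ _) _; rewrite [en (_ *: u)]enZr u1 mulr1 ger0_norm ?subr_ge0//.
  have := enD ((s - d')%:C *: u') (- (P - P')).
  rewrite [en (_ *: u')]enZr u'1 mulr1 ger0_norm ?subr_ge0// enN; lra.
have := Kle_triangle oY cY (Kle_triangle oY cY h1 h3) (KleC h2).
apply: Kle_mono.
have q d1 x1 P1 u1' : peg P1 x1 u1' d1 -> Kle Y o P1 T -> 0 < d1 -> 2 * s / d1 <= 2 * (s * T / e).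
  move=> pg1 K1 d10; have hd := peg_depth_ge pg1 mo e0 K1.
  rewrite (_ : 2 * (s * T / e) = 2 * s / (e / T)); last by field; rewrite !gt_eqF.
  apply: ler_wpM2l; first by rewrite mulr_ge0// ltW.
  by rewrite lef_pV2 ?posrE// divr_gt0.
have q1 := q _ _ _ _ pg KP d0; have q2 := q _ _ _ _ pg' KP' d'0.
have a1 : 0 <= 2 * s / d by rewrite divr_ge0 ?ltW// mulr_gt0.
have a2 : 0 <= 2 * s / d' by rewrite divr_ge0 ?ltW// mulr_gt0.
move: (s * T / e) (2 * s / d) (2 * s / d') q1 q2 a1 a2 => a b b' q1 q2 a1 a2.
have : b * b' <= (2 * a) * (2 * a) by apply: ler_pM.
have -> : b * 3 ^+ 6 * b' = 729 * (b * b') by rewrite -natrX; ring.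
by move: (b * b') => y; lra.
Qed.

(** A chain of bounded length leads from o to the centre of the interior ball at P, and [peg_inward]
    leads from there to P. If d exceeds r0 the chain reaches P itself, and d <= 1 / c keeps C / d
    large enough. *)
Lemma center_bound o (e M : R) : (forall y, Y y -> en y <= M) -> margin Y o e -> 0 < e ->
  exists2 C : R, 0 < C & forall P x u d, Y P -> peg P x u d -> Kle Y o P (C / d).
Proof.
move=> YM mo e0.
have Yo : Y o by apply: mo; rewrite subrr en0.
pose e' := Num.min e r0.
have e'0 : 0 < e' by rewrite lt_min e0.
have e'e : e' <= e by rewrite ge_min lexx.
have e'r : e' <= r0 by rewrite ge_min lexx orbT.
have mono z s : e' <= s -> margin Y z s -> margin Y z e'.
  by move=> es m w wz; apply: m; exact: lt_le_trans es.
have mo' := mono o e e'e mo.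
have [N hN] : exists N : nat, 2 * M <= N%:R * (e' / 2).
  have e2 : 0 < e' / 2 by rewrite divr_gt0.
  exists (Num.Def.archi_bound `|2 * M / (e' / 2)|).
  rewrite -ler_pdivrMr//; apply: le_trans (ler_norm _) (ltW _).
  exact: Num.Theory.archi_boundP (normr_ge0 _).
have chain z : margin Y z e' -> Kle Y o z (3 ^+ N).
  move=> mz; apply: (Kle_chain oY cY e'0 mo' mz); apply: le_trans hN.
  apply: le_trans (enB _ _) _; rewrite mulr2n mulrDl !mul1r lerD//; last exact: YM.
  by apply: YM; apply: mz; rewrite subrr en0.
have N0 : 0 < 3 ^+ N :> R by rewrite exprn_gt0.
exists (3 ^+ N * (2 * r0 + c^-1)) => [|P x u d YP pg].
  by rewrite mulr_gt0// addr_gt0 ?invr_gt0// mulr_gt0.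
have [_ _ [d0 md] mr _] := pg.
have cV : 0 < c^-1 by rewrite invr_gt0.
have [dr|dr] := leP d r0.
  have := Kle_triangle oY cY (chain _ (mono _ _ e'r mr)) (KleC (peg_inward pg dr (lexx _))).
  apply: Kle_mono; rewrite -[X in _ <= X]mulrA ler_pM2l// ler_pM2r ?invr_gt0//; lra.
have := chain _ (mono _ _ (le_trans e'r (ltW dr)) md); apply: Kle_mono.
rewrite -mulrA ler_peMr ?(ltW N0)// ler_pdivlMr// mul1r.
have := peg_depth_le YP pg; lra.
Qed.

End Pegs.

Section Visibility.
Context {R : realType} {n : nat}.
Variables (Y : set 'rV[R[i]]_n) (r0 c : R).
Implicit Types (u v w x y o P Q : 'rV[R[i]]_n) (d s T S C B e : R) (f : R[i] -> 'rV[R[i]]_n).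

Let pos256 : 0 < 256 :> R. Proof. by rewrite ltr0n. Qed.

Lemma gap_le k m : (k <= m)%N -> (k + (maxn k m - minn k m) = m)%N.
Proof. lia. Qed.

(** Stands in for the existence of an extremal disc: T is halved as long as a disc remains, which
    stops because parameters are at least 1. *)
Lemma Kd_halving P Q T : Kd Y P Q T -> exists S, [/\ S <= T, Kd Y P Q S & ~ Kd Y P Q (S / 2)].
Proof.
move=> KT; have [N hN] : exists N, T < 2 ^+ N.
  by exists (Num.Def.archi_bound T); exact: Num.Theory.upper_nthrootP.
elim: N T KT hN => [|N ih] T KT; first by rewrite expr0 ltNge KT.1.
rewrite exprSr => TN; have [K2|K2] := pselect (Kd Y P Q (T / 2)); last by exists T.
have [|S [ST KS nS]] := ih _ K2; first by rewrite ltr_pdivrMr.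
exists S; split => //; apply: le_trans ST _; have := KT.1; lra.
Qed.

Lemma power_bracket S : 1 <= S -> exists N, 256 ^+ N <= S < 256 ^+ N.+1.
Proof.
move=> S1; have : S < 256 ^+ Num.Def.archi_bound S.
  apply: lt_le_trans (Num.Theory.upper_nthrootP (leqnn _)) _.
  by apply: lerXn2r; rewrite ?nnegrE; lra.
elim: (Num.Def.archi_bound S) => [|N ih]; first by rewrite expr0 ltNge S1.
by have [/ih//|NS SN] := ltP S (256 ^+ N); exists N; rewrite NS.
Qed.

Lemma path_up (p : nat -> 'rV[R[i]]_n) (A : R) (i : nat) :
  (forall k, (k < i)%N -> en (p k.+1 - p k) <= A * 2^-1 ^+ k) ->
  en (p i - p 0%N) <= A * (2 - 2 * 2^-1 ^+ i).
Proof.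
elim: i => [|i ih] h; first by rewrite subrr en0 expr0; lra.
apply: le_trans (en_dist_trans _ (p i) _) _.
have := h i (ltnSn i); have := ih (fun k ki => h k (ltnW ki)).
rewrite [2^-1 ^+ i.+1]exprS; move: (2^-1 ^+ i) => a; lra.
Qed.

(** The exponent is |k - m| in natural numbers. From the peak m one geometric series runs in each
    direction, each of sum at most 2 A. *)
Lemma path_small (p : nat -> 'rV[R[i]]_n) (A : R) (m N : nat) : (m <= N)%N ->
  (forall k, (k <= N)%N -> en (p k.+1 - p k) <= A * 2^-1 ^+ (maxn k m - minn k m)) ->
  en (p N.+1 - p 0%N) <= 4 * A.
Proof.
move=> mN h.
have A0 : 0 <= A.
  have := h m mN; rewrite maxnn minnn subnn expr0 mulr1; apply: le_trans; exact: en_ge0.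
apply: le_trans (en_dist_trans _ (p m) _) _.
have up : en (p N.+1 - p m) <= A * 2.
  have := @path_up (fun k => p (m + k)%N) A (N.+1 - m).
  rewrite addn0 subnKC; last exact: leqW.
  move=> /(_ _)/le_trans; apply; last first.
    by apply: ler_wpM2l => //; have : 0 <= 2^-1 ^+ (N.+1 - m) :> R by [rewrite exprn_ge0]; lra.
  move=> k kN; have := h (m + k)%N; rewrite addnS.
  by rewrite (maxn_idPl _) ?leq_addr// (minn_idPr _) ?leq_addr// addKn; apply; lia.
have down : en (p m - p 0%N) <= A * 2.
  have := @path_up (fun k => p (m - k)%N) A m.
  rewrite subnn subn0 enBC => /(_ _)/le_trans; apply; last first.
    by apply: ler_wpM2l => //; have : 0 <= 2^-1 ^+ m :> R by [rewrite exprn_ge0]; lra.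
  move=> k km; rewrite enBC; have := h (m - k.+1)%N.
  rewrite (_ : (m - k.+1).+1 = m - k)%N; last lia.
  rewrite (_ : maxn _ _ - minn _ _ = k.+1)%N; last lia.
  move=> /(_ _)/le_trans; apply; first lia.
  by apply: ler_wpM2l => //; rewrite exprS ler_piMl ?exprn_ge0//; lra.
lra.
Qed.

Hypotheses (oY : eopen Y) (cY : cvx Y) (r00 : 0 < r0) (c0 : 0 < c).
Hypothesis SB : forall P, Y P -> exists x u d, peg Y r0 c P x u d.

(* The points f (tp (256^k)) cut an almost extremal disc f from P to Q into steps of bounded
   length. If d_m is the largest depth, the triangle inequality through o gives
   d_k d_m <= 4 C^2 / 256^|k-m| and d_m^2 <= 8 C^2 / T, so that the square roots of the d_k,
   which bound the steps, decay like B / 2^|k-m|. *)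
Lemma visibility o P Q C B T : 0 < C -> 0 < B ->
  (forall P x u d, Y P -> peg Y r0 c P x u d -> Kle Y o P (C / d)) ->
  32 * C ^+ 4 <= c ^+ 4 * B ^+ 8 * T -> Kle Y P Q T ->
  ~ Kle Y o P (T / 2) -> ~ Kle Y o Q (T / 2) -> en (P - Q) <= 2056 * B.
Proof.
move=> C0 B0 CB hT KPQ nP nQ.
have T1 := Kle_ge1 KPQ.
(* [Kle] reaches only parameters beyond T, so the halving starts at 2 T; this is where S <= 2 T
   comes from. *)
have [|S [ST KS nS]] := @Kd_halving P Q (2 * T); first by apply: KPQ; lra.
have [S1 [f [df fP fQ]]] := KS; have S0 : 0 < S by lra.
have [N /andP[NS SN]] := power_bracket S1.
pose W k : R := 256 ^+ k.
have W0 k : 0 < W k := exprn_gt0 k pos256.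
have W1 k : 1 <= W k by rewrite exprn_ege1//; lra.
pose p k := f (tp (W k))%:C.
have p0 : p 0%N = P by rewrite /p /W expr0 tp1.
have Yp k : Y (p k) by apply: df.2; exact: modulus_tp.
have /choice[d hd] : forall k, exists d, exists x, exists u, peg Y r0 c (p k) x u d.
  by move=> k; have [x [u [d pg]]] := SB (Yp k); exists d, x, u.
have d0 k : 0 < d k by have [x [u [_ _ []]]] := hd k.
have Kop k : Kle Y o (p k) (C / d k) by have [x [u pg]] := hd k; exact: CB pg.
have KPp k : Kle Y P (p k) (W k).
  by have := Kd_points df ltr01 (W1 k); rewrite tp1 fP divr1 => /Kd_Kle.
have KpQ k : W k <= S -> Kle Y (p k) Q (S / W k).
  by move=> WS; have := Kd_points df (W0 k) WS; rewrite fQ => /Kd_Kle.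
have WS k : (k <= N)%N -> W k <= S.
  by move=> kN; apply: le_trans NS; rewrite ler_weXn2l//; lra.
(* Otherwise the path P, p j, o, p (j + i), Q would have parameter C^2 S / (d_j d_{j+i} 256^i) below
   S / 4, against the choice of S. *)
have pair j i : (j + i <= N)%N -> d j * d (j + i)%N * W i <= 4 * C ^+ 2.
  move=> jiN; rewrite leNgt; apply/negP => h; apply: nS.
  have dd : 0 < d j * d (j + i)%N by rewrite mulr_gt0.
  have K1 := Kle_triangle oY cY (KleC (Kop j)) (Kop (j + i)%N).
  have K2 := Kle_triangle oY cY (Kle_triangle oY cY (KPp j) K1) (KpQ _ (WS _ jiN)).
  apply: K2; rewrite /W exprD.
  have Wj : 0 < 256 ^+ j :> R := exprn_gt0 j pos256.
  have Wi : 0 < 256 ^+ i :> R := exprn_gt0 i pos256.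
  rewrite (_ : _ * _ * _ = C ^+ 2 * S / (d j * d (j + i)%N * W i)); last first.
    by rewrite /W; field; rewrite !gt_eqF.
  have dW : 0 < d j * d (j + i)%N * W i by rewrite mulr_gt0.
  rewrite ltr_pdivrMr//.
  have : S * (4 * C ^+ 2) < S * (d j * d (j + i)%N * W i) by rewrite ltr_pM2l.
  have : 0 < S * C ^+ 2 by rewrite mulr_gt0// exprn_gt0.
  lra.
pose m := [arg max_(k > (ord0 : 'I_N.+1)) d k]%O.
have dm k : (k <= N)%N -> d k <= d m.
  rewrite /m; case: Order.TotalTheory.arg_maxP => // k' _ h kN.
  by have := h (Ordinal (kN : (k < N.+1)%N)) isT.
have mN : (m <= N)%N by have := ltn_ord m; rewrite ltnS.
(* The paths from o through p m to P and to Q both have parameter above T / 2, and the product of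
   the two is C^2 S / d_m^2 with S <= 2 T. *)
have dmT : d m ^+ 2 * T <= 8 * C ^+ 2.
  have q1 : T / 2 < C / d m * W m.
    rewrite ltNge; apply/negP => h; apply: nP; apply: (Kle_mono h).
    exact: Kle_triangle (Kop m) (KleC (KPp m)).
  have q2 : T / 2 < C / d m * (S / W m).
    rewrite ltNge; apply/negP => h; apply: nQ; apply: (Kle_mono h).
    exact: Kle_triangle (Kop m) (KpQ _ (WS _ mN)).
  have T2 : 0 <= T / 2 by lra.
  have := ltr_pM T2 T2 q1 q2.
  rewrite (_ : C / d m * W m * _ = C ^+ 2 * S / d m ^+ 2); last first.
    by field; rewrite !gt_eqF.
  rewrite ltr_pdivlMr ?exprn_gt0// => h.
  have : C ^+ 2 * S <= C ^+ 2 * (2 * T) by rewrite ler_pM2l// exprn_gt0.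
  move=> /(lt_le_trans h) {}h.
  rewrite -(ler_pM2r (_ : 0 < T)); last lra.
  by move: h; rewrite (_ : T / 2 * (T / 2) * d m ^+ 2 = d m ^+ 2 * T * T / 4); [lra|field].
(* With i = |k - m| and d_k <= d_m, the two bounds multiply to d_k^4 256^i T <= 32 C^4, so d_k^4
   256^i <= c^4 B^8. Since 256 = 2^8, the eighth root gives the decay 2^-i; this is why the steps
   are powers of 256. *)
have yk k : (k <= N)%N -> Num.sqrt (d k / c) <= B * 2^-1 ^+ (maxn k m - minn k m).
  move=> kN; set i := (_ - _)%N.
  have dW : d m * d k * W i <= 4 * C ^+ 2.
    have [km|mk] := leqP k m.
      have := pair k i; rewrite /i (gap_le km) [d m * _]mulrC; exact.
    by have := pair m i; rewrite /i maxnC minnC (gap_le (ltnW mk)); exact.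
  have d4 : d k ^+ 4 * W i <= c ^+ 4 * B ^+ 8.
    rewrite -(ler_pM2r (_ : 0 < T)); last lra.
    apply: le_trans hT.
    have : d k ^+ 4 * W i * T <= d m ^+ 2 * T * (d m * d k * W i).
      rewrite (_ : d m ^+ 2 * T * _ = d m ^+ 3 * d k * W i * T); last by ring.
      rewrite ler_pM2r; last lra.
      rewrite ler_pM2r// exprSr ler_pM2r// ler_pXn2r ?nnegrE ?(ltW (d0 _))//.
      exact: dm.
    have : d m ^+ 2 * T * (d m * d k * W i) <= 8 * C ^+ 2 * (4 * C ^+ 2).
      by apply: ler_pM => //; rewrite !mulr_ge0 ?exprn_ge0 ?(ltW (d0 _)) ?(ltW (W0 _))//; lra.
    move=> h1 h2; apply: le_trans h2 (le_trans h1 _).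
    by rewrite le_eqVlt; apply/orP; left; apply/eqP; ring.
  rewrite -[2^-1 ^+ i]/(_ ^+ i) exprVn ler_pdivlMr ?exprn_gt0//.
  rewrite -(@ler_pXn2r _ 8) ?nnegrE ?mulr_ge0 ?sqrtr_ge0 ?exprn_ge0 ?(ltW B0)//.
  rewrite exprMn (_ : 8 = 2 * 4)%N// exprM sqr_sqrtr ?divr_ge0 ?(ltW (d0 _)) ?(ltW c0)//.
  rewrite -exprM mulnC exprM (_ : 2 ^+ (2 * 4) = 256 :> R); last by rewrite -natrX.
  rewrite expr_div_n mulrAC ler_pdivrMr ?exprn_gt0// mulrC [X in _ <= X]mulrC.
  by rewrite mulrC.
(* S need not be a power of 256: the last step goes from p N to Q and is the only one that may be
   shorter. *)
pose q k := if (k <= N)%N then p k else Q.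
have step k : (k <= N)%N -> en (q k.+1 - q k) <= 514 * Num.sqrt (d k / c).
  move=> kN; have [g [dg gE]] := disc_shift df (W0 k).
  have g0 : g 0 = p k by have := gE 1 ltr01; rewrite tp1 mul1r.
  have [x [u pg]] := hd k; rewrite -g0 in pg.
  have mv V : 1 <= V -> V <= 256 -> q k.+1 = g (tp V)%:C ->
      en (q k.+1 - q k) <= 514 * Num.sqrt (d k / c).
    move=> V1 V256 ->; rewrite /q kN -g0; apply: disc_move dg pg _ => //.
    rewrite modulus_real ger0_norm ?tp_ge0// (_ : 255 / 257 = tp 256); last by rewrite /tp; congr (_ / _); lra.
    move: V256; rewrite le_eqVlt => /orP[/eqP->//|/tp_lt h]; apply: ltW; apply: h; lra.
  have [kN'|Nk] := ltnP k N.
    apply: (mv 256); [lra|lra|rewrite /q kN' gE; last lra].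
    by rewrite /p /W exprS.
  have {Nk kN}E : k = N by apply/eqP; rewrite eqn_leq kN.
  rewrite E in gE mv *.
  apply: (mv (S / W N)).
  - by rewrite ler_pdivlMr// mul1r.
  - by rewrite ler_pdivrMr// -exprS ltW.
  - by rewrite /q ltnn gE ?divr_gt0// divfK ?gt_eqF.
have := @path_small q (514 * B) m N mN.
have -> : q 0%N = P by rewrite /q leq0n.
have -> : q N.+1 = Q by rewrite /q ltnn.
rewrite enBC => /(_ _)/le_trans; apply; last lra.
move=> k kN; apply: le_trans (step k kN) _.
by rewrite -mulrA; apply: ler_wpM2l; [lra|exact: yk].
Qed.

Lemma no_branching o e M : (forall y, Y y -> en y <= M) -> margin Y o e -> 0 < e ->
  exists T0 : R, forall T P P' Q, T0 <= T ->
    Kle Y o P T -> Kle Y o P' T -> Kle Y P Q T -> Kle Y P' Q T ->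
    ~ Kle Y P P' (T ^+ 2 / 2) -> ~ Kle Y o Q (T / 2) -> False.
Proof.
move=> YM mo e0; have [C C0 CB] := center_bound oY cY r00 c0 YM mo e0.
(* [peg_close] will give 2916 (s T / e)^2, which is below T^2 / 2 because 2916 / 100^2 < 1/2. *)
pose s := Num.min r0 (e / 100).
have s0 : 0 < s by rewrite lt_min r00 divr_gt0.
have sr : s <= r0 by rewrite ge_min lexx.
have se : s <= e / 100 by rewrite ge_min lexx orbT.
(* 4112 = 2 * 2056: the two applications of [visibility] add up to |P - P'| <= s. *)
pose B := s / 4112.
have B0 : 0 < B by rewrite /B; lra.
have cB : 0 < c ^+ 4 * B ^+ 8 by rewrite mulr_gt0// exprn_gt0.
(* The first bound is the hypothesis of [visibility]. The second gives C / s <= T / 2, so that a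
   point deeper than s would be within T / 2 of o. *)
exists (Num.max (32 * C ^+ 4 / (c ^+ 4 * B ^+ 8)) (2 * C / s)) => T P P' Q.
rewrite ge_max ler_pdivrMr// ler_pdivrMr// [T * (_ * _)]mulrC => /andP[hT hs].
move=> KP KP' PQ P'Q nPP' nQ.
have T1 := Kle_ge1 KP.
have nP : ~ Kle Y o P (T / 2).
  move=> K; apply: nPP'; rewrite (_ : _ / 2 = T / 2 * T); last by field.
  exact: Kle_triangle (KleC K) KP'.
have nP' : ~ Kle Y o P' (T / 2).
  move=> K; apply: nPP'; rewrite (_ : _ / 2 = T * (T / 2)); last by field.
  exact: Kle_triangle (KleC KP) K.
have v1 := visibility C0 B0 CB hT PQ nP nQ.
have v2 := visibility C0 B0 CB hT P'Q nP' nQ.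
have PP : en (P - P') <= s.
  apply: le_trans (en_dist_trans _ Q _) _; rewrite (enBC Q); move: v1 v2; rewrite /B; lra.
have depth P1 x u d : peg Y r0 c P1 x u d -> Kle Y o P1 T -> ~ Kle Y o P1 (T / 2) -> d <= s.
  move=> pg K1 nK; have [_ _ [d0 _] _ _] := pg.
  rewrite leNgt; apply/negP => sd; apply: nK; apply: Kle_mono (CB _ _ _ _ (Kle_in K1).2 pg).
  rewrite ler_pdivrMr//; have : T * s <= T * d by rewrite ler_wpM2l ?ltW//; lra.
  by move: hs; lra.
have [x [u [d pg]]] := SB (Kle_in KP).2; have [x' [u' [d' pg']]] := SB (Kle_in KP').2.
apply: nPP'; apply: Kle_mono
  (peg_close oY cY pg pg' mo e0 KP KP' PP (depth _ _ _ _ pg KP nP) (depth _ _ _ _ pg' KP' nP') sr).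
rewrite (_ : s * T / e = s / e * T); last by rewrite mulrAC.
rewrite (exprMn _ (s / e)).
have : (s / e) ^+ 2 <= 100^-1 ^+ 2.
  by rewrite ler_pXn2r ?nnegrE ?divr_ge0 ?(ltW s0) ?(ltW e0)// ler_pdivrMr//; lra.
move: ((s / e) ^+ 2) => a ha.
have : a * T ^+ 2 <= 100^-1 ^+ 2 * T ^+ 2 by apply: ler_wpM2r => //; exact: sqr_ge0.
have : 0 <= T ^+ 2 by exact: sqr_ge0.
by move: (T ^+ 2) (a * _) => y z; lra.
Qed.

End Visibility.

(** * Products and the theorem *)

Section Products.
Context {R : realType} {p : nat} {m : 'I_p -> nat}.

(** A disc into the product is a tuple of discs, and by [Kd_mono], through [Kle], all of them may
    use the same parameter: the distance of a product is the maximum. A factor must exist to supply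
    1 <= T'. *)
Lemma Kle_prod (X : forall j : 'I_p, set 'rV[R[i]]_(m j)) (x x' : 'rV[R[i]]_(\sum_j m j)) T :
  (0 < p)%N -> Kle (prod_domain X) x x' T <->
  forall j, Kle (X j) (submxrow x j) (submxrow x' j) T.
Proof.
move=> p0; split=> [h j T' /h[T1 [f [[hf fX] f0 fT]]]|h T' TT].
  split => //; exists (fun z => submxrow (f z) j); split; [|by rewrite f0|by rewrite fT].
  split => [k z z1|z z1]; last exact: fX.
  rewrite (_ : (fun _ => _) = (fun z => f z 0 (tagnat.Rank j k))); first exact: hf.
  by apply/funext => w; rewrite mxE.
have T'1 : 1 <= T' by have [] := h (Ordinal p0) T' TT.
have hj j : exists f, [/\ disc_in (X j) f, f 0 = submxrow x j & f (tp T')%:C = submxrow x' j].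
  by have [_] := h j T' TT.
pose f j := projT1 (cid (hj j)).
have fP j : [/\ disc_in (X j) (f j), f j 0 = submxrow x j & f j (tp T')%:C = submxrow x' j].
  exact: projT2 (cid (hj j)).
split => //; exists (fun z => \mxrow_j f j z); split.
- split => [k z z1|z z1 j]; last by rewrite mxrowK; have [[_ fX] _ _] := fP j; exact: fX.
  have [[hf _] _ _] := fP (tagnat.sig1 k).
  rewrite (_ : (fun _ => _) = (fun z => f (tagnat.sig1 k) z 0 (tagnat.sig2 k))); first exact: hf.
  by apply/funext => w; rewrite mxE.
- by rewrite -[RHS]submxrowK; apply: eq_mxrow => j; have [_ ->] := fP j.
- by rewrite -[RHS]submxrowK; apply: eq_mxrow => j; have [_ _ ->] := fP j.
Qed.

End Products.

Lemma Kle_kobayashi (R : realType) (m n : nat) (X : set 'rV[R[i]]_m) (Y : set 'rV[R[i]]_n)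
  x x' y y' T : kobayashi Y y y' = kobayashi X x x' -> Kle X x x' T -> Kle Y y y' T.
Proof. by move=> E h; have T1 := Kle_ge1 h; apply/(KleP _ _ _ T1); rewrite E; apply/KleP. Qed.

Section StronglyConvexDomains.
Context {R : realType} {n : nat}.
Variable Y : set 'rV[R[i]]_n.
Hypotheses (n0 : (0 < n)%N) (sY : strongly_convex_C3_domain Y).

Lemma strongly_convex_data : [/\ eopen Y, cvx Y, exists M, forall y, Y y -> en y <= M
  & exists r0 c : R, [/\ 0 < r0, 0 < c & forall P, Y P -> exists x u d, peg Y r0 c P x u d]].
Proof.
have [[_ oY cnY] bY [U [r [[oU bdU rk YU grad] hess]]]] := sY.
have oY' : eopen Y by apply/open_enP.
have oU' : eopen U by apply/open_enP.
have [M _ YM] := bounded_set_en bY.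
have bdE z : bd Y z -> boundary Y z.
  by move=> [cz nz]; split => //; move: oY => /interior_id ->.
have rC : C1_on U r by exact: real_Ck_C1 rk.
have rC2 w : C1_on U (real_derive w r).
  have [_ /(_ w)[_ h]] := rk; exact: (@real_Ck_C1 _ _ 1 U _ h).
have cr : ccont_on U r by exact: real_Ck_cont rk.
have YU' z : U z -> Y z <-> r z < 0.
  move=> Uz; split => [Yz|rz].
    by have : (Y `&` U) z by []; rewrite YU => -[].
  by have : (Y `&` U) z by [rewrite YU]; case.
have bdU' z : bd Y z -> U z by move=> /bdE/bdU.
have grad' z : bd Y z -> exists v, real_derive v r z != 0 by move=> /bdE/grad.
have hess' z : bd Y z -> forall v, real_derive v r z = 0 -> v != 0 -> 0 < qhess r z v.
  by move=> /bdE/hess h v; exact: h.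
have cY : cvx Y := strongly_convex_cvx oY' cnY oU' bdU' cr rC rC2 YU' hess'.
split => //; first by exists M.
exact: (strong_ball oY' cnY YM oU' bdU' cr rC rC2 YU' grad' hess' n0).
Qed.

(** If Q and Q' were almost opposite, Q could not be within T / 2 of o, as Q' is within T of o; then
    [no_branching] gives a contradiction. *)
Lemma strongly_convex_no_branching o : Y o -> exists T0 : R, forall T P P' Q Q', T0 <= T ->
  Kle Y o P T -> Kle Y o P' T -> Kle Y o Q' T -> Kle Y P Q T -> Kle Y P' Q T ->
  ~ Kle Y P P' (T ^+ 2 / 2) -> Kle Y Q Q' (T ^+ 2 / 2).
Proof.
have [oY cY [M YM] [r0 [c [r00 c0 SB]]]] := strongly_convex_data => Yo.
have [e e0 mo] := oY o Yo.
have [T0 hT0] := no_branching oY cY r00 c0 SB YM mo e0.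
exists T0 => T P P' Q Q' TT KP KP' KQ' PQ P'Q nPP'.
apply: contrapT => nQ; apply: (hT0 T P P' Q) => // K; apply: nQ.
rewrite (_ : _ / 2 = T / 2 * T); last by field.
exact: Kle_triangle (KleC K) KQ'.
Qed.

End StronglyConvexDomains.

Theorem theorem1p1 (R : realType) (p q : nat) (hp : (1 <= p)%N) (hq : (1 <= q)%N)
    (m : 'I_p -> nat) (n : 'I_q -> nat)
    (hm : forall j, (1 <= m j)%N) (hn : forall j, (1 <= n j)%N)
    (X : forall j : 'I_p, set 'rV[R[i]]_(m j))
    (Y : forall j : 'I_q, set 'rV[R[i]]_(n j))
    (hX : forall j, bounded_convex_domain (X j))
    (hY : forall j, strongly_convex_C3_domain (Y j))
    (hpq : (q < p)%N) :
  ~ exists phi : 'rV[R[i]]_(\sum_j m j) -> 'rV[R[i]]_(\sum_j n j),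
      isometric_embedding (prod_domain X) (prod_domain Y) phi.
Proof.
move=> [phi [phiY iso]].
have X0 j : X j !=set0 by have [[]] := hX j.
pose o j := projT1 (cid (X0 j)).
have Xo j : X j (o j) := projT2 (cid (X0 j)).
pose O := \mxrow_j o j.
have XO : prod_domain X O by move=> j; rewrite mxrowK.
have hT k : exists T0 : R, forall T P P' Q Q', T0 <= T ->
    Kle (Y k) (submxrow (phi O) k) P T -> Kle (Y k) (submxrow (phi O) k) P' T ->
    Kle (Y k) (submxrow (phi O) k) Q' T -> Kle (Y k) P Q T -> Kle (Y k) P' Q T ->
    ~ Kle (Y k) P P' (T ^+ 2 / 2) -> Kle (Y k) Q Q' (T ^+ 2 / 2).
  by have := strongly_convex_no_branching (hn k) (hY k) (phiY _ XO k); exact.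
have /choice[T0 hT0] := hT.
(* The factor of Y shared by two indices is found only after T is fixed, so T exceeds the thresholds
   of all factors. *)
pose T := \big[Order.max/2]_k T0 k.
have T2 : 2 <= T by exact: bigmax_ge_id.
have TT0 k : T0 k <= T by exact: le_bigmax.
have T1 : 1 < T by lra.
have lines j : exists x : bool -> 'rV[R[i]]_(m j),
    (forall b, Kd (X j) (o j) (x b) T) /\ ~ Kle (X j) (x true) (x false) (T ^+ 2 / 2).
  have [[_ oX _] bX cX] := hX j; have [M _ XM] := bounded_set_en bX.
  have [x1 [x2 [k1 k2 nk]]] :=
    line_points (hm j) ((open_enP _).1 oX) (convex_set_cvx cX) XM (Xo j) T1.
  by exists (fun b => if b then x1 else x2); split => // -[].
pose x j := projT1 (cid (lines j)).
have xT j b : Kd (X j) (o j) (x j b) T by have [h _] := projT2 (cid (lines j)); exact: h.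
have xN j : ~ Kle (X j) (x j true) (x j false) (T ^+ 2 / 2).
  by have [_ h] := projT2 (cid (lines j)).
pose a i b := \mxrow_j (if j == i then x j b else o j).
have oo j : Kle (X j) (o j) (o j) T by apply: Kle_mono (Kle_refl (Xo j)); exact: ltW.
have KOa i b : Kle (prod_domain X) O (a i b) T.
  apply/Kle_prod => // j; rewrite !mxrowK; case: eqP => // _; exact: Kd_Kle.
have Xa i b : prod_domain X (a i b) by have [] := Kle_in (KOa i b).
(* The two points differ in coordinates i and j only, in each of which one of them has the base
   point; the maximum over factors does not add the two distances. *)
have Kaa i j b b' : i != j -> Kle (prod_domain X) (a i b) (a j b') T.
  move=> ij; apply/Kle_prod => // k; rewrite !mxrowK.
  have [->|_] := eqVneq k i; last by case: eqP => // _; exact: Kd_Kle.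
  by rewrite (negPf ij); apply: KleC; exact: Kd_Kle.
have KNa i : ~ Kle (prod_domain X) (a i true) (a i false) (T ^+ 2 / 2).
  by move=> K; have := (@Kle_prod _ _ _ X _ _ _ hp).1 K i; rewrite !mxrowK eqxx; exact: xN.
have img z z' S : prod_domain X z -> prod_domain X z' -> Kle (prod_domain X) z z' S ->
    forall k, Kle (Y k) (submxrow (phi z) k) (submxrow (phi z') k) S.
  by move=> Xz Xz' K; apply/Kle_prod => //; exact: Kle_kobayashi (iso z z' Xz Xz') K.
(* The isometry is used in the reverse direction: closeness in every factor of Y would give
   closeness in X. *)
have sep i : exists k, ~ Kle (Y k) (submxrow (phi (a i true)) k) (submxrow (phi (a i false)) k) (T ^+ 2 / 2).
  apply: contrapT => h; apply: (KNa i).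
  apply: (@Kle_kobayashi _ _ _ (prod_domain Y) (prod_domain X)).
    by apply/esym/iso; exact: Xa.
  by apply/Kle_prod => // k; apply: contrapT => nk; apply: h; exists k.
have /choice[c hc] := sep.
have [i [j [ij cij]]] : exists i j, i != j /\ c i = c j.
  apply: contrapT => h; have inj : injective c.
    by move=> i j cij; apply: contrapT => /eqP ij; apply: h; exists i, j.
  by have := leq_card c inj; rewrite !card_ord leqNgt hpq.
(* The pair of index i plays P, P' and that of index j plays Q, Q'; the lemma then denies the
   separation of the second pair in the shared factor. *)
have := hc j; rewrite -cij; apply.
apply: (hT0 (c i) T (submxrow (phi (a i true)) (c i)) (submxrow (phi (a i false)) (c i))) => //.
- exact: img.
- exact: img.
- exact: img.
- by apply: img => //; exact: Kaa.
- by apply: img => //; exact: Kaa.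
Qed.
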